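(* Let $(M,\omega)$ be a closed spherically monotone symplectic manifold. Then a symplectic circle action on $(M,\omega)$ is Hamiltonian if and only if it has a fixed point.
   Context: $M$ is connected. Spherically monotone means there is a constant $\lambda\in\mathbb{R}\setminus\{0\}$ with $[\omega]|_{\pi_2(M)}=\lambda\cdot c_1(M)|_{\pi_2(M)}$, where $c_1(M)$ is the first Chern class of $(M,\omega)$. A smooth action of $S^1=\mathbb{R}/\mathbb{Z}$ on $M$, generated by the vector field $X$, is symplectic if the $1$-form $\iota_X\omega$ is closed, and Hamiltonian if $\iota_X\omega$ is exact. A fixed point of the action is a point fixed by all of $S^1$. *)

(* Defs.v *)
From HB Require Import structures.
From mathcomp Require Import all_boot all_order all_algebra.
From mathcomp Require Import all_classical all_reals all_analysis.

Set Implicit Arguments.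
Unset Strict Implicit.
Unset Printing Implicit Defensive.

Import Order.TTheory GRing.Theory Num.Theory.
Import numFieldNormedType.Exports.

Local Open Scope classical_set_scope.
Local Open Scope ring_scope.

                                                                       
Fixpoint Ck_on (R : realType) (V W : normedModType R) (k : nat) (U : set V)
    (f : V -> W) : Prop :=
  match k with
  | 0 => forall x, U x -> {for x, continuous f}
  | k'.+1 => (forall x, U x -> differentiable f x) /\
             (forall v : V, Ck_on k' U ('D_v f))
  end.

Definition smooth_on (R : realType) (V W : normedModType R) (U : set V)
    (f : V -> W) : Prop :=
  forall k, Ck_on k U f.

Record chart (R : realType) (n : nat) (M : topologicalType) := Chart {
  chart_dom : set M;
  chart_cod : set 'rV[R]_n;
  coord : M -> 'rV[R]_n;
  param : 'rV[R]_n -> M;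
  open_dom : open chart_dom;
  open_cod : open chart_cod;
  coord_cod : forall p, chart_dom p -> chart_cod (coord p);
  param_dom : forall x, chart_cod x -> chart_dom (param x);
  coordK : forall p, chart_dom p -> param (coord p) = p;
  paramK : forall x, chart_cod x -> coord (param x) = x;
  coord_continuous : forall p, chart_dom p -> {for p, continuous coord};
  param_continuous : forall x, chart_cod x -> {for x, continuous param} }.

                                                                           
              
Record manifold (R : realType) (n : nat) := Manifold {
  carrier :> topologicalType;
  carrier_hausdorff : hausdorff_space carrier;
  carrier_second_countable : @second_countable carrier;
  atlas_index : Type;
  charts : atlas_index -> chart R n carrier;
  chart_at : carrier -> atlas_index;
  chart_at_dom : forall p, chart_dom (charts (chart_at p)) p;
  transition_smooth : forall i j,
    smooth_on (chart_cod (charts i) `&` param (charts i) @^-1` chart_dom (charts j))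
              (coord (charts j) \o param (charts i)) }.

Section Manifold.
Variables (R : realType) (n : nat) (M : manifold R n).

Local Notation I := (atlas_index M).
Local Notation E := 'rV[R]_n.

Definition cdom (i : I) : set M := chart_dom (charts i).
Definition ccod (i : I) : set E := chart_cod (charts i).
Definition ccoord (i : I) : M -> E := coord (charts i).
Definition cparam (i : I) : E -> M := param (charts i).

Definition transition (i j : I) : E -> E := ccoord j \o cparam i.
Definition overlap (i j : I) : set E := ccod i `&` cparam i @^-1` cdom j.

Definition smooth_into (V : normedModType R) (U : set V) (f : V -> M) : Prop :=
  (forall x, U x -> {for x, continuous f}) /\
  (forall i, smooth_on (U `&` f @^-1` cdom i) (ccoord i \o f)).

Definition smooth_function (H : M -> R) : Prop :=
  forall i, smooth_on (ccod i) (H \o cparam i).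

                                                                             
                                                  
Definition tensor1 := I -> E -> E -> R.
Definition tensor2 := I -> E -> E -> E -> R.
Definition vfield := I -> E -> E.
Definition endo := I -> E -> 'M[R]_n.

Definition two_form (w : tensor2) : Prop :=
  [/\ (forall i x, ccod i x ->
         forall (a : R) u v z, w i x (a *: u + v) z = a * w i x u z + w i x v z),
      (forall i x, ccod i x -> forall u v, w i x u v = - w i x v u),
      (forall i u v, smooth_on (ccod i) (fun x => w i x u v)) &
      (forall i j x, overlap i j x -> forall u v,
         w i x u v = w j (transition i j x) ('D_u (transition i j) x)
                                            ('D_v (transition i j) x))].

                                                                            
                               
Definition closed1 (a : tensor1) : Prop :=
  forall i x, ccod i x -> forall u v,
    'D_u (fun y => a i y v) x - 'D_v (fun y => a i y u) x = 0.

Definition exact1 (a : tensor1) : Prop :=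
  exists2 H : M -> R, smooth_function H &
    forall i x, ccod i x -> forall v, a i x v = 'D_v (H \o cparam i) x.

Definition closed2 (w : tensor2) : Prop :=
  forall i x, ccod i x -> forall u v z,
    'D_u (fun y => w i y v z) x + 'D_v (fun y => w i y z u) x
      + 'D_z (fun y => w i y u v) x = 0.

Definition nondegenerate (w : tensor2) : Prop :=
  forall i x, ccod i x -> forall u, (forall v, w i x u v = 0) -> u = 0.

Definition symplectic_form (w : tensor2) : Prop :=
  [/\ two_form w, closed2 w & nondegenerate w].

Definition smooth_endo (J : endo) : Prop :=
  (forall i, smooth_on (ccod i) (J i)) /\
  (forall i j x, overlap i j x -> forall v,
     'D_(v *m J i x) (transition i j) x =
     'D_v (transition i j) x *m J j (transition i j x)).

                                                                         
Definition compatible_acs (w : tensor2) (J : endo) : Prop :=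
  [/\ smooth_endo J,
      (forall i x, ccod i x -> J i x *m J i x = - 1%:M),
      (forall i x, ccod i x -> forall u v,
         w i x (u *m J i x) (v *m J i x) = w i x u v) &
      (forall i x, ccod i x -> forall v, v != 0 -> 0 < w i x v (v *m J i x))].

                                                                             
                                                                            
                                                           
Definition connection_form := I -> E -> E -> 'M[R]_n.

Definition connection (A : connection_form) : Prop :=
  [/\ (forall i x, ccod i x -> forall (a : R) u v,
         A i x (a *: u + v) = a *: A i x u + A i x v),
      (forall i v, smooth_on (ccod i) (fun x => A i x v)) &
      (forall i j x, overlap i j x -> forall v w,
         'D_v ('D_w (transition i j)) x
           + 'D_w (transition i j) x
               *m A j (transition i j x) ('D_v (transition i j) x)
         = 'D_(w *m A i x v) (transition i j) x)].

                                                                        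
                         
Definition unitary_connection (w : tensor2) (J : endo) (A : connection_form)
    : Prop :=
  [/\ connection A,
      (forall i x, ccod i x -> forall v y z,
         'D_v (fun p => w i p y z) x
         = w i x (y *m A i x v) z + w i x y (z *m A i x v)) &
      (forall i x, ccod i x -> forall v,
         'D_v (J i) x = A i x v *m J i x - J i x *m A i x v)].

                                                                       
            
Definition curvature (A : connection_form) (i : I) (x u v : E) : 'M[R]_n :=
  'D_u (fun y => A i y v) x - 'D_v (fun y => A i y u) x
    + A i x v *m A i x u - A i x u *m A i x v.

                                             
                                                                     
                 
Definition chern_form (J : endo) (A : connection_form) : tensor2 :=
  fun i x u v => (4 * pi)^-1 * \tr (curvature A i x u v *m J i x).

                                                                             
                                                                       
Definition represents_c1 (w : tensor2) (c : tensor2) : Prop :=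
  exists (J : endo) (A : connection_form),
    [/\ compatible_acs w J, unitary_connection w J A & c = chern_form J A].

                                                                         
                                                                       
Definition vec3 (a b c : R) : 'rV[R]_3 := \row_k [:: a; b; c]`_k.

Definition unit_sphere : set 'rV[R]_3 :=
  [set x | \sum_k x ord0 k ^+ 2 = 1].

Definition smooth_sphere (u : 'rV[R]_3 -> M) : Prop :=
  exists U : set 'rV[R]_3,
    [/\ open U, unit_sphere `<=` U & smooth_into U u].

Definition spherical (s t : R) : 'rV[R]_3 :=
  vec3 (sin s * cos t) (sin s * sin t) (cos s).

                                                                        
                                                                       
Definition sphere_integral (w : tensor2) (u : 'rV[R]_3 -> M) : R :=
  \int[lebesgue_measure]_(s in `[0, pi])
    \int[lebesgue_measure]_(t in `[0, 2 * pi])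
      let i := chart_at (u (spherical s t)) in
      w i (ccoord i (u (spherical s t)))
        (derive1 (fun s' : R => ccoord i (u (spherical s' t))) s)
        (derive1 (fun t' : R => ccoord i (u (spherical s t'))) t).

                                                                           
                                                                       
                      
Definition spherically_monotone (w : tensor2) : Prop :=
  exists lambda : R, lambda != 0 /\
    exists2 c : tensor2, represents_c1 w c &
      forall u : 'rV[R]_3 -> M, smooth_sphere u ->
        sphere_integral w u = lambda * sphere_integral c u.

                                                               
Definition circle_action (Phi : R -> M -> M) : Prop :=
  [/\ (forall p, Phi 0 p = p),
      (forall s t p, Phi (s + t) p = Phi s (Phi t p)),
      (forall p, Phi 1 p = p) &
      (forall i, smooth_into (V := (R^o * E)%type) (setT `*` ccod i)
                   (fun tx => Phi tx.1 (cparam i tx.2)))].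

Definition generator (Phi : R -> M -> M) : vfield :=
  fun i x => derive1 (fun t : R => ccoord i (Phi t (cparam i x))) 0.

Definition contraction (X : vfield) (w : tensor2) : tensor1 :=
  fun i x v => w i x (X i x) v.

Definition symplectic_action (w : tensor2) (Phi : R -> M -> M) : Prop :=
  circle_action Phi /\ closed1 (contraction (generator Phi) w).

Definition hamiltonian_action (w : tensor2) (Phi : R -> M -> M) : Prop :=
  circle_action Phi /\ exact1 (contraction (generator Phi) w).

Definition fixed_point (Phi : R -> M -> M) (p : M) : Prop :=
  forall t, Phi t p = p.

End Manifold.

(* Main.v *)
(* Let X generate the action and let alpha be the closed form iota_X omega.

   If alpha = dH, then H has a maximum p by compactness; alpha, hence X,
   vanishes at p, and p is fixed.

   Conversely let p be fixed, and let gamma be a loop at p which is constant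
   near its ends. Moving gamma by the action sweeps out a smooth sphere u,
   because the two ends of gamma stay at p. The action preserves omega, so the
   integral of omega over u is, up to a constant, the integral of alpha along
   gamma. By monotonicity it is also lambda times the integral over u of the
   Chern form c of some compatible J and unitary connection A, and this second
   integral vanishes. Indeed let L_t be the differential at x of the time t
   map and E_t = L_t - J_x L_t J (matrices act on row vectors); E_t is
   invertible since J is tamed by omega and L_t is symplectic, and it
   intertwines J_x with J. In the frame E_t the connection is complex linear,
   so its curvature is, in trace against J, an exact differential; averaging
   its dt-component over the period gives a function mu on M whose derivative
   is the average of iota_X of the pullbacks of c. As gamma is a loop, mu
   takes the same value at its ends.

   So alpha integrates to 0 along all loops at p, and M is connected: alpha is
   exact. *)

Require Import Defs.
From HB Require Import structures.
From mathcomp Require Import all_boot all_order all_algebra.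
From mathcomp Require Import all_classical all_reals all_analysis.
From mathcomp Require Import ring lra.

Set Implicit Arguments.
Unset Strict Implicit.
Unset Printing Implicit Defensive.

Import Order.TTheory GRing.Theory Num.Theory.
Import numFieldNormedType.Exports.

Local Open Scope classical_set_scope.
Local Open Scope ring_scope.

(** * Calculus of C^k maps *)

(** Monotonicity gives an equality of integrals for one form [c], built from some [J] and [A] that
    need not be invariant under the action. The integral of [c] over u therefore has to be computed,
    and L_t, which does not commute with [J], is of no use as a complex frame; E_t is twice its
    complex linear part. It identifies the tangent space at the moved point with the one at x, whose
    complex structure varies with x but not with t. This is enough: the derivative of J_x in a space
    direction is a commutator with the connection matrix, and under the trace it cancels the
    quadratic term of the curvature. There results a one-form [theta] on time-space patches whose
    exterior derivative, on planes containing the time direction, is [4 * pi] times the pullback of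
    [c]. Its dt-component does not depend on charts; its space components depend on the source
    chart, but they are periodic in t, so that their time derivative integrates to 0.

    Longitude on the sphere has period [2 * pi] and the action has period 1, whence flows without a
    prescribed period. Loops live on the whole line and are constant outside [[0, 1]], so that u is
    constant on two polar caps. *)

Section DifferentiableNear.
Variables (R : realType) (V W : normedModType R).
Implicit Types (f g : V -> W).

Lemma near_translate (P : V -> Prop) x :
  (\forall y \near x, P y) -> \forall h \near 0, P (h + x).
Proof.
have : (h + x) @[h --> (0 : V)] --> 0 + x by apply: cvgD; [exact: cvg_id|exact: cvg_cst].
by rewrite add0r => H Px; exact: H.
Qed.

(** Serves where the differential is guessed first and an estimate is at hand: for two maps with the
    same germ, for [flat] at 0, and for the potential of a one-form. *)
Lemma is_diff_eps f x (df : {linear V -> W}) : continuous df ->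
  (forall e, 0 < e -> \forall h \near 0, `|f (h + x) - f x - df h| <= e * `|h|) ->
  is_diff x f df.
Proof.
move=> dfc H.
have E : f \o shift x = cst (f x) + df +o_ 0 id.
  apply/eqaddoP => e e0; near=> h.
  rewrite -![(_ + _ : _ -> _) _]/(_ + _) -![(- _ : _ -> _) _]/(- _) /=.
  by rewrite /cst opprD addrA; near: h; exact: H.
have D := diff_unique dfc E; apply: DiffDef => //.
by apply/diff_locallyP; rewrite D.
Unshelve. all: by end_near. Qed.

Lemma differentiable_near f g x :
  {near x, f =1 g} -> differentiable f x -> differentiable g x.
Proof.
move=> fg df; apply: (@ex_diff _ _ _ _ _ _ _ (@is_diff_eps _ _ ('d f x) _ _)).
  exact: diff_continuous.
move=> e e0.
have [_ /eqaddoP /(_ _ e0) H] := (diff_locallyP _ _).1 df.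
have := near_translate fg; apply: filterS2 H => h.
rewrite -![(_ + _ : _ -> _) _]/(_ + _) -![(- _ : _ -> _) _]/(- _) /=.
by rewrite -(nbhs_singleton fg) => + <-; rewrite /cst opprD addrA.
Qed.
End DifferentiableNear.

Section Ck.
Variables (R : realType).
Implicit Types (U V W Z : normedModType R).

Lemma open_near (T : topologicalType) (U : set T) x (P : T -> Prop) : open U -> U x ->
  (forall y, U y -> P y) -> \forall y \near x, P y.
Proof. by move=> oU Ux H; apply: filterS (open_nbhs_nbhs (conj oU Ux)). Qed.

Lemma Ck_on_sub V W k (A B : set V) (f : V -> W) :
  A `<=` B -> Ck_on k B f -> Ck_on k A f.
Proof.
elim: k f => [|k IH] f AB /=; first by move=> H x /AB; exact: H.
by move=> [H1 H2]; split=> [x /AB|v]; [exact: H1|exact: IH].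
Qed.

(** Directional derivatives depend only on the germ of [f], so each pass of the induction hands the
    same open set over to ['D_v f]. *)
Lemma Ck_on_local V W k (A : set V) (f : V -> W) :
  (forall x, A x -> exists B g, [/\ open B, B x, Ck_on k B g & {in B, f =1 g}]) ->
  Ck_on k A f.
Proof.
elim: k f => [|k IH] f H /=.
  move=> x /H[B [g [oB Bx cg fg]]].
  have fgx : \forall y \near x, g y = f y.
    by apply: (open_near oB Bx) => y By; rewrite fg// inE.
  rewrite /prop_for /continuous_at -(nbhs_singleton fgx).
  exact: cvg_trans (near_eq_cvg fgx) (cg x Bx).
split=> [x /H[B [g [oB Bx [cg _] fg]]]|v].
  apply: differentiable_near (cg x Bx).
  by apply: (open_near oB Bx) => y By; rewrite fg// inE.
apply: IH => x /H[B [g [oB Bx [_ cg] fg]]].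
exists B, ('D_v g); split=> //; first exact: cg.
move=> y; rewrite inE => By.
apply: near_eq_derive; apply: (open_near oB By) => z Bz; by rewrite fg// inE.
Qed.

Lemma Ck_on_eq V W k (A : set V) (f g : V -> W) : open A ->
  {in A, f =1 g} -> Ck_on k A g -> Ck_on k A f.
Proof. by move=> oA fg cg; apply: Ck_on_local => x Ax; exists A, g; split. Qed.

Lemma Ck_onS V W k (A : set V) (f : V -> W) : Ck_on k.+1 A f -> Ck_on k A f.
Proof.
elim: k f => [|k IH] f [df H]; first by move=> x /df; exact: differentiable_continuous.
by split=> // v; apply: IH.
Qed.

Lemma Ck_on_cst V W k (A : set V) (c : W) : Ck_on k A (cst c : V -> W).
Proof.
elim: k c => [|k IH] c; first by move=> x _; exact: cst_continuous.
split=> [x _|v]; first exact: differentiable_cst.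
by rewrite (_ : 'D_v (cst c) = cst 0)//; apply/funext => x; rewrite derive_cst.
Qed.

Lemma Ck_on_lin V W k (A : set V) (l : {linear V -> W}) :
  continuous l -> Ck_on k A l.
Proof.
case: k => [|k] cl; first by move=> x _; exact: cl.
split=> [x _|v]; first exact: linear_differentiable.
rewrite (_ : 'D_v l = cst (l v)); first exact: Ck_on_cst.
apply/funext => x; rewrite deriveE; last exact: linear_differentiable.
by rewrite diff_lin.
Qed.

Lemma Ck_on_lincomp V W Z k (A : set V) (l : {linear W -> Z}) (f : V -> W) :
  open A -> continuous l -> Ck_on k A f -> Ck_on k A (l \o f).
Proof.
move=> oA cl; elim: k f => [|k IH] f.
  by move=> cf x Ax; apply: continuous_comp; [exact: cf|exact: cl].
move=> [df cf]; split=> [x Ax|v].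
  by apply: differentiable_comp; [exact: df|apply: linear_differentiable; exact: cl].
apply: (@Ck_on_eq _ _ _ _ _ (l \o 'D_v f)) => //; last exact: IH (cf v).
move=> x; rewrite inE => Ax.
rewrite deriveE; last first.
  by apply: differentiable_comp; [exact: df|apply: linear_differentiable; exact: cl].
rewrite diff_comp; [|exact: df|apply: linear_differentiable; exact: cl].
by rewrite /= diff_lin// deriveE//; exact: df.
Qed.

Lemma Ck_onD V W k (A : set V) (f g : V -> W) :
  open A -> Ck_on k A f -> Ck_on k A g -> Ck_on k A (fun x => f x + g x).
Proof.
move=> oA; elim: k f g => [|k IH] f g.
  by move=> cf cg x Ax; apply: continuousD; [exact: cf|exact: cg].
move=> [df cf] [dg cg]; split=> [x Ax|v].
  by apply: differentiableD; [exact: df|exact: dg].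
apply: (@Ck_on_eq _ _ _ _ _ (fun x => 'D_v f x + 'D_v g x)) => //; last exact: IH (cf v) (cg v).
by move=> x /[!inE] Ax; rewrite deriveD//; apply: diff_derivable; [exact: df|exact: dg].
Qed.

Lemma Ck_onN V W k (A : set V) (f : V -> W) :
  open A -> Ck_on k A f -> Ck_on k A (fun x => - f x).
Proof.
move=> oA; elim: k f => [|k IH] f.
  by move=> cf x Ax; apply: continuousN; exact: cf.
move=> [df cf]; split=> [x Ax|v]; first by apply: differentiableN; exact: df.
apply: (@Ck_on_eq _ _ _ _ _ (fun x => - 'D_v f x)) => //; last exact: IH (cf v).
by move=> x /[!inE] Ax; rewrite deriveN//; apply: diff_derivable; exact: df.
Qed.

Lemma Ck_onB V W k (A : set V) (f g : V -> W) :
  open A -> Ck_on k A f -> Ck_on k A g -> Ck_on k A (fun x => f x - g x).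
Proof. by move=> oA cf cg; apply: Ck_onD => //; exact: Ck_onN. Qed.

Lemma Ck_on_sum V W k (A : set V) n (f : 'I_n -> V -> W) :
  open A -> (forall i, Ck_on k A (f i)) -> Ck_on k A (fun x => \sum_(i < n) f i x).
Proof.
move=> oA; elim: n f => [|n IH] f cf.
  rewrite (_ : (fun _ => _) = cst 0); first exact: Ck_on_cst.
  by apply/funext => x; rewrite big_ord0.
rewrite (_ : (fun _ => _) = (fun x => \sum_(i < n) f (widen_ord (leqnSn n) i) x + f ord_max x)).
  by apply: Ck_onD => //; exact: IH.
by apply/funext => x; rewrite big_ord_recr.
Qed.

Lemma Ck_onM V k (A : set V) (f g : V -> R) :
  open A -> Ck_on k A f -> Ck_on k A g -> Ck_on k A (fun x => f x * g x).
Proof.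
move=> oA; elim: k f g => [|k IH] f g.
  by move=> cf cg x Ax; apply: continuousM; [exact: cf|exact: cg].
move=> cf' cg'; have [df cf] := cf'; have [dg cg] := cg'; split=> [x Ax|v].
  by apply: differentiableM; [exact: df|exact: dg].
apply: (@Ck_on_eq _ _ _ _ _ (fun x => f x * 'D_v g x + g x * 'D_v f x)) => //.
  by move=> x /[!inE] Ax; rewrite deriveM//; apply: diff_derivable; [exact: df|exact: dg].
by apply: Ck_onD => //; apply: IH; [exact: Ck_onS|exact: cg|exact: Ck_onS|exact: cf].
Qed.

Lemma Ck_onZl V W k (A : set V) (f : V -> R) (w : W) :
  open A -> Ck_on k A f -> Ck_on k A (fun x => f x *: w).
Proof.
move=> oA; elim: k f => [|k IH] f.
  move=> cf x Ax; apply: (@continuous_comp _ _ _ f ( *:%R^~ w)); [exact: cf|exact: scalel_continuous].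
move=> [df cf]; split=> [x Ax|v]; first by apply: differentiableZl; exact: df.
apply: (@Ck_on_eq _ _ _ _ _ (fun x => 'D_v f x *: w)) => //; last exact: IH (cf v).
move=> x /[!inE] Ax; rewrite deriveE; last by apply: differentiableZl; exact: df.
by rewrite diffZl; [rewrite /= deriveE//|]; exact: df.
Qed.

Lemma Ck_onV V k (A : set V) (f : V -> R) :
  open A -> (forall x, A x -> f x != 0) -> Ck_on k A f ->
  Ck_on k A (fun x => (f x)^-1).
Proof.
move=> oA f0; elim: k => [|k IH].
  by move=> cf x Ax; apply: continuousV; [exact: f0|exact: cf].
move=> cf'; have [df cf] := cf'; have {}IH := IH (Ck_onS cf').
split=> [x Ax|v].
  by apply: differentiableV; [exact: df|exact: f0].
apply: (@Ck_on_eq _ _ _ _ _ (fun x => - (((f x)^-1 * (f x)^-1) * 'D_v f x))) => //.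
  move=> x /[!inE] Ax; rewrite deriveV//; [|exact: f0|by apply: diff_derivable; exact: df].
  by rewrite -exprVn expr2 scaleNr.
by apply: Ck_onN => //; apply: Ck_onM => //; [exact: Ck_onM|exact: cf].
Qed.

(** Raises regularity by one through a known derivative formula; this is how [sin], [cos], [atan]
    and [flat] become smooth. *)
Lemma Ck_on1R k (A : set R) (f g : R -> R) : open A ->
  (forall x, A x -> is_derive x 1 f (g x)) -> Ck_on k A g -> Ck_on k.+1 A f.
Proof.
move=> oA dfg cg; have df x : A x -> differentiable f x.
  by move=> Ax; apply/derivable1_diffP; have [] := dfg x Ax.
split=> // v; apply: (@Ck_on_eq _ _ _ _ _ (fun x => v * g x)) => //.
  move=> x /[!inE] Ax; rewrite deriveE; last exact: df.
  rewrite -[v in LHS]mulr1 -[v * 1]/(v *: (1 : R)) linearZ -deriveE; last exact: df.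
  by have [_ ->] := dfg x Ax.
by apply: Ck_onM => //; exact: Ck_on_cst.
Qed.

End Ck.

(** * Finite-dimensional spaces: chain rule and matrix calculus *)

Section FiniteDim.
Variables (R : realType).
Implicit Types (U V W Z : normedModType R).

Definition linear_of V W (l : V -> W) (Hl : linear l) : {linear V -> W} :=
  HB.pack l (GRing.isLinear.Build R V W *:%R l Hl).

(** Continuous coordinates are what allows a derivative along a moving direction to be split into
    derivatives along fixed ones. *)
Definition findim W := exists m (e : 'I_m -> W) (c : 'I_m -> {linear W -> R}),
  (forall i, continuous (c i)) /\ forall w, w = \sum_(i < m) c i w *: e i.

Lemma findim_R : findim R.
Proof.
exists 1%N, (fun=> 1), (fun=> idfun); split=> [_ x|w]; first exact: cvg_id.
by rewrite big_ord1; exact/esym/mulr1.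
Qed.

Lemma findim_mx m n : findim 'M[R]_(m, n).
Proof.
have L i j : linear (fun A : 'M[R]_(m, n) => A i j : R).
  by move=> a A B; rewrite !mxE.
exists #|{: 'I_m * 'I_n}|, (fun k => delta_mx (enum_val k).1 (enum_val k).2),
  (fun k => linear_of (L (enum_val k).1 (enum_val k).2)); split=> [i|A].
  exact: coord_continuous.
rewrite [LHS]matrix_sum_delta pair_big /=.
rewrite (reindex (@enum_val _ {: 'I_m * 'I_n})) /=; last exact/onW_bij/enum_val_bij.
by apply: eq_bigr.
Qed.

Lemma findim_prod V W : findim V -> findim W -> findim (V * W)%type.
Proof.
move=> [m [e [c [cc cE]]]] [m' [e' [c' [cc' cE']]]].
have L (i : 'I_(m + m')) : linear (fun w : V * W => match fintype.split i with inl j => c j w.1 | inr j => c' j w.2 end : R).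
  by move=> a [v w] [v' w']; case: fintype.split => j /=; rewrite linearP.
exists (m + m')%N, (fun i => match fintype.split i with inl j => (e j, 0) | inr j => (0, e' j) end),
  (fun i => linear_of (L i)); split=> [i|[v w]].
  rewrite /linear_of /= => x.
  case: (fintype.split i) => j.
    by apply: (@continuous_comp _ _ _ fst (c j)); [exact: cvg_fst|exact: cc].
  by apply: (@continuous_comp _ _ _ snd (c' j)); [exact: cvg_snd|exact: cc'].
rewrite big_split_ord /=.
under eq_bigr do rewrite (unsplitK (inl _)).
under [X in _ = _ + X]eq_bigr do rewrite (unsplitK (inr _)).
have Dp (a : R) (v' : V) (w' : W) : a *: ((v', w') : V * W) = (a *: v', a *: w') by [].
have S1 : \sum_(i < m) c i v *: ((e i, 0) : V * W) = (v, 0).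
  rewrite [in RHS](cE v); elim/big_rec2 : _ => // i a b _ ->.
  by rewrite Dp scaler0; congr pair; rewrite /= addr0.
have S2 : \sum_(i < m') c' i w *: ((0, e' i) : V * W) = (0, w).
  rewrite [in RHS](cE' w); elim/big_rec2 : _ => // i a b _ ->.
  by rewrite Dp scaler0; congr pair; rewrite /= addr0.
by rewrite S1 S2; congr pair; rewrite /= ?addr0 ?add0r.
Qed.

Lemma findim_continuous V W (l : {linear V -> W}) : findim V -> continuous l.
Proof.
move=> [m [e [c [cc cE]]]].
rewrite (_ : (l : V -> W) = fun v => \sum_(i < m) c i v *: l (e i)).
  have H : Ck_on 0 setT (fun v => \sum_(i < m) c i v *: l (e i)).
    apply: Ck_on_sum => [|i]; first exact: openT.
    by apply: Ck_onZl; [exact: openT|exact: Ck_on_lin].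
  by move=> x; exact: (H x I).
by apply/funext => v; rewrite [in LHS](cE v) linear_sum; apply: eq_bigr => i _; rewrite linearZ.
Qed.

Lemma Ck_on_coordP V W k (A : set V) (f : V -> W) m (e : 'I_m -> W) (c : 'I_m -> {linear W -> R}) :
  open A -> (forall w, w = \sum_(i < m) c i w *: e i) ->
  (forall i, Ck_on k A (c i \o f)) -> Ck_on k A f.
Proof.
move=> oA cE cf; rewrite (_ : f = fun x => \sum_(i < m) c i (f x) *: e i).
  by apply: Ck_on_sum => // i; apply: Ck_onZl => //; exact: cf.
by apply/funext => x; exact: cE.
Qed.

Lemma derive_comp V W Z (f : V -> W) (g : W -> Z) x v :
  differentiable f x -> differentiable g (f x) ->
  'D_v (g \o f) x = 'D_('D_v f x) g (f x).
Proof.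
move=> df dg; rewrite deriveE; last exact: differentiable_comp.
by rewrite diff_comp//= !deriveE.
Qed.

Lemma derive_linear V W (f : V -> W) x (a : R) u v : differentiable f x ->
  'D_(a *: u + v) f x = a *: 'D_u f x + 'D_v f x.
Proof. by move=> df; rewrite !deriveE// linearP. Qed.

(** The chain rule differentiates [g] along ['D_v f x], which moves with [x], whereas [Ck_on]
    controls fixed directions only. Expanding the direction in a basis gives a sum of products to
    which the induction applies. *)
Lemma Ck_on_compR V W k (A : set V) (B : set W) (f : V -> W) (g : W -> R) :
  findim W -> open A -> (forall x, A x -> B (f x)) ->
  Ck_on k A f -> Ck_on k B g -> Ck_on k A (g \o f).
Proof.
move=> fW oA AB; have [m [e [c [cc cE]]]] := fW.
elim: k g => [|k IH] g.
  by move=> cf cg x Ax; apply: continuous_comp; [exact: cf|apply: cg; exact: AB].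
move=> cf' cg'; have [df cf] := cf'; have [dg cg] := cg'; split=> [x Ax|v].
  by apply: differentiable_comp; [exact: df|apply: dg; exact: AB].
apply: (@Ck_on_eq _ _ _ _ _ _ (fun x => \sum_(i < m) c i ('D_v f x) * 'D_(e i) g (f x))) => //.
  move=> x /[!inE] Ax; rewrite derive_comp//; [|exact: df|by apply: dg; exact: AB].
  rewrite [X in 'D_X g _](cE ('D_v f x)) deriveE; last by apply: dg; exact: AB.
  rewrite linear_sum; apply: eq_bigr => i _.
  rewrite linearZ; congr (_ * _); rewrite [RHS]deriveE//; apply: dg; exact: AB.
apply: Ck_on_sum => // i; apply: Ck_onM => //.
  by apply: (@Ck_on_lincomp _ _ _ _ k A (c i) ('D_v f)) => //; exact: cf.
by apply: (IH ('D_(e i) g)); [exact: Ck_onS|exact: cg].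
Qed.

Lemma Ck_on_comp V W Z k (A : set V) (B : set W) (f : V -> W) (g : W -> Z) :
  findim W -> findim Z -> open A -> open B -> (forall x, A x -> B (f x)) ->
  Ck_on k A f -> Ck_on k B g -> Ck_on k A (g \o f).
Proof.
move=> fW [m [e [c [cc cE]]]] oA oB AB cf cg.
apply: (Ck_on_coordP oA cE) => i; rewrite -[_ \o _]/((c i \o g) \o f).
by apply: Ck_on_compR AB cf _ => //; exact: Ck_on_lincomp.
Qed.

Lemma Ck_on_bigsum V k (A : set V) I (r : seq I) (f : I -> V -> R) :
  open A -> (forall i, Ck_on k A (f i)) -> Ck_on k A (fun x => \sum_(i <- r) f i x).
Proof.
move=> oA cf; elim: r => [|i r IH].
  by rewrite (_ : (fun _ => _) = cst 0); [exact: Ck_on_cst|apply/funext => x; rewrite big_nil].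
rewrite (_ : (fun _ => _) = fun x => f i x + \sum_(i <- r) f i x); first exact: Ck_onD.
by apply/funext => x; rewrite big_cons.
Qed.

Lemma Ck_on_bigprod V k (A : set V) I (r : seq I) (f : I -> V -> R) :
  open A -> (forall i, Ck_on k A (f i)) -> Ck_on k A (fun x => \prod_(i <- r) f i x).
Proof.
move=> oA cf; elim: r => [|i r IH].
  by rewrite (_ : (fun _ => _) = cst 1); [exact: Ck_on_cst|apply/funext => x; rewrite big_nil].
rewrite (_ : (fun _ => _) = fun x => f i x * \prod_(i <- r) f i x); first exact: Ck_onM.
by apply/funext => x; rewrite big_cons.
Qed.

Section Matrices.
Variables (V : normedModType R) (k : nat) (A : set V).
Hypothesis oA : open A.

Lemma Ck_on_mxP m n (f : V -> 'M[R]_(m, n)) :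
  Ck_on k A f <-> forall i j, Ck_on k A (fun x => f x i j).
Proof.
have L i j : linear (fun A : 'M[R]_(m, n) => A i j : R) by move=> a B C; rewrite !mxE.
split=> [cf i j|cf].
  by apply: (@Ck_on_lincomp _ _ _ _ _ _ (linear_of (L i j))) => //; exact: coord_continuous.
have [p [e [c [cc cE]]]] := findim_mx m n.
apply: (Ck_on_coordP oA cE) => i.
rewrite (_ : _ \o _ = fun x => \sum_(a < m) \sum_(b < n) f x a b * c i (delta_mx a b)).
  by do 2![apply: Ck_on_sum => // ?]; apply: Ck_onM => //; exact: Ck_on_cst.
apply/funext => x /=; rewrite [X in c i X]matrix_sum_delta linear_sum.
apply: eq_bigr => a _; rewrite linear_sum; apply: eq_bigr => b _.
by rewrite linearZ.
Qed.

Lemma Ck_on_mulmx m n p (f : V -> 'M[R]_(m, n)) (g : V -> 'M[R]_(n, p)) :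
  Ck_on k A f -> Ck_on k A g -> Ck_on k A (fun x => f x *m g x).
Proof.
move=> /Ck_on_mxP cf /Ck_on_mxP cg; apply/Ck_on_mxP => i j.
rewrite (_ : (fun _ => _) = fun x => \sum_l f x i l * g x l j).
  by apply: Ck_on_sum => // l; exact: Ck_onM.
by apply/funext => x; rewrite mxE.
Qed.

Lemma Ck_on_tr n (f : V -> 'M[R]_n) : Ck_on k A f -> Ck_on k A (fun x => \tr (f x)).
Proof. by move=> /Ck_on_mxP cf; rewrite /mxtrace; apply: Ck_on_sum. Qed.

Lemma Ck_on_det n (f : V -> 'M[R]_n) : Ck_on k A f -> Ck_on k A (fun x => \det (f x)).
Proof.
move=> /Ck_on_mxP cf; rewrite /determinant; apply: Ck_on_bigsum => // s.
by apply: Ck_onM => //; [exact: Ck_on_cst|apply: Ck_on_bigprod].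
Qed.

Lemma Ck_on_invmx n (f : V -> 'M[R]_n) : (forall x, A x -> f x \in unitmx) ->
  Ck_on k A f -> Ck_on k A (fun x => invmx (f x)).
Proof.
move=> fu cf; apply: (@Ck_on_eq _ _ _ _ _ _ (fun x => (\det (f x))^-1 *: \adj (f x))) => //.
  by move=> x /[!inE] Ax; rewrite /invmx fu.
apply/Ck_on_mxP => i j.
rewrite (_ : (fun _ => _) = fun x => (\det (f x))^-1 * cofactor (f x) j i); last first.
  by apply/funext => x; rewrite !mxE.
apply: Ck_onM => //.
  apply: Ck_onV => // [x Ax|]; last exact: Ck_on_det.
  by have := fu x Ax; rewrite unitmxE unitfE.
rewrite /cofactor; apply: Ck_onM => //; first exact: Ck_on_cst.
apply: Ck_on_det; apply/Ck_on_mxP => a b.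
rewrite (_ : (fun _ => _) = fun x => f x (lift j a) (lift i b)); first exact: (Ck_on_mxP f).1.
by apply/funext => x; rewrite !mxE.
Qed.

End Matrices.

Lemma derive_entry V m n (f : V -> 'M[R]_(m, n)) x v i j : derivable f x v ->
  'D_v f x i j = 'D_v (fun y => f y i j) x.
Proof. by move=> df; rewrite derive_mx// mxE. Qed.

Lemma derivable_mulmx V m n p (f : V -> 'M[R]_(m, n)) (g : V -> 'M[R]_(n, p)) x v :
  derivable f x v -> derivable g x v -> derivable (fun y => f y *m g y) x v.
Proof.
move=> /derivable_mxP df /derivable_mxP dg; apply/derivable_mxP => i j.
rewrite (_ : (fun _ => _) = \sum_l ((fun y => f y i l) * (fun y => g y l j))).
  by apply: derivable_sum => l; apply: derivableM.
by apply/funext => y; rewrite mxE fct_sumE.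
Qed.

Lemma derive_mulmx V m n p (f : V -> 'M[R]_(m, n)) (g : V -> 'M[R]_(n, p)) x v :
  derivable f x v -> derivable g x v ->
  'D_v (fun y => f y *m g y) x = 'D_v f x *m g x + f x *m 'D_v g x.
Proof.
move=> df dg; have df' := (derivable_mxP _ _ _).1 df; have dg' := (derivable_mxP _ _ _).1 dg.
apply/matrixP => i j; rewrite derive_entry; last exact: derivable_mulmx.
rewrite (_ : (fun _ => _) = \sum_l ((fun y => f y i l) * (fun y => g y l j))); last first.
  by apply/funext => y; rewrite mxE fct_sumE.
rewrite derive_sum; last by move=> l; apply: derivableM.
rewrite !mxE -big_split; apply: eq_bigr => l _ /=.
by rewrite deriveM// !derive_entry// [RHS]addrC; congr (_ + _); exact: mulrC.
Qed.

Lemma derive_trace V n (f : V -> 'M[R]_n) x v : derivable f x v ->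
  'D_v (fun y => \tr (f y)) x = \tr ('D_v f x).
Proof.
move=> df; have df' := (derivable_mxP _ _ _).1 df.
rewrite (_ : (fun _ => _) = \sum_l (fun y => f y l l)); last first.
  by apply/funext => y; rewrite fct_sumE.
by rewrite derive_sum//; apply: eq_bigr => l _; rewrite derive_entry.
Qed.

End FiniteDim.

(** * Mean value arguments, symmetry of second derivatives, antiderivatives *)

Section OneVariable.
Variables (R : realType).
Implicit Types (V W : normedModType R).

Lemma differentiable_line V (x v : V) (s : R) : differentiable (fun s : R => x + s *: v) s.
Proof.
have := @differentiableD _ _ _ (cst x : R -> V) (fun s : R => s *: v) s.
exact.
Qed.

Lemma derive_line V (x v : V) (s w : R) : 'D_w (fun s : R => x + s *: v) s = w *: v.
Proof.
rewrite deriveE; last exact: differentiable_line.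
have H1 : differentiable (cst x : R -> V) s by exact: differentiable_cst.
have D2 := is_diff_scalel s v.
have H2 : differentiable (fun s : R => s *: v) s by exact: (@ex_diff _ _ _ _ _ _ _ D2).
have /(congr1 (fun f => f w)) E := @diffD _ _ _ (cst x : R -> V) (fun s : R => s *: v) s H1 H2.
apply: (etrans E) => /=.
have -> : 'd (cst x : R -> V) s w = 0 by rewrite diff_cst.
by rewrite add0r (@diff_val _ _ _ _ _ _ _ D2).
Qed.

Lemma is_derive_along V W (f : V -> W) (x v : V) (s : R) : differentiable f (x + s *: v) ->
  is_derive s 1 (fun s : R => f (x + s *: v)) ('D_v f (x + s *: v)).
Proof.
move=> df; have dl := differentiable_line x v s.
apply: DeriveDef.
  by apply: diff_derivable; exact: (@differentiable_comp _ _ _ _ (fun s : R => x + s *: v) f).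
rewrite (@derive_comp _ _ _ _ (fun s : R => x + s *: v) f)//.
by rewrite derive_line scale1r.
Qed.

Lemma is_derive_continuous (f : R -> R) (x v : R) : is_derive x 1 f v -> {for x, continuous f}.
Proof. by move=> [df _]; apply: differentiable_continuous; exact/derivable1_diffP. Qed.

Lemma MVT_ge (f g : R -> R) (a b : R) : a <= b ->
  (forall x, a <= x <= b -> is_derive x 1 f (g x)) ->
  exists2 c, a <= c <= b & f b - f a = g c * (b - a).
Proof.
move=> ab H; have [||c cab E] := @MVT_segment _ f g a b ab.
- by move=> x; rewrite in_itv /= => /andP[ax xb]; apply: H; rewrite !ltW.
- apply: derivable_within_continuous => x; rewrite in_itv /= => xab.
  by have [] := H x xab.
- by exists c => //; move: cab; rewrite in_itv.
Qed.

Lemma derive0_eq (f : R -> R) (a b : R) : a <= b ->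
  (forall x, a <= x <= b -> is_derive x 1 f 0) -> f a = f b.
Proof.
move=> ab H; have [c _] := @MVT_ge f (cst 0) a b ab H.
by rewrite /= mul0r => /eqP; rewrite subr_eq0 => /eqP.
Qed.

Lemma derive0_cst (f : R -> R) : (forall x : R, is_derive x 1 f 0) -> forall x y, f x = f y.
Proof.
move=> H x y; have [xy|/ltW yx] := leP x y; first by apply: derive0_eq.
by apply/esym; apply: derive0_eq.
Qed.

Lemma derive_periodic V W (f : V -> W) (b x v : V) : (forall z, f (z + b) = f z) ->
  'D_v f (x + b) = 'D_v f x.
Proof.
move=> H; rewrite /derive; congr (lim (_ @ 0^')); apply/funext => h /=.
by rewrite addrA !H.
Qed.

Lemma near_within_box V (P : V -> Prop) (x u v : V) : (\forall y \near x, P y) ->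
  exists2 h : R, 0 < h &
    forall a b, 0 <= a <= h -> 0 <= b <= h -> P (x + a *: u + b *: v).
Proof.
move=> /nbhs_ballP[e /= e0 H].
(* The [+ 1] keeps [N] positive when both directions vanish; the factor 2 below makes the last
   inequality strict. *)
pose N := `|u| + `|v| + 1; have N0 : 0 < N by rewrite ltr_wpDl// addr_ge0.
exists (e / N / 2); first by rewrite !divr_gt0.
move=> a b /andP[a0 ah] /andP[b0 bh]; apply: H.
rewrite -ball_normE /= -addrA opprD addNKr normrN.
apply: (@le_lt_trans _ _ (a * `|u| + b * `|v|)).
  by apply: le_trans (ler_normD _ _) _; rewrite !normrZ !ger0_norm.
apply: (@le_lt_trans _ _ (e / N / 2 * (`|u| + `|v|))).
  by rewrite mulrDr lerD// ler_wpM2r.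
apply: (@le_lt_trans _ _ (e / N / 2 * N)).
  by rewrite ler_wpM2l ?lerDl// !divr_ge0// ltW.
rewrite mulrAC divfK ?gt_eqF//; lra.
Qed.

(** Two mean values: along [u], for the difference of [f] between two parallel edges, then along
    [v], for ['D_u f]. *)
Lemma second_difference V (A : set V) (f : V -> R) (x u v : V) (h : R) : 0 <= h ->
  Ck_on 2 A f ->
  (forall a b, 0 <= a <= h -> 0 <= b <= h -> A (x + a *: u + b *: v)) ->
  exists a b, [/\ 0 <= a <= h, 0 <= b <= h &
    f (x + h *: u + h *: v) - f (x + h *: u) - f (x + h *: v) + f x =
    h * h * 'D_v ('D_u f) (x + a *: u + b *: v)].
Proof.
move=> h0 [df /(_ u) [ddf _]] HA.
pose g a := f (x + h *: v + a *: u) - f (x + a *: u).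
pose g' a := 'D_u f (x + h *: v + a *: u) - 'D_u f (x + a *: u).
have h00 : 0 <= (0 : R) <= h by rewrite lexx.
have hhh : 0 <= h <= h by rewrite lexx h0.
have [a aI Ea] : exists2 a, 0 <= a <= h & g h - g 0 = g' a * (h - 0).
  apply: MVT_ge => // a aI; apply: is_deriveB; apply: is_derive_along; apply: df.
    by rewrite addrAC; exact: HA.
  by rewrite -[X in A X]addr0 -(scale0r v); exact: HA.
have [b bI Eb] : exists2 b, 0 <= b <= h & 'D_u f (x + a *: u + h *: v) - 'D_u f (x + a *: u + 0 *: v)
    = 'D_v ('D_u f) (x + a *: u + b *: v) * (h - 0).
  apply: (@MVT_ge (fun b => 'D_u f (x + a *: u + b *: v)) (fun b => 'D_v ('D_u f) (x + a *: u + b *: v)) 0 h h0) => b bI.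
  by apply: is_derive_along; apply: ddf; exact: HA.
exists a, b; split=> //.
move: Ea; rewrite /g /g' scale0r !addr0 (addrAC x (h *: v)).
move: Eb; rewrite scale0r addr0 subr0 => Eb.
rewrite (addrAC x (h *: v)) Eb => E.
transitivity (f (x + h *: u + h *: v) - f (x + h *: u) - (f (x + h *: v) - f x)); first by ring.
by rewrite E; ring.
Qed.

(** The second difference over a parallelogram is symmetric in [u] and [v], so the two mixed
    derivatives agree at two points of any small parallelogram, and continuity brings these points
    to [x]. *)
Lemma derive_sym V (A : set V) (f : V -> R) (x u v : V) : open A -> A x ->
  Ck_on 2 A f -> 'D_u ('D_v f) x = 'D_v ('D_u f) x.
Proof.
move=> oA Ax cf; apply/eqP; rewrite -subr_eq0 -normr_le0; apply/ler_addgt0Pr => e e0.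
rewrite add0r.
have c1 : {for x, continuous ('D_u ('D_v f))} := (cf.2 v).2 u x Ax.
have c2 : {for x, continuous ('D_v ('D_u f))} := (cf.2 u).2 v x Ax.
have e2 : 0 < e / 2 by rewrite divr_gt0.
have n1 : \forall y \near x, `|'D_u ('D_v f) x - 'D_u ('D_v f) y| < e / 2.
  by move/cvgrPdist_lt : c1 => /(_ _ e2).
have n2 : \forall y \near x, `|'D_v ('D_u f) x - 'D_v ('D_u f) y| < e / 2.
  by move/cvgrPdist_lt : c2 => /(_ _ e2).
have nA : \forall y \near x, A y by exact: (open_near oA Ax).
have [h h0 H] := near_within_box u v (filterI nA (filterI n1 n2)).
have [a [b [aI bI E1]]] := second_difference (ltW h0) cf (fun a b aI bI => (H a b aI bI).1).
have HA' a' b' : 0 <= a' <= h -> 0 <= b' <= h -> A (x + a' *: v + b' *: u).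
  by move=> aI' bI'; rewrite addrAC; exact: (H _ _ bI' aI').1.
have [a' [b' [aI' bI' E2]]] := second_difference (ltW h0) cf HA'.
have [_ [_]] := H a b aI bI; have := H b' a' bI' aI'; rewrite (addrAC x (b' *: u)) => -[_ [+ _]].
move: E1 E2; rewrite (addrAC x (h *: v)).
move: ('D_u ('D_v f) x) ('D_v ('D_u f) x) ('D_v ('D_u f) _) ('D_u ('D_v f) _).
move: (f _) (f _) (f _) (f _) => f1 f2 f3 f4 p q r r' E1 E2 K1 K2.
have E : r = r'.
  by apply: (@mulfI _ (h * h)); [rewrite mulf_neq0// gt_eqF|rewrite -E1 -E2; ring].
rewrite (_ : p - q = (p - r') - (q - r)); last by rewrite E; ring.
by apply: le_trans (ler_normB _ _) _; rewrite (splitr e) lerD// ltW.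
Qed.

Lemma derive_sym_mx V (A : set V) m n (f : V -> 'M[R]_(m, n)) (x u v : V) : open A -> A x ->
  Ck_on 2 A f -> 'D_u ('D_v f) x = 'D_v ('D_u f) x.
Proof.
move=> oA Ax cf; apply/matrixP => i j.
have E w w' : ('D_w ('D_w' f) x) i j = 'D_w ('D_w' (fun y => f y i j)) x.
  rewrite derive_entry; last first.
    by have [_ /(_ w') [df _]] := cf; apply: diff_derivable; exact: df.
  apply: near_eq_derive; apply: (open_near oA Ax) => y Ay; rewrite derive_entry//.
  by have [df _] := cf; apply: diff_derivable; exact: df.
have cf' : Ck_on 2 A (fun y => f y i j) by exact: (Ck_on_mxP 2 oA f).1.
apply: (etrans (E u v)); apply: (etrans _ (esym (E v u))).
exact: (derive_sym u v oA Ax cf').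
Qed.

(** The integral starts at [a], so two-sided derivatives are obtained to the right of [a] only; the
    caller takes [a] below its interval. *)
Lemma antiderivative (f : R -> R) (a : R) : continuous f ->
  exists F : R -> R, forall x : R, a < x -> is_derive x 1 F (f x).
Proof.
move=> cf; exists (fun x => \int[lebesgue_measure]_(t in `[a, x]) f t) => x x1.
have xlt : x < x + 1 by rewrite ltrDl.
have fi : lebesgue_measure.-integrable `[a, x + 1] (EFin \o f).
  apply: continuous_compact_integrable; first exact: segment_compact.
  exact: continuous_subspaceT.
have [dF E] := continuous_FTC1_closed xlt fi x1 (cf x).
by apply: DeriveDef dF _; rewrite -derive1E.
Qed.

End OneVariable.

(** * Elementary smooth functions and polar angles *)

Section SmoothFunctions.
Variables (R : realType).

Lemma Ck_on_sin_cos k : Ck_on k setT (@sin R) /\ Ck_on k setT (@cos R).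
Proof.
elim: k => [|k [IHs IHc]]; first by split=> x _; [exact: continuous_sin|exact: continuous_cos].
split; first by apply: (@Ck_on1R _ _ _ _ cos) => //; exact: openT.
apply: (@Ck_on1R _ _ _ _ (fun x => - sin x)); first exact: openT.
by apply: Ck_onN => //; exact: openT.
Qed.

Lemma Ck_on_id k : Ck_on k setT (id : R -> R).
Proof. by apply: (@Ck_on_lin _ _ _ _ _ idfun) => x; exact: cvg_id. Qed.

Lemma Ck_on_atan k : Ck_on k setT (@atan R).
Proof.
case: k => [|k]; first by move=> x _; exact: continuous_atan.
have D (x : R) : setT x -> is_derive x 1 atan (1 + x * x)^-1.
  by move=> _; rewrite -expr2; exact: is_derive1_atan.
apply: (Ck_on1R openT D).
apply: Ck_onV; first exact: openT.
  by move=> x _; rewrite gt_eqF// ltr_pwDl// -expr2 sqr_ge0.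
apply: Ck_onD; [exact: openT|exact: Ck_on_cst|].
by apply: Ck_onM; [exact: openT|exact: Ck_on_id|exact: Ck_on_id].
Qed.

(** The powers of [t^-1] make the family stable under differentiation, so that one induction proves
    all members smooth. *)
Definition flat m (t : R) : R := if 0 < t then t^-1 ^+ m * expR (- t^-1) else 0.

Lemma flat_ge0 m t : 0 <= flat m t.
Proof. by rewrite /flat; case: ifP => // t0; rewrite mulr_ge0 ?exprn_ge0 ?invr_ge0 ?expR_ge0// ltW. Qed.

(** One term of the exponential series, of degree two more than the power of [t^-1], leaves a
    quadratic bound; this yields derivative 0 at 0. *)
Lemma flat_le m t : flat m t <= (m.+2)`!%:R * (t * t).
Proof.
rewrite /flat; case: ifP => [t0|_]; last by rewrite mulr_ge0// -expr2 sqr_ge0.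
have i0 : 0 < t^-1 by rewrite invr_gt0.
have := @expR_ge1Dxn R t^-1 m.+1 (ltW i0).
have F0 : 0 < (m.+2)`!%:R :> R by rewrite ltr0n fact_gt0.
move=> /(le_trans _) => /(_ (t^-1 ^+ m.+2 / (m.+2)`!%:R)) H.
have {}H : t^-1 ^+ m.+2 / (m.+2)`!%:R <= expR t^-1 by apply: H; rewrite lerDr.
rewrite expRN ler_pdivrMr ?expR_gt0//.
have P : t^-1 ^+ m * (t^-1 * t^-1) = t^-1 ^+ m.+2 by rewrite !exprSr mulrA.
have -> : t^-1 ^+ m = t^-1 ^+ m.+2 * (t * t).
  by rewrite -P -mulrA [_ * (t * t)](_ : _ = 1) ?mulr1//; field; rewrite gt_eqF.
rewrite [leRHS](_ : _ = (m.+2)`!%:R * expR t^-1 * (t * t)); last by ring.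
apply: ler_wpM2r; first by rewrite mulr_ge0// ltW.
by rewrite mulrC -ler_pdivrMr.
Qed.

Lemma is_derive_flat m (t : R) : is_derive t 1 (flat m) (- (m%:R * flat m.+1 t) + flat m.+2 t).
Proof.
have [t0|t0|<-] := ltgtP 0 t; last first.
- have -> : - (m%:R * flat m.+1 0) + flat m.+2 0 = 0 by rewrite /flat ltxx mulr0 oppr0 addr0.
  have D : is_diff 0 (flat m) \0.
    have L : linear (\0 : R -> R) by move=> a u v; rewrite /= scaler0 addr0.
    apply: (@is_diff_eps _ _ _ _ _ (linear_of L)); first by move=> x; exact: cst_continuous.
    move=> e e0; pose C : R := (m.+2)`!%:R.
    have C0 : 0 < C by rewrite ltr0n fact_gt0.
    have d0 : 0 < C^-1 * e by rewrite mulr_gt0// invr_gt0.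
    have := @nbhs0_le _ R _ d0; apply: filterS => h hd.
    rewrite addr0 /= [flat m 0]/flat ltxx !subr0 ger0_norm ?flat_ge0//.
    apply: le_trans (flat_le m h) _; rewrite -/C.
    have -> : h * h = `|h| * `|h| by rewrite -normrM ger0_norm// -expr2 sqr_ge0.
    by rewrite mulrA ler_wpM2r// -ler_pdivlMl.
  apply: DeriveDef; first by apply/derivable1_diffP; exact: ex_diff.
  by rewrite deriveE ?diff_val.
- apply: (@near_eq_is_derive _ _ _ (cst 0)).
    near=> x; rewrite /flat ifF//; apply/negbTE; rewrite -leNgt ltW//.
    by near: x; exact: lt_nbhsl.
  rewrite /flat !ifF ?mulr0 ?oppr0 ?addr0; first exact: is_derive_cst.
  + by apply/negbTE; rewrite -leNgt ltW.
  + by apply/negbTE; rewrite -leNgt ltW.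
- have tn0 : t != 0 by rewrite gt_eqF.
  apply: (@near_eq_is_derive _ _ _ (fun t : R => t^-1 ^+ m * expR (- t^-1))).
    near=> x; rewrite /flat ifT//; near: x; exact: lt_nbhsr.
  have iV : is_derive t 1 (fun t : R => t^-1) (- (t^-1 ^+ 2)).
    apply: DeriveDef; first exact: derivableV.
    by rewrite deriveV// derive_id -exprVn scaleNr [_ *: _]mulr1.
  have iNV : is_derive t 1 (fun t : R => - t^-1) (t^-1 ^+ 2).
    by rewrite -[X in is_derive _ _ _ X]opprK; exact: is_deriveN.
  have iE : is_derive t 1 (expR \o (fun t : R => - t^-1)) (expR (- t^-1) * t^-1 ^+ 2).
    exact: is_derive1_comp.
  have iX := @is_deriveX _ _ _ m t 1 _ iV.
  have iM := is_deriveM iX iE.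
  rewrite (_ : (fun _ => _) = (fun t : R => t^-1) ^+ m * (expR \o (fun t : R => - t^-1))).
    apply: (is_derive_eq iM).
    rewrite /flat t0 /= ?exprfctE /= /GRing.scale /=; move: (expR _) => E.
    case: m {iX iM} => [|m] /=; first by rewrite !mul0r !expr0; ring.
    by rewrite !exprS; ring.
  by apply/funext => x; rewrite /= exprfctE.
Unshelve. all: by end_near. Qed.

Lemma Ck_on_flat m k : Ck_on k setT (flat m).
Proof.
elim: k m => [|k IH] m; first by move=> x _; exact: (is_derive_continuous (is_derive_flat m x)).
apply: (Ck_on1R openT (fun x _ => is_derive_flat m x)).
have oT := @openT R; apply: Ck_onD => //; apply: Ck_onN => //.
by apply: Ck_onM => //; exact: Ck_on_cst.
Qed.

(** The cut-off that slows paths down, so that they stay constant beyond their ends and can be glued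
    smoothly. *)
Definition smooth_step (t : R) : R := flat 0 t / (flat 0 t + flat 0 (1 - t)).

Lemma flat_gt0 m t : 0 < t -> 0 < flat m t.
Proof. by move=> t0; rewrite /flat t0 mulr_gt0 ?exprn_gt0 ?invr_gt0 ?expR_gt0. Qed.

Lemma flat_eq0 m t : t <= 0 -> flat m t = 0.
Proof. by move=> t0; rewrite /flat ifF//; apply/negbTE; rewrite -leNgt. Qed.

Lemma flat_den t : 0 < flat 0 t + flat 0 (1 - t).
Proof.
have [t0|t0] := ltP 0 t; first by rewrite ltr_pwDl ?flat_gt0 ?flat_ge0.
by rewrite ltr_wpDl ?flat_ge0// flat_gt0//; lra.
Qed.

Lemma smooth_step0 t : t <= 0 -> smooth_step t = 0.
Proof. by move=> t0; rewrite /smooth_step flat_eq0// mul0r. Qed.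

Lemma smooth_step1 t : 1 <= t -> smooth_step t = 1.
Proof.
move=> t1; rewrite /smooth_step (@flat_eq0 _ (1 - t)); last by lra.
by rewrite addr0 divff// gt_eqF// flat_gt0//; lra.
Qed.

Lemma smooth_step_ge0 t : 0 <= smooth_step t.
Proof. by rewrite divr_ge0 ?flat_ge0// ltW// flat_den. Qed.

Lemma smooth_step_le1 t : smooth_step t <= 1.
Proof. by rewrite /smooth_step ler_pdivrMr ?flat_den// mul1r lerDl flat_ge0. Qed.

Lemma Ck_on_smooth_step k : Ck_on k setT smooth_step.
Proof.
have oT := @openT R; apply: Ck_onM => //; first exact: Ck_on_flat.
apply: Ck_onV => // [x _|]; first by rewrite gt_eqF// flat_den.
apply: Ck_onD => //; first exact: Ck_on_flat.
have c1 : Ck_on k setT (fun t : R => 1 - t).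
  by apply: Ck_onB => //; [exact: Ck_on_cst|exact: Ck_on_id].
exact: (@Ck_on_compR R R R k setT setT _ (flat 0) (findim_R R) oT (fun _ _ => I) c1 (Ck_on_flat 0 k)).
Qed.

End SmoothFunctions.

Section Angle.
Variables (R : realType).

Lemma periodic_int T (F : R -> T) (p : R) : (forall t, F (t + p) = F t) ->
  forall (k : int) t, F (t + p *~ k) = F t.
Proof.
move=> H; have Hn n t : F (t + p *+ n) = F t.
  elim: n => [|n IH]; first by rewrite mulr0n addr0.
  by rewrite mulrSr addrA H.
case=> n t; first exact: Hn.
by rewrite NegzE mulrNz -[in RHS](subrK (p *+ n.+1) t) Hn.
Qed.

(** The difference of the angles, reduced to [[0, 2 * pi)], has cosine 1 by the subtraction formula,
    hence is 0. *)
Lemma periodic_angle T (F : R -> T) (a b : R) : (forall t, F (t + 2 * pi) = F t) ->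
  cos a = cos b -> sin a = sin b -> F a = F b.
Proof.
move=> HF Ec Es; have pi0 := pi_gt0 R; have p20 : 0 < 2 * pi :> R by rewrite mulr_gt0.
pose k := Num.floor ((a - b) / (2 * pi)); pose r := a - b - (2 * pi) *~ k.
have kE : (2 * pi) *~ k = k%:~R * (2 * pi) :> R by rewrite mulrzl.
have r0 : 0 <= r.
  by rewrite /r kE subr_ge0 -ler_pdivlMr// ; exact: floor_le_tmp.
have r2 : r < 2 * pi.
  rewrite /r kE ltrBlDr (_ : _ + k%:~R * _ = (k%:~R + 1) * (2 * pi)); last by ring.
  rewrite -ltr_pdivrMr//.
  have := floorD1_gt ((a - b) / (2 * pi)).
  by rewrite intrD.
have cr : cos r = 1.
  rewrite /r -mulrNz (periodic_int (p := 2 * pi) (F := cos)); last first.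
    by move=> t; rewrite mulr_natl cosD2pi.
  by rewrite cosB Ec Es -!expr2 cos2Dsin2.
have rE : r = 0.
  (* [cos] is injective on [[0, pi]]; beyond [pi] the reflected angle [2 * pi - r] would vanish,
     against [r < 2 * pi]. *)
  have [rpi|rpi] := leP r pi.
    apply: cos_inj; rewrite ?in_itv /= ?lexx ?r0 ?rpi ?ltW//.
    by rewrite cr cos0.
  suff : 2 * pi - r = 0 by move: r2; lra.
  apply: cos_inj; rewrite ?in_itv /= ?lexx ?ltW//=; [lra|lra|].
  by rewrite cos0 addrC mulr_natl cosD2pi cosN.
have -> : a = b + (2 * pi) *~ k by move: rE; rewrite /r; lra.
exact: periodic_int.
Qed.

(** A relation and not a function: an angle is determined only modulo [2 * pi], and only local
    choices of it are continuous. *)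
Definition has_angle (a b t : R) := exists2 r, 0 < r & a = r * cos t /\ b = r * sin t.

Lemma has_angle_norm (a b t r : R) : 0 < r -> a = r * cos t -> b = r * sin t ->
  a ^+ 2 + b ^+ 2 = r ^+ 2.
Proof. by move=> r0 -> ->; rewrite !exprMn -mulrDr cos2Dsin2 mulr1. Qed.

Lemma has_angle_periodic T (F : R -> T) (a b s t : R) : (forall t, F (t + 2 * pi) = F t) ->
  has_angle a b s -> has_angle a b t -> F s = F t.
Proof.
move=> HF [r r0 [E1 E2]] [r' r'0 [E1' E2']].
have rE : r = r'.
  apply/eqP; rewrite -(@eqrXn2 _ 2)// ?ltW//.
  by rewrite -(has_angle_norm r0 E1 E2) -(has_angle_norm r'0 E1' E2').
have rn0 : r != 0 by rewrite gt_eqF.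
by apply: periodic_angle => //; apply: (mulfI rn0); rewrite -?E1 -?E2 rE -?E1' -?E2'.
Qed.

Lemma has_angle_ex (a b : R) : 0 < a ^+ 2 + b ^+ 2 -> exists t, has_angle a b t.
Proof.
move=> H; pose r := Num.sqrt (a ^+ 2 + b ^+ 2).
have r0 : 0 < r by rewrite sqrtr_gt0.
have r2 : r ^+ 2 = a ^+ 2 + b ^+ 2 by rewrite sqr_sqrtr// ltW.
have rn0 : r != 0 by rewrite gt_eqF.
have E : (a / r) ^+ 2 + (b / r) ^+ 2 = 1.
  by rewrite !exprMn -mulrDl -r2 -exprMn mulfV// expr1n.
have I1 : -1 <= a / r <= 1.
  by rewrite -ler_norml -(@expr_le1 _ 2)// real_normK ?num_real// -E lerDl sqr_ge0.
have S : `|b / r| = sin (acos (a / r)).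
  rewrite sin_acos// -E [X in X - _]addrC addrK sqrtr_sqr//.
have [b0|b0] := leP 0 b.
  exists (acos (a / r)); exists r => //; rewrite -S acosK ?in_itv//=.
  by rewrite ger0_norm ?divr_ge0// ?ltW//; split; rewrite mulrC divfK.
exists (- acos (a / r)); exists r => //; rewrite cosN sinN -S acosK ?in_itv//=.
rewrite ltr0_norm ?opprK; last by rewrite pmulr_llt0// invr_gt0.
by split; rewrite mulrC divfK.
Qed.

(** After rotation by [- t] the point lies in the right half-plane, where [atan] of the slope is its
    angle. This gives a smooth local choice near any direction [t]. *)
Lemma has_angle_atan (t a b : R) : 0 < a * cos t + b * sin t ->
  has_angle a b (t + atan ((b * cos t - a * sin t) / (a * cos t + b * sin t))).
Proof.
set c := cos t; set s := sin t; set a' := a * c + b * s; set b' := b * c - a * s => a0.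
have an0 : a' != 0 by rewrite gt_eqF.
pose u := atan (b' / a').
have cu : 0 < cos u by apply: cos_gt0_pihalf; rewrite atan_gtNpi2 atan_ltpi2.
have cn0 : cos u != 0 by rewrite gt_eqF.
have su : sin u = b' / a' * cos u by rewrite -{1}(atanK (b' / a')) -/u /tan divfK.
have cs : c * c + s * s = 1 by rewrite -!expr2 cos2Dsin2.
exists (a' / cos u); first by rewrite divr_gt0.
rewrite -/u cosD sinD -/c -/s su; split.
  have -> : a' / cos u * (c * cos u - s * (b' / a' * cos u)) = c * a' - s * b'.
    by field; rewrite an0.
  rewrite /a' /b'; transitivity (a * (c * c + s * s)); first by rewrite cs mulr1.
  by ring.
have -> : a' / cos u * (s * cos u + c * (b' / a' * cos u)) = s * a' + c * b'.
  by field; rewrite an0.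
rewrite /a' /b'; transitivity (b * (c * c + s * s)); first by rewrite cs mulr1.
by ring.
Qed.

End Angle.

(* Keeps unification from unfolding directional derivatives to limits. *)
Local Opaque derive.

(** * Curvature of a connection pulled back along a map *)

Section PointwiseLinear.
Variables (R : realType) (V : normedModType R) (n : nat).
Local Notation E := 'rV[R]_n.
Local Notation e_ k := (delta_mx (0 : 'I_1) (k : 'I_n) : E).

Lemma lin_sum (W : lmodType R) (a : E -> W) : linear a ->
  forall u, a u = \sum_k u 0 k *: a (e_ k).
Proof.
move=> L u; pose a' : {linear E -> W} := HB.pack a (GRing.isLinear.Build R E W *:%R a L).
by rewrite [LHS](_ : a u = a' u)// [X in a' X]row_sum_delta linear_sum; apply: eq_bigr => k _; rewrite linearZ.
Qed.

Lemma row_entry_derive (w : V -> E) x p k : differentiable w x ->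
  differentiable (fun z => w z 0 k) x /\ 'D_p (fun z => w z 0 k) x = 'D_p w x 0 k.
Proof.
move=> dw; split; last by rewrite derive_entry//; exact: diff_derivable.
exact: (@differentiable_comp _ _ _ _ w (fun M : E => M 0 k) x dw (differentiable_coord _ _ _)).
Qed.

Section ScalarForm.
Variables (B : set E) (a : E -> E -> R).
Hypothesis aL : forall z, B z -> linear (a z : E -> R).

Lemma Ck_on_lin2 k (U : set V) (y w : V -> E) : open U -> open B ->
  (forall x, U x -> B (y x)) -> (forall v, Ck_on k B (a^~ v)) ->
  Ck_on k U y -> Ck_on k U w -> Ck_on k U (fun z => a (y z) (w z)).
Proof.
move=> oU oB UB ca cy /(Ck_on_mxP k oU) cw.
apply: (@Ck_on_eq _ _ _ _ _ _ (fun z => \sum_k w z 0 k * a (y z) (e_ k))) => //.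
  by move=> z /[!inE] Uz; rewrite [LHS](lin_sum (aL (UB z Uz))).
apply: Ck_on_sum => // l; apply: Ck_onM => //.
exact: (@Ck_on_compR _ _ _ _ U B y (a^~ (e_ l)) (findim_mx R 1 n) oU UB cy (ca _)).
Qed.

(** A product rule for a one-form evaluated at a moving point on a moving vector. Linearity holds at
    points of [B] only, so the expansion in the basis is made near [x]. *)
Lemma derive_lin2 (y w : V -> E) x p : open B ->
  (\forall z \near x, B (y z)) -> (forall v, differentiable (a^~ v) (y x)) ->
  differentiable y x -> differentiable w x ->
  differentiable (fun z => a (y z) (w z)) x /\
  'D_p (fun z => a (y z) (w z)) x =
    'D_('D_p y x) (a^~ (w x)) (y x) + a (y x) ('D_p w x).
Proof.
move=> oB nB da dy dw; have By := nbhs_singleton nB.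
pose f k z := w z 0 k * a (y z) (e_ k).
have dak k : differentiable (fun z => a (y z) (e_ k)) x.
  exact: (@differentiable_comp _ _ _ _ y (a^~ (e_ k)) x dy (da _)).
have Dak k : 'D_p (fun z => a (y z) (e_ k)) x = 'D_('D_p y x) (a^~ (e_ k)) (y x).
  exact: (@derive_comp _ _ _ _ y (a^~ (e_ k)) x p dy (da _)).
have dwk k := (row_entry_derive p k dw).1.
have Dwk k := (row_entry_derive p k dw).2.
have df k : differentiable (f k) x by apply: differentiableM.
have ne : \forall z \near x, (\sum_k f k) z = a (y z) (w z).
  by near=> z; rewrite fct_sumE [RHS](lin_sum (aL _))//; near: z.
split; first by apply: (differentiable_near ne); exact: differentiable_sum.
rewrite -(near_eq_derive p ne) derive_sum; last by move=> k; exact: diff_derivable.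
have -> : 'D_('D_p y x) (a^~ (w x)) (y x) = \sum_k w x 0 k * 'D_('D_p y x) (a^~ (e_ k)) (y x).
  have nz : \forall z \near y x, (\sum_k (fun z => w x 0 k * a z (e_ k))) z = a z (w x).
    by apply: (open_near oB By) => z Bz; rewrite fct_sumE [RHS](lin_sum (aL Bz)).
  rewrite -(near_eq_derive _ nz) derive_sum; last first.
    move=> k; apply: diff_derivable; apply: (@differentiableZ _ _ _ (a^~ (e_ k)) (w x 0 k)).
    exact: da.
  by apply: eq_bigr => k _; rewrite deriveZ//; apply: diff_derivable; exact: da.
rewrite [a (y x) _](lin_sum (aL By)) -big_split; apply: eq_bigr => k _ /=.
rewrite /f deriveM; [|exact: diff_derivable|exact: diff_derivable].
by rewrite Dak Dwk; congr (_ + _); exact: mulrC.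
Unshelve. all: by end_near. Qed.

End ScalarForm.

Section MatrixForm.
Variables (B : set E) (m q : nat) (a : E -> E -> 'M[R]_(m, q)).
Hypothesis aL : forall z, B z -> linear (a z).

Let aL' i j z : B z -> linear ((fun z v => a z v i j) z : E -> R).
Proof. by move=> Bz c u v; rewrite aL// !mxE. Qed.

Lemma Ck_on_lin2_mx k (U : set V) (y w : V -> E) : open U -> open B ->
  (forall x, U x -> B (y x)) -> (forall v, Ck_on k B (a^~ v)) ->
  Ck_on k U y -> Ck_on k U w -> Ck_on k U (fun z => a (y z) (w z)).
Proof.
move=> oU oB UB ca cy cw; apply/Ck_on_mxP => // i j.
apply: (@Ck_on_lin2 B _ (@aL' i j) k U y w oU oB UB _ cy cw) => v.
exact: (Ck_on_mxP k oB (a^~ v)).1.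
Qed.

Lemma derive_lin2_mx (y w : V -> E) x p : open B ->
  (\forall z \near x, B (y z)) -> (forall v, differentiable (a^~ v) (y x)) ->
  differentiable y x -> differentiable w x -> 
  derivable (fun z => a (y z) (w z)) x p /\
  'D_p (fun z => a (y z) (w z)) x =
    'D_('D_p y x) (a^~ (w x)) (y x) + a (y x) ('D_p w x).
Proof.
move=> oB nB da dy dw.
have da' i j v : differentiable (fun z => a z v i j) (y x).
  exact: (@differentiable_comp _ _ _ _ (a^~ v) (fun M : 'M[R]_(m,q) => M i j) _ (da v) (differentiable_coord _ _ _)).
have H i j := derive_lin2 (@aL' i j) p oB nB (da' i j) dy dw.
have D : derivable (fun z => a (y z) (w z)) x p.
  by apply/derivable_mxP => i j; apply: diff_derivable; exact: (H i j).1.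
split=> //; apply/matrixP => i j; rewrite derive_entry// mxE [LHS](H i j).2.
congr (_ + _); apply/esym/derive_entry; apply: diff_derivable; exact: da.
Qed.

End MatrixForm.

End PointwiseLinear.

(** * Matrix identities for a change of frame *)

Section GaugeAlgebra.
Variables (R : comUnitRingType) (n : nat).
Implicit Types (F J K P Q S a b c : 'M[R]_n).

(** Here [P] is the derivative of the frame [F] and [a] the connection matrix; the last hypothesis
    is the derivative of [F *m J = J0 *m F] when [J] is parallel. The conclusion says that [J0] is
    parallel for the connection matrix in the frame [F]. *)
Lemma gauge_commutator F J J0 a P D0 : F \in unitmx -> F *m J = J0 *m F ->
  P *m J + F *m (a *m J - J *m a) = D0 *m F + J0 *m P ->
  D0 = (P + F *m a) *m invmx F *m J0 - J0 *m ((P + F *m a) *m invmx F).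
Proof.
move=> uF FJ E; apply: (can_inj (mulmxK uF)) => /=.
rewrite mulmxBl -(mulmxA _ J0) -FJ -(mulmxA _ (invmx F)) (mulmxA (invmx F)) mulVmx// mul1mx.
rewrite -(mulmxA J0) -(mulmxA (P + _)) mulVmx// mulmx1.
rewrite -[LHS](addrK (J0 *m P)) -E (mulmxBr F) (mulmxDr J0) !mulmxDl !mulmxA FJ.
set A1 := P *m J; set A2 := F *m a *m J; set A3 := J0 *m F *m a; set A4 := J0 *m P.
by apply/matrixP => i j; rewrite !mxE; ring.
Qed.

(** [P], [Q] are first derivatives of [F] and [S] its mixed second derivative; [c], [d] are
    derivatives of the connection matrices [b], [a]. In the difference of the two differentiated
    frame equations [S] cancels, and curvature is seen to change by conjugation. *)
Lemma gauge_curvature F P Q S a b c d Bp Bq dpBq dqBp :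
  Bp *m F = P + F *m a -> Bq *m F = Q + F *m b ->
  dpBq *m F + Bq *m P = S + P *m b + F *m c ->
  dqBp *m F + Bp *m Q = S + Q *m a + F *m d ->
  (dpBq - dqBp) *m F = (Bp *m Bq - Bq *m Bp) *m F + F *m (c - d + b *m a - a *m b).
Proof.
move=> Ep Eq E1 E2.
have EP : P = Bp *m F - F *m a by rewrite Ep addrK.
have EQ : Q = Bq *m F - F *m b by rewrite Eq addrK.
have {}E1 : dpBq *m F = S + P *m b + F *m c - Bq *m P by rewrite -E1 addrK.
have {}E2 : dqBp *m F = S + Q *m a + F *m d - Bp *m Q by rewrite -E2 addrK.
rewrite mulmxBl {}E1 {}E2 {Ep Eq} EP EQ !(mulmxDr, mulmxDl, mulmxN, mulNmx) !mulmxA.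
set A1 := Bp *m F *m b; set A2 := Bq *m F *m a; set A3 := F *m a *m b; set A4 := F *m b *m a.
set A5 := F *m c; set A6 := F *m d; set A7 := Bp *m Bq *m F; set A8 := Bq *m Bp *m F.
by apply/matrixP => i j; rewrite !mxE; ring.
Qed.

(** By cyclicity of the trace, the commutator of [Bp] and [Bq] traced against [J0] cancels [Bq]
    traced against the commutator [D]; the remaining term is invariant under conjugation. *)
Lemma gauge_trace F J J0 Bp Bq X K D : F \in unitmx -> F *m J = J0 *m F ->
  X *m F = (Bp *m Bq - Bq *m Bp) *m F + F *m K -> D = Bp *m J0 - J0 *m Bp ->
  \tr (X *m J0) + \tr (Bq *m D) = \tr (K *m J).
Proof.
move=> uF FJ EX ->.
have -> : X = Bp *m Bq - Bq *m Bp + F *m K *m invmx F.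
  by apply: (can_inj (mulmxK uF)) => /=; rewrite mulmxDl EX mulmxKV.
have -> : \tr (K *m J) = \tr (F *m K *m invmx F *m J0).
  rewrite -!(mulmxA F) [RHS]mxtrace_mulC -!mulmxA -FJ (mulmxA (invmx F)) mulVmx// mul1mx//.
rewrite mulmxDl mulmxBl mulmxBr mxtraceD !raddfB /=.
have -> : \tr (Bq *m (J0 *m Bp)) = \tr (Bp *m Bq *m J0).
  by rewrite mulmxA mxtrace_mulC mulmxA.
rewrite (mulmxA Bq Bp J0); ring.
Qed.

(** The hypotheses have the shape in which differentiation produces them: [S], [S'] are the two
    mixed derivatives of the frame, and [e], [e'] the connection on the two mixed derivatives of the
    base map. [D'] is the derivative of [J0] in the direction where it is constant. *)
Lemma gauge_curvature_trace F J J0 P Q S S' a b c d e e' Bp Bq X Y D D' t1 t2 :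
  F \in unitmx -> F *m J = J0 *m F ->
  Bp *m F = P + F *m a -> Bq *m F = Q + F *m b ->
  X *m F + Bq *m P = S + P *m b + F *m (c + e) ->
  Y *m F + Bp *m Q = S' + Q *m a + F *m (d + e') ->
  S = S' -> e = e' -> D = Bp *m J0 - J0 *m Bp -> D' = 0 ->
  t1 = \tr (X *m J0) + \tr (Bq *m D) -> t2 = \tr (Y *m J0) + \tr (Bp *m D') ->
  t1 - t2 = \tr ((c - d + b *m a - a *m b) *m J).
Proof.
move=> uF FJ Ep Eq E1 E2 ES Ee ED -> -> ->; rewrite -{S'}ES -{e'}Ee in E2.
have EX := gauge_curvature Ep Eq E1 E2.
have := gauge_trace uF FJ EX ED.
rewrite mulmx0 mxtrace0 addr0 mulmxBl raddfB /= addrAC => ->; congr (\tr (_ *m _)).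
by apply/matrixP => i j; rewrite !mxE; ring.
Qed.

End GaugeAlgebra.

Section CurvatureTrace.
Variables (R : realType) (V : normedModType R) (n : nat).
Local Notation E := 'rV[R]_n.
Variables (U : set V) (B : set E) (y : V -> E) (A : E -> E -> 'M[R]_n).
Variables (J : E -> 'M[R]_n) (F J0 : V -> 'M[R]_n).
Hypotheses (oU : open U) (oB : open B) (UB : forall z, U z -> B (y z)).
Hypothesis AL : forall z, B z -> linear (A z).
Hypotheses (sy : smooth_on U y) (sA : forall v, smooth_on B (A^~ v)).
Hypotheses (sJ : smooth_on B J) (sF : smooth_on U F) (sJ0 : smooth_on U J0).
Hypothesis Fu : forall z, U z -> F z \in unitmx.
Hypothesis FJ : forall z, U z -> F z *m J (y z) = J0 z *m F z.
Hypothesis DJ : forall z v, B z -> 'D_v J z = A z v *m J z - J z *m A z v.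

(** The matrix, in the frame given by the rows of [F], of the connection pulled back along [y],
    evaluated on [w]. *)
Definition frame_connection (w : V) (z : V) : 'M[R]_n :=
  ('D_w F z + F z *m A (y z) ('D_w y z)) *m invmx (F z).

Definition frame_trace (w : V) (z : V) : R := \tr (frame_connection w z *m J0 z).

Lemma smooth_pull_connection w : smooth_on U (fun z => A (y z) ('D_w y z)).
Proof.
move=> k; apply: (Ck_on_lin2_mx AL) => //; first by move=> v; exact: sA.
by have [_] := sy k.+1; exact.
Qed.

Lemma smooth_frame_connection w : smooth_on U (frame_connection w).
Proof.
move=> k; apply: Ck_on_mulmx => //; last exact: Ck_on_invmx.
apply: Ck_onD => //; first by have [_] := sF k.+1; exact.
by apply: Ck_on_mulmx => //; exact: smooth_pull_connection.
Qed.

Lemma smooth_frame_trace w : smooth_on U (frame_trace w).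
Proof. by move=> k; apply: Ck_on_tr => //; apply: Ck_on_mulmx => //; exact: smooth_frame_connection. Qed.

Variables (x : V).
Hypothesis Ux : U x.

Let dv (W : normedModType R) (f : V -> W) (v : V) : smooth_on U f -> derivable f x v.
Proof. by move=> sf; apply: diff_derivable; exact: ((sf 1%N).1 x Ux). Qed.

Let near_U (P : V -> Prop) : (forall z, U z -> P z) -> \forall z \near x, P z.
Proof. exact: open_near. Qed.

Lemma derive_frame_structure w :
  'D_w J0 x = frame_connection w x *m J0 x - J0 x *m frame_connection w x.
Proof.
have diffJ : differentiable J (y x) := (sJ 1%N).1 _ (UB Ux).
have diffy : differentiable y x := (sy 1%N).1 _ Ux.
have E1 : 'D_w (fun z => F z *m J (y z)) x = 'D_w (fun z => J0 z *m F z) x.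
  by apply: near_eq_derive; apply: near_U.
have dJy : derivable (J \o y) x w.
  by apply: diff_derivable; exact: differentiable_comp diffy diffJ.
have {}E1 := etrans (esym (derive_mulmx (@dv _ _ w sF) dJy))
  (etrans E1 (derive_mulmx (@dv _ _ w sJ0) (@dv _ _ w sF))).
rewrite (derive_comp w diffy diffJ) (DJ _ (UB Ux)) /= in E1.
have uF := Fu Ux.
exact: (gauge_commutator uF (FJ Ux) E1).
Qed.

Let dB w v : derivable (frame_connection w) x v.
Proof. by apply: dv; exact: smooth_frame_connection. Qed.

Let BE w z : U z -> frame_connection w z *m F z = 'D_w F z + F z *m A (y z) ('D_w y z).
Proof. by move=> Uz; rewrite /frame_connection mulmxKV//; exact: Fu. Qed.

Let sD (W : normedModType R) (f : V -> W) v : smooth_on U f -> smooth_on U ('D_v f).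
Proof. by move=> sf k; have [_] := sf k.+1; exact. Qed.

Lemma derive_frame_connection p q :
  'D_p (frame_connection q) x *m F x + frame_connection q x *m 'D_p F x =
  'D_p ('D_q F) x + 'D_p F x *m A (y x) ('D_q y x) +
  F x *m ('D_('D_p y x) (A^~ ('D_q y x)) (y x) + A (y x) ('D_p ('D_q y) x)).
Proof.
rewrite -(derive_mulmx (@dB q p) (@dv _ _ p sF)).
have -> : 'D_p (fun z => frame_connection q z *m F z) x =
    'D_p (fun z => 'D_q F z + F z *m A (y z) ('D_q y z)) x.
  by apply: near_eq_derive; apply: near_U; exact: BE.
have [sa sa'] := derive_lin2_mx AL p oB (near_U UB)
  (fun v => (sA v 1%N).1 _ (UB Ux)) ((sy 1%N).1 _ Ux) ((@sD _ _ q sy 1%N).1 _ Ux).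
have E := @deriveD _ _ _ ('D_q F) (fun z => F z *m A (y z) ('D_q y z)) x p
  (@dv _ _ p (@sD _ _ q sF)) (derivable_mulmx (@dv _ _ p sF) sa).
rewrite -[RHS]addrA; apply: (etrans E); congr (_ + _).
by apply: (etrans (derive_mulmx (@dv _ _ p sF) sa)); rewrite sa'.
Qed.

(** [J0] may vary in direction [p]: its derivative there is the commutator with the connection
    matrix, which the quadratic part of the curvature absorbs. Thus the curvature trace is the
    exterior derivative of [frame_trace] on the plane of [p] and [q]. *)
Lemma curvature_trace p q : 'D_q J0 x = 0 ->
  'D_p (frame_trace q) x - 'D_q (frame_trace p) x =
  \tr (('D_('D_p y x) (A^~ ('D_q y x)) (y x) - 'D_('D_q y x) (A^~ ('D_p y x)) (y x)
        + A (y x) ('D_q y x) *m A (y x) ('D_p y x)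
        - A (y x) ('D_p y x) *m A (y x) ('D_q y x)) *m J (y x)).
Proof.
move=> DJ0.
have DT w v : 'D_v (frame_trace w) x =
    \tr ('D_v (frame_connection w) x *m J0 x) + \tr (frame_connection w x *m 'D_v J0 x).
  rewrite derive_trace; last exact: (derivable_mulmx (@dB w v) (@dv _ _ v sJ0)).
  by rewrite derive_mulmx ?linearD//; exact: dv.
exact: (gauge_curvature_trace (Fu Ux) (FJ Ux) (BE p Ux) (BE q Ux)
  (derive_frame_connection p q) (derive_frame_connection q p)
  (derive_sym_mx p q oU Ux (sF 2%N)) (congr1 (A (y x)) (derive_sym_mx p q oU Ux (sy 2%N)))
  (derive_frame_structure p) DJ0 (DT q p) (DT p q)).
Qed.

End CurvatureTrace.

Section Misc.
Variables (R : realType).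

Lemma open_setI_preimage (S T : topologicalType) (U : set S) (f : S -> T) (B : set T) :
  open U -> (forall x, U x -> {for x, continuous f}) -> open B -> open (U `&` f @^-1` B).
Proof.
move=> oU cf oB; rewrite openE => x [Ux Bx]; apply: filterI.
  exact: open_nbhs_nbhs.
by apply: (cf x Ux); exact: open_nbhs_nbhs.
Qed.

Lemma derive_pair (U V W : normedModType R) (f : U -> V) (g : U -> W) x v :
  differentiable f x -> differentiable g x ->
  'D_v (fun x => (f x, g x)) x = ('D_v f x, 'D_v g x).
Proof.
move=> df dg; rewrite deriveE; last exact: differentiable_pair.
by rewrite diff_pair//= !deriveE.
Qed.

Lemma derive_at0 (V W : normedModType R) (f : V -> W) (x v : V) : differentiable f x ->
  'D_1 (fun s : R => f (x + s *: v)) 0 = 'D_v f x.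
Proof.
have E : x = x + (0 : R) *: v by rewrite scale0r addr0.
move=> df; have [|_ ->] := @is_derive_along _ _ _ f x v 0; first by rewrite -E.
by rewrite -E.
Qed.

Variables (n : nat).
Local Notation E := 'rV[R]_n.
Local Notation e_ k := (delta_mx (0 : 'I_1) (k : 'I_n) : E).

(** A partial Jacobian, acting on row vectors from the right; the choice of [u] lets it take the
    space part of a map of time and space. *)
Definition dirmx (V : normedModType R) m (u : 'I_n -> V) (f : V -> 'rV[R]_m) (x : V) : 'M[R]_(n, m) :=
  \matrix_(k < n) 'D_(u k) f x.

Lemma mul_dirmx (V : normedModType R) m (u : E -> V) (f : V -> 'rV[R]_m) x (v : E) :
  linear u -> differentiable f x ->
  v *m dirmx (fun k => u (e_ k)) f x = 'D_(u v) f x.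
Proof.
move=> lu df.
have L : linear (fun v => 'D_(u v) f x) by move=> a b c; rewrite lu derive_linear.
by rewrite (lin_sum L) mulmx_sum_row; apply: eq_bigr => k _; rewrite rowK.
Qed.

Lemma Ck_on_dirmx (V : normedModType R) m k (U : set V) (u : 'I_n -> V) (f : V -> 'rV[R]_m) :
  open U -> Ck_on k.+1 U f -> Ck_on k U (dirmx u f).
Proof.
move=> oU [df cf]; apply/Ck_on_mxP => // i j.
rewrite (_ : (fun _ => _) = fun x => 'D_(u i) f x 0 j); last by apply/funext => x; rewrite mxE.
exact: ((Ck_on_mxP k oU ('D_(u i) f)).1 (cf _) 0 j).
Qed.

Lemma row_mx_ext m (A B : 'M[R]_(n, m)) : (forall v : E, v *m A = v *m B) -> A = B.
Proof.
move=> H; apply/row_matrixP => k; have := H (e_ k).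
by rewrite -!rowE.
Qed.

Section BilinearForm.
Variables (V : normedModType R) (B : set E) (w : E -> E -> E -> R).
Hypothesis oB : open B.
Hypothesis wl : forall z, B z -> forall v, linear (w z ^~ v).
Hypothesis wr : forall z, B z -> forall u, linear (w z u : E -> R).
Hypothesis sw : forall u v, smooth_on B (fun z => w z u v).

Lemma derive_bilin (y u v : V -> E) x p : (\forall z \near x, B (y z)) ->
  differentiable y x -> differentiable u x -> differentiable v x ->
  differentiable (fun z => w (y z) (u z) (v z)) x /\
  'D_p (fun z => w (y z) (u z) (v z)) x =
    'D_('D_p y x) (fun z => w z (u x) (v x)) (y x) + w (y x) ('D_p u x) (v x)
    + w (y x) (u x) ('D_p v x).
Proof.
move=> nB dy du dv; have By := nbhs_singleton nB.
have dw a b : differentiable (fun z => w z a b) (y x) := (sw a b 1%N).1 _ By.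
have H k := @derive_lin2 _ _ _ B (fun z => w z (e_ k)) (fun z Bz => wr Bz (e_ k))
  y v x p oB nB (dw (e_ k)) dy dv.
pose f k z := u z 0 k * w (y z) (e_ k) (v z).
have duk k := (row_entry_derive p k du).1.
have Duk k := (row_entry_derive p k du).2.
have df k : differentiable (f k) x by apply: differentiableM => //; exact: (H k).1.
have ne : \forall z \near x, (\sum_k f k) z = w (y z) (u z) (v z).
  by near=> z; rewrite fct_sumE [RHS](lin_sum (wl _ (v z)) (u z))//; near: z.
split; first by apply: (differentiable_near ne); exact: differentiable_sum.
apply: (etrans (esym (near_eq_derive p ne))).
rewrite derive_sum; last by move=> k; exact: diff_derivable.
have nz : \forall z \near y x, (\sum_k (fun z => u x 0 k * w z (e_ k) (v x))) z = w z (u x) (v x).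
  by apply: (open_near oB By) => z Bz; rewrite fct_sumE [RHS](lin_sum (wl Bz (v x))).
have -> : 'D_('D_p y x) (fun z => w z (u x) (v x)) (y x) =
    \sum_k u x 0 k * 'D_('D_p y x) (fun z => w z (e_ k) (v x)) (y x).
  apply: (etrans (esym (near_eq_derive _ nz))); rewrite derive_sum; last first.
    move=> k; apply: diff_derivable.
    exact: (@differentiableZ _ _ _ (fun z => w z (e_ k) (v x)) (u x 0 k)).
  by apply: eq_bigr => k _; apply: deriveZ; apply: diff_derivable; exact: dw.
rewrite (lin_sum (wl By (v x)) ('D_p u x)).
rewrite (lin_sum (wl By ('D_p v x)) (u x)).
rewrite -!big_split; apply: eq_bigr => k _ /=.
apply: (etrans (deriveM _ _)); [exact: diff_derivable|exact: diff_derivable (H k).1|].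
rewrite (H k).2 Duk /GRing.scale /=; ring.
Unshelve. all: by end_near. Qed.

End BilinearForm.
End Misc.

(** * Flows in charts *)

Section Charts.
Variables (R : realType) (n : nat) (M : manifold R n).
Local Notation I := (atlas_index M).
Local Notation E := 'rV[R]_n.
Implicit Types (i j : I).

Lemma open_ccod i : open (@ccod R n M i). Proof. exact: open_cod. Qed.
Lemma open_cdom i : open (@cdom R n M i). Proof. exact: open_dom. Qed.

Lemma open_overlap i j : open (@overlap R n M i j).
Proof.
apply: open_setI_preimage; [exact: open_ccod| |exact: open_cdom].
by move=> x cx; apply: param_continuous.
Qed.

Lemma ccoordK i p : cdom i p -> cparam i (ccoord i p) = p.
Proof. exact: coordK. Qed.
Lemma cparamK i x : @ccod R n M i x -> ccoord i (cparam i x) = x.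
Proof. exact: paramK. Qed.
Lemma ccoord_cod i p : cdom i p -> ccod i (ccoord i p).
Proof. exact: coord_cod. Qed.
Lemma cparam_dom i x : @ccod R n M i x -> cdom i (cparam i x).
Proof. exact: param_dom. Qed.

Lemma smooth_transition i j : smooth_on (@overlap R n M i j) (transition i j).
Proof. exact: transition_smooth. Qed.

Lemma transition_cod i j x : @overlap R n M i j x -> ccod j (transition i j x).
Proof. by move=> [_ cx]; exact: ccoord_cod. Qed.

Lemma transition_ccoord i j p : cdom i p -> transition i j (ccoord i p) = ccoord j p.
Proof. by move=> ip; rewrite /transition /= ccoordK. Qed.

Lemma overlap_ccoord i j p : cdom i p -> cdom j p -> @overlap R n M i j (ccoord i p).
Proof. by move=> ip jp; split; [exact: ccoord_cod|rewrite /= ccoordK]. Qed.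

Lemma diff_transition i j x : @overlap R n M i j x -> differentiable (transition i j) x.
Proof. exact: (smooth_transition i j 1%N).1. Qed.

Lemma open_time_cod i : open ((setT : set R^o) `*` @ccod R n M i : set (R^o * 'rV[R]_n)%type).
Proof.
rewrite (_ : _ `*` _ = snd @^-1` (@ccod R n M i)).
  by apply: open_comp => [x _|]; [exact: cvg_snd|exact: open_ccod].
by apply/seteqP; split=> x //= [].
Qed.

End Charts.

(** An action of the real line. [circle_action] fixes the period 1, whereas the sphere requires a
    flow of period [2 * pi]. *)
Record smooth_flow (R : realType) (n : nat) (M : manifold R n) := SmoothFlow {
  flow_map :> R -> M -> M;
  flow_map0 : forall p, flow_map 0 p = p;
  flow_mapD : forall s t p, flow_map (s + t) p = flow_map s (flow_map t p);
  flow_map_smooth : forall i, smooth_into (V := (R^o * 'rV[R]_n)%type) (setT `*` @ccod R n M i)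
                      (fun tx => flow_map tx.1 (cparam i tx.2)) }.

Section Flow.
Variables (R : realType) (n : nat) (M : manifold R n) (Psi : smooth_flow M).
Local Notation I := (atlas_index M).
Local Notation E := 'rV[R]_n.
Local Notation V := (R^o * 'rV[R]_n)%type.
Implicit Types (i j : I).

Let sPsi := flow_map_smooth Psi.

Local Notation X := (@generator R n M Psi).

Definition flow_coord i j (tx : V) : E := ccoord j (Psi tx.1 (cparam i tx.2)).

Definition flow_dom i j : set V :=
  [set tx | ccod i tx.2 /\ cdom j (Psi tx.1 (cparam i tx.2))].

Definition time_dir : V := (1, 0).
Definition space_dir (v : E) : V := (0, v).

Lemma linear_space_dir : linear space_dir.
Proof. by move=> a u v; rewrite /space_dir; congr pair; rewrite /= ?scaler0 ?addr0. Qed.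

Let fd : findim V := findim_prod (findim_R R) (findim_mx R 1 n).

Lemma open_flow_dom i j : open (flow_dom i j).
Proof.
have oU := @open_time_cod _ _ M i.
have := open_setI_preimage oU (sPsi i).1 (open_cdom j).
by congr open; apply/seteqP; split=> x /=; [move=> [[_ ?] ?]|move=> [? ?]].
Qed.

Lemma smooth_flow_coord i j : smooth_on (flow_dom i j) (flow_coord i j).
Proof. by move=> k; apply: Ck_on_sub ((sPsi i).2 j k) => x []. Qed.

Lemma diff_flow_coord i j tx : flow_dom i j tx -> differentiable (flow_coord i j) tx.
Proof. exact: (smooth_flow_coord i j 1%N).1. Qed.

Lemma flow_coord_cod i j tx : flow_dom i j tx -> ccod j (flow_coord i j tx).
Proof. by move=> [_]; exact: ccoord_cod. Qed.

Lemma flow_dom0 i j x : overlap i j x -> flow_dom i j (0, x).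
Proof. by move=> [ix jx]; split=> //=; rewrite flow_map0. Qed.

Lemma flow_coord0 i j x : flow_coord i j (0, x) = transition i j x.
Proof. by rewrite /flow_coord /= flow_map0. Qed.

Lemma overlap_id i x : @ccod R n M i x -> overlap i i x.
Proof. by move=> ix; split=> //; exact: cparam_dom. Qed.

Lemma derive_flow_time i j tx : flow_dom i j tx ->
  'D_time_dir (flow_coord i j) tx = X j (flow_coord i j tx).
Proof.
move=> dtx; have [ix jx] := dtx; rewrite -(derive_at0 time_dir (diff_flow_coord dtx)).
rewrite /generator derive1E; congr (derive _ (0 : R) (1 : R)); apply/funext => s.
rewrite /flow_coord /= ccoordK// -flow_mapD scaler0 addr0 addrC.
by congr (ccoord j (Psi (_ + _) _)); exact: mulr1.
Qed.

Lemma flow_coord_transition i j j' tx : flow_dom i j tx ->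
  flow_coord i j' tx = transition j j' (flow_coord i j tx).
Proof. by move=> [_ jx]; rewrite /flow_coord transition_ccoord. Qed.

Lemma flow_overlap i j j' tx : flow_dom i j tx -> flow_dom i j' tx ->
  overlap j j' (flow_coord i j tx).
Proof. by move=> [_ jx] [_ jx']; exact: overlap_ccoord. Qed.

Lemma derive_flow_coord_transition i j j' tx w : flow_dom i j tx -> flow_dom i j' tx ->
  'D_w (flow_coord i j') tx = 'D_('D_w (flow_coord i j) tx) (transition j j') (flow_coord i j tx).
Proof.
move=> jx jx'; rewrite -derive_comp; [|exact: diff_flow_coord|exact/diff_transition/flow_overlap].
apply: near_eq_derive; apply: (open_near (@open_flow_dom i j) jx) => z jz.
exact: flow_coord_transition.
Qed.

Lemma generator_transition i j x : overlap i j x ->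
  X j (transition i j x) = 'D_(X i x) (transition i j) x.
Proof.
move=> ijx; have ix : ccod i x by case: ijx.
have d1 := flow_dom0 (overlap_id ix); have d2 := flow_dom0 ijx.
have E := derive_flow_time d2; rewrite flow_coord0 in E; rewrite -E.
apply: (etrans (derive_flow_coord_transition _ d1 d2)); rewrite (derive_flow_time d1).
by rewrite flow_coord0 [transition i i x](cparamK ix).
Qed.

Lemma smooth_generator i : smooth_on (@ccod R n M i) (X i).
Proof.
move=> k.
have c1 : Ck_on k (@ccod R n M i) (fun x : E => (0, x) : V).
  have L : linear (fun x : E => (0, x) : V).
    by move=> a u v; congr pair; rewrite /= ?scaler0 ?addr0.
  apply: (@Ck_on_lin _ _ _ _ _ (linear_of L)).
  by apply: findim_continuous; exact: findim_mx.
have dx x : ccod i x -> flow_dom i i (0, x) by move=> /overlap_id; exact: flow_dom0.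
have c2 : Ck_on k (flow_dom i i) ('D_time_dir (flow_coord i i)).
  exact: (smooth_flow_coord i i k.+1).2.
apply: (Ck_on_eq (@open_ccod _ _ M i)) (Ck_on_comp fd (findim_mx R 1 n)
  (@open_ccod _ _ M i) (@open_flow_dom i i) dx c1 c2) => x /[!inE] ix /=.
rewrite derive_flow_time; last exact: dx.
by rewrite flow_coord0 /transition /= cparamK.
Qed.

(** Flows preserve their generator: moving for time [t] after a short time [h] is the same as moving
    for time [t + h], and both sides are differentiated at [h = 0]. *)
Lemma derive_flow_generator i j tx : flow_dom i j tx ->
  'D_(space_dir (X i tx.2)) (flow_coord i j) tx = X j (flow_coord i j tx).
Proof.
case: tx => t x dtx; have [ix jx] := dtx.
apply: (etrans _ (derive_flow_time dtx)).
pose g (h : R) : V := (t, flow_coord i i (h, x)).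
have di : flow_dom i i (0, x) by apply: flow_dom0; exact: overlap_id.
have Ei : flow_coord i i (0, x) = x by rewrite flow_coord0 /transition /= cparamK.
have dl h : flow_dom i i (h, x) -> differentiable (fun h : R => flow_coord i i (h, x)) h.
  move=> dh; apply: (@differentiable_comp _ _ _ _ (fun h : R => (h, x) : V) (flow_coord i i)).
    by apply: differentiable_pair.
  exact: diff_flow_coord.
have Dl : 'D_1 (fun h : R => flow_coord i i (h, x)) 0 = X i x.
  apply: (@etrans _ _ ('D_time_dir (flow_coord i i) (0, x))); last first.
    by rewrite (derive_flow_time di) Ei.
  apply: (etrans _ (derive_at0 time_dir (diff_flow_coord di))).
  congr (derive _ (0 : R) (1 : R)); apply/funext => s; rewrite /flow_coord /= scaler0 addr0 add0r.
  by congr (ccoord i (Psi _ _)); exact/esym/mulr1.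
have dg : differentiable g 0 by apply: differentiable_pair => //; exact: dl.
have Dg : 'D_1 g 0 = space_dir (X i x).
  have dc : differentiable (fun=> t : R^o) (0 : R) by [].
  have := @derive_pair _ _ _ _ (fun=> t : R^o) (fun h : R => flow_coord i i (h, x)) 0 1 dc (dl _ di).
  by rewrite Dl derive_cst => ->.
have g0 : g 0 = (t, x) by rewrite /g Ei.
have := @derive_comp _ _ _ _ g (flow_coord i j) 0 1 dg.
rewrite g0 Dg => <-; last exact: diff_flow_coord.
apply: (etrans _ (derive_at0 time_dir (diff_flow_coord dtx))).
apply: near_eq_derive.
have nb : \forall h \near (0 : R), flow_dom i i (h, x).
  have c0 : {for (0 : R), continuous (fun h : R => (h, x) : V)}.
    by apply: differentiable_continuous; apply: differentiable_pair.
  by apply: c0; exact: (open_near (@open_flow_dom i i) di).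
apply: filterS nb => h [_ ih]; rewrite /g /flow_coord /= ccoordK// -flow_mapD scaler0 addr0.
by congr (ccoord j (Psi (_ + _) _)); exact/esym/mulr1.
Qed.

End Flow.

(** * Invariance of the symplectic form under the flow *)

Section SymplecticFlow.
Variables (R : realType) (n : nat) (M : manifold R n) (Psi : smooth_flow M).
Local Notation I := (atlas_index M).
Local Notation E := 'rV[R]_n.
Local Notation V := (R^o * 'rV[R]_n)%type.
Local Notation X := (@generator R n M Psi).
Implicit Types (i j : I).
Variable omega : tensor2 M.
Hypothesis w2 : two_form omega.

Lemma two_form_linearl i x : ccod i x -> forall v, linear (omega i x ^~ v : E -> R).
Proof. by move=> ix v a u u'; have [H _ _ _] := w2; rewrite H. Qed.

Lemma two_form_linearr i x : ccod i x -> forall u, linear (omega i x u : E -> R).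
Proof.
move=> ix u a v v'; have [H A _ _] := w2.
rewrite A// H// [in RHS](A _ _ ix u v) [in RHS](A _ _ ix u v').
by rewrite opprD /GRing.scale /= mulrN.
Qed.

Lemma smooth_two_form i u v : smooth_on (@ccod R n M i) (fun x => omega i x u v).
Proof. by have [_ _ H _] := w2. Qed.

Lemma two_form_anti i x u v : ccod i x -> omega i x u v = - omega i x v u.
Proof. by move=> ix; have [_ H _ _] := w2; exact: H. Qed.

Lemma two_form_transition i j x u v : overlap i j x ->
  omega i x u v = omega j (transition i j x) ('D_u (transition i j) x) ('D_v (transition i j) x).
Proof. by have [_ _ _ H] := w2; move=> /H. Qed.

Local Notation alpha := (Defs.contraction X omega).

Lemma contraction_linear i x : ccod i x -> linear (alpha i x : E -> R).
Proof. by move=> ix; exact: two_form_linearr. Qed.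

Lemma contraction_transition i j x v : overlap i j x ->
  alpha i x v = alpha j (transition i j x) ('D_v (transition i j) x).
Proof.
move=> ijx; rewrite /Defs.contraction generator_transition//.
exact: two_form_transition.
Qed.

Lemma smooth_contraction i v : smooth_on (@ccod R n M i) (fun x => alpha i x v).
Proof.
move=> k; have oc := @open_ccod _ _ M i.
have c1 : Ck_on k (@ccod R n M i) (fun x : E => x).
  by apply: (@Ck_on_lin _ _ _ _ _ idfun) => x; exact: cvg_id.
apply: (@Ck_on_lin2 _ _ _ (@ccod R n M i) (fun x u => omega i x u v)) => //.
- by move=> x ix; exact: two_form_linearl.
- by move=> u; exact: smooth_two_form.
- exact: smooth_generator.
Qed.

Hypothesis closed_omega : closed2 omega.
Hypothesis closed_alpha : closed1 alpha.

(* Cartan's formula L_X omega = d(iota_X omega) + iota_X d omega = 0, in a chart. *)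
Lemma lie_derivative0 i x u v : ccod i x ->
  'D_(X i x) (fun y => omega i y u v) x + omega i x ('D_u (X i) x) v
    + omega i x u ('D_v (X i) x) = 0.
Proof.
move=> ix; have oc := @open_ccod _ _ M i.
have dX : differentiable (X i) x := (smooth_generator Psi i 1%N).1 x ix.
have nx : \forall y \near x, ccod i y by exact: (open_near oc ix).
have H w a : 'D_a (fun y => alpha i y w) x =
    'D_a (fun y => omega i y (X i x) w) x + omega i x ('D_a (X i) x) w.
  have dw b : differentiable (fun y => omega i y b w) x := (smooth_two_form i b w 1%N).1 x ix.
  have := (@derive_lin2 _ _ _ (@ccod R n M i) (fun y b => omega i y b w)
    (fun y iy => two_form_linearl iy w) (fun y : E => y) (X i) x a oc nx dw _ dX).2.
  by move=> /(_ _) ->; rewrite ?derive_id.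
have := closed_alpha ix u v; rewrite !H => E1.
have := closed_omega ix (X i x) u v.
have nu : \forall y \near x, - omega i y (X i x) v = omega i y v (X i x).
  by apply: (open_near oc ix) => y iy; rewrite [RHS]two_form_anti.
have dn : derivable (fun y => omega i y (X i x) v) x u.
  by apply: diff_derivable; exact: (smooth_two_form i (X i x) v 1%N).1 x ix.
rewrite -(near_eq_derive u nu) (deriveN dn) => E2.
rewrite (two_form_anti u ('D_v (X i) x) ix).
lra.
Qed.

Lemma near_flow_dom i j t x : flow_dom Psi i j (t, x) -> \forall s \near t, flow_dom Psi i j (s, x).
Proof.
move=> dt; have c0 : {for t, continuous (fun h : R => (h, x) : V)}.
  by apply: differentiable_continuous; apply: differentiable_pair.
by apply: c0; exact: (open_near (@open_flow_dom _ _ _ Psi i j) dt).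
Qed.

Lemma time_line (t : R) (x : E) : ((0, x) : V) + t *: time_dir R n = (t, x).
Proof. by congr pair; rewrite /= ?scaler0 ?addr0 ?add0r//; exact: mulr1. Qed.

Lemma is_derive_time (W : normedModType R) (F : V -> W) t x : differentiable F (t, x) ->
  is_derive t 1 (fun s : R => F (s, x)) ('D_(time_dir R n) F (t, x)).
Proof.
rewrite -(time_line t x) => dF.
have := is_derive_along dF.
by congr is_derive; apply/funext => s; rewrite time_line.
Qed.

Lemma derive_flow0 i j x u : overlap i j x ->
  'D_(space_dir u) (flow_coord Psi i j) (0, x) = 'D_u (transition i j) x.
Proof.
move=> ijx; have d0 := flow_dom0 Psi ijx.
apply: (etrans (esym (derive_at0 (space_dir u) (diff_flow_coord d0)))).
apply: (etrans _ (derive_at0 u (diff_transition ijx))).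
congr (derive _ (0 : R) (1 : R)); apply/funext => s.
by rewrite -(flow_coord0 Psi); congr flow_coord; congr pair; rewrite /= scaler0 addr0.
Qed.

Lemma derive_transition_id i x u : ccod i x -> 'D_u (@transition R n M i i) x = u.
Proof.
move=> ix; apply: (etrans _ (derive_id x u)); apply: near_eq_derive.
by apply: (open_near (@open_ccod _ _ M i) ix) => z iz; exact: cparamK.
Qed.

(** Mixed derivatives commute and the time derivative of the flow is [X], so the time derivative of
    the pulled-back form is the pullback of the Lie derivative. *)
Lemma derive_pullback_time i j tx u v : flow_dom Psi i j tx ->
  let F := fun z => omega j (flow_coord Psi i j z) ('D_(space_dir u) (flow_coord Psi i j) z)
    ('D_(space_dir v) (flow_coord Psi i j) z) in
  differentiable F tx /\ 'D_(time_dir R n) F tx = 0.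
Proof.
move=> dtx; set y := flow_coord Psi i j => F.
have oD := @open_flow_dom _ _ _ Psi i j; have oc := @open_ccod _ _ M j.
have sy := smooth_flow_coord Psi i j; have dy := diff_flow_coord dtx.
have dD w : differentiable ('D_(space_dir w) y) tx := ((sy 2%N).2 (space_dir w)).1 tx dtx.
have nB : \forall z \near tx, ccod j (y z).
  by apply: (open_near oD dtx) => z; exact: flow_coord_cod.
have [dF ->] := derive_bilin oc (fun z jz v => two_form_linearl jz v)
  (fun z jz u => two_form_linearr jz u) (smooth_two_form j) (time_dir R n) nB dy (dD u) (dD v).
split=> //; have jy := nbhs_singleton nB.
have ED w : 'D_(time_dir R n) ('D_(space_dir w) y) tx = 'D_('D_(space_dir w) y tx) (X j) (y tx).
  have dX : differentiable (X j) (y tx) := (smooth_generator Psi j 1%N).1 _ jy.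
  apply: (etrans (derive_sym_mx _ _ oD dtx (sy 2%N))).
  apply: (etrans _ (derive_comp (space_dir w) dy dX)).
  by apply: near_eq_derive; apply: (open_near oD dtx) => z; exact: derive_flow_time.
have C3 (a b c a' b' c' : R) : a = a' -> b = b' -> c = c' -> a + b + c = a' + b' + c'.
  by move=> -> -> ->.
exact: (etrans (C3 _ _ _ _ _ _ (congr1 (derive _ _) (derive_flow_time dtx))
  (congr1 (omega j (y tx) ^~ _) (ED u)) (congr1 (omega j (y tx) _) (ED v)))
  (lie_derivative0 ('D_(space_dir u) y tx) ('D_(space_dir v) y tx) jy)).
Qed.

Lemma flow_preserves_form i j tx u v : flow_dom Psi i j tx ->
  omega j (flow_coord Psi i j tx) ('D_(space_dir u) (flow_coord Psi i j) tx)
    ('D_(space_dir v) (flow_coord Psi i j) tx) = omega i tx.2 u v.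
Proof.
pose G j z := omega j (flow_coord Psi i j z) ('D_(space_dir u) (flow_coord Psi i j) z)
    ('D_(space_dir v) (flow_coord Psi i j) z).
have GE j1 j2 z : flow_dom Psi i j1 z -> flow_dom Psi i j2 z -> G j1 z = G j2 z.
  move=> d1 d2; rewrite /G (two_form_transition _ _ (flow_overlap d1 d2)).
  rewrite -(flow_coord_transition _ d1).
  by congr (omega _ _ _ _); apply/esym/derive_flow_coord_transition.
case: tx => t x dtx; have [ix jx] := dtx; rewrite /= in ix jx *.
(* The orbit may leave every single chart, so the target chart follows the point. Near each time [F]
   agrees with its expression in one chart, where its derivative is 0; at time 0 it is the form
   itself. *)
pose F s := G (chart_at (Psi s (cparam i x))) (s, x).
have dom s : flow_dom Psi i (chart_at (Psi s (cparam i x))) (s, x).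
  by split=> //=; exact: chart_at_dom.
have F0 (s : R) : is_derive s 1 F 0.
  pose k := chart_at (Psi s (cparam i x)).
  have [dG DG] := derive_pullback_time u v (dom s).
  have := is_derive_time dG; rewrite DG; apply: near_eq_is_derive.
  by apply: filterS (near_flow_dom (dom s)) => r dr; exact: GE dr (dom r).
have := derive0_cst F0 t 0; rewrite /F => E0.
have E1 := GE _ _ _ (dom t) dtx; rewrite -[LHS]/(G j (t, x)) -E1 E0.
have oi := overlap_id ix; have d0 := flow_dom0 Psi oi.
rewrite (GE _ _ _ (dom 0) d0) /G flow_coord0 [transition i i x](cparamK ix).
by rewrite !(derive_flow0 _ oi) !(derive_transition_id _ ix).
Qed.

Lemma flow_preserves_contraction i j tx v : flow_dom Psi i j tx ->
  alpha j (flow_coord Psi i j tx) ('D_(space_dir v) (flow_coord Psi i j) tx) = alpha i tx.2 v.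
Proof.
move=> dtx; rewrite /Defs.contraction -(derive_flow_generator dtx).
exact: flow_preserves_form.
Qed.

End SymplecticFlow.

(** * The complex frame along the flow and its connection form *)

Section UnitaryFlow.
Variables (R : realType) (n : nat) (M : manifold R n) (Psi : smooth_flow M).
Local Notation I := (atlas_index M).
Local Notation E := 'rV[R]_n.
Local Notation V := (R^o * 'rV[R]_n)%type.
Local Notation e_ k := (delta_mx (0 : 'I_1) (k : 'I_n) : E).
Local Notation X := (@generator R n M Psi).
Local Notation time := (time_dir R n).
Local Notation y := (flow_coord Psi).
Implicit Types (i j : I).
Variables (omega : tensor2 M) (J : endo M) (A : connection_form M).
Hypothesis w2 : two_form omega.
Hypothesis closed_omega : closed2 omega.
Hypothesis closed_alpha : closed1 (Defs.contraction X omega).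
Hypothesis acs : compatible_acs omega J.
Hypothesis conn : unitary_connection omega J A.

Let fd : findim V := findim_prod (findim_R R) (findim_mx R 1 n).

Let smooth_J i : smooth_on (@ccod R n M i) (J i). Proof. by have [[H _] _ _ _] := acs. Qed.
Let JJ i x : ccod i x -> J i x *m J i x = - 1%:M. Proof. by have [_ H _ _] := acs; exact: H. Qed.
Let tame i x v : ccod i x -> v != 0 -> 0 < omega i x v (v *m J i x).
Proof. by move=> ix; have [_ _ _ H] := acs; exact: H. Qed.
Let J_transition i j x v : overlap i j x ->
  'D_(v *m J i x) (transition i j) x = 'D_v (transition i j) x *m J j (transition i j x).
Proof. by move=> ix; have [[_ H] _ _ _] := acs; exact: H. Qed.
Let A_linear i x : ccod i x -> linear (A i x).
Proof. by move=> ix a u v; have [[H _ _] _ _] := conn; exact: H. Qed.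
Let smooth_A i v : smooth_on (@ccod R n M i) (A i ^~ v).
Proof. by have [[_ H _] _ _] := conn; exact: H. Qed.
Let A_transition i j x v w : overlap i j x ->
  'D_v ('D_w (transition i j)) x
    + 'D_w (transition i j) x *m A j (transition i j x) ('D_v (transition i j) x)
  = 'D_(w *m A i x v) (transition i j) x.
Proof. by move=> ix; have [[_ _ H] _ _] := conn; exact: H. Qed.
Let DJ i x v : ccod i x -> 'D_v (J i) x = A i x v *m J i x - J i x *m A i x v.
Proof. by move=> ix; have [_ _ H] := conn; exact: H. Qed.

Definition flow_jacobian i j : V -> 'M[R]_n := dirmx (fun k => space_dir (e_ k)) (y i j).

Definition flow_frame i j (tx : V) : 'M[R]_n :=
  flow_jacobian i j tx - J i tx.2 *m flow_jacobian i j tx *m J j (y i j tx).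

Lemma mul_flow_jacobian i j tx v : flow_dom Psi i j tx ->
  v *m flow_jacobian i j tx = 'D_(space_dir v) (y i j) tx.
Proof.
move=> dtx; apply: (@mul_dirmx _ _ _ _ (@space_dir R n)); first exact: linear_space_dir.
exact: diff_flow_coord.
Qed.

Lemma unitmx_inj m (B : 'M[R]_m) : (forall v : 'rV_m, v *m B = 0 -> v = 0) -> B \in unitmx.
Proof.
move=> H; rewrite -row_free_unit -kermx_eq0; apply/eqP/row_matrixP => k.
by rewrite row0; apply: H; rewrite -row_mul mulmx_ker row0.
Qed.

(** On a vector [v] killed by the frame the Jacobian [L] is antilinear. Invariance of [omega] then
    makes [omega(v, v J)] the opposite of [omega(v L, v L J)], so both cannot obey tameness unless
    [v] is 0. *)
Lemma flow_frame_unit i j tx : flow_dom Psi i j tx -> flow_frame i j tx \in unitmx.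
Proof.
move=> dtx; have [ix _] := dtx; have jy := flow_coord_cod dtx.
apply: unitmx_inj => v; rewrite /flow_frame mulmxBr !mulmxA.
set L := flow_jacobian i j tx; set J0 := J i tx.2; set J1 := J j _ => E0.
have Eab : v *m L = v *m J0 *m L *m J1 by apply/eqP; rewrite -subr_eq0; apply/eqP.
have EJ : v *m L *m J1 = - (v *m J0 *m L).
  by rewrite Eab -(mulmxA _ J1) JJ// mulmxN mulmx1.
apply/eqP; apply: contraT => vn0.
have := tame ix vn0.
rewrite -(flow_preserves_form w2 closed_omega closed_alpha v (v *m J i tx.2) dtx).
rewrite -!mul_flow_jacobian// -/L -/J0.
have -> : v *m J0 *m L = - (v *m L *m J1) by rewrite EJ opprK.
have oN a b : omega j (y i j tx) a (- b) = - omega j (y i j tx) a b.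
  have := two_form_linearr w2 jy a; move=> /(_ (-1) b 0).
  have Z : omega j (y i j tx) a 0 = 0.
    by have := two_form_linearr w2 jy a (-1) 0 0; rewrite scaler0 addr0 scaleN1r addNr.
  by rewrite Z !addr0 !scaleN1r.
rewrite oN oppr_gt0; have [->|aL] := eqVneq (v *m L) 0.
  have Z b : omega j (y i j tx) 0 b = 0.
    by have := two_form_linearl w2 jy b (-1) 0 0; rewrite scaler0 addr0 scaleN1r addNr.
  by rewrite Z ltxx.
by move=> H; have := tame jy aL; rewrite ltNge ltW.
Qed.

Lemma flow_frame_J i j tx : flow_dom Psi i j tx ->
  flow_frame i j tx *m J j (y i j tx) = J i tx.2 *m flow_frame i j tx.
Proof.
move=> dtx; have [ix _] := dtx; have jy := flow_coord_cod dtx.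
rewrite /flow_frame mulmxBl mulmxBr -!mulmxA JJ// !mulmxA JJ//.
by rewrite !mulmxN !mulNmx mulmx1 mul1mx !opprK addrC.
Qed.

Lemma smooth_J_snd i j : smooth_on (flow_dom Psi i j) (fun tx => J i tx.2).
Proof.
move=> k; have oD := @open_flow_dom _ _ _ Psi i j.
have c1 : Ck_on k (flow_dom Psi i j) (snd : V -> E).
  have L : linear (snd : V -> E) by [].
  apply: (@Ck_on_lin _ _ _ _ _ (linear_of L)).
  by apply: findim_continuous.
apply: (Ck_on_comp (findim_mx R 1 n) (findim_mx R n n) oD (@open_ccod _ _ M i) _ c1 (smooth_J i k)).
by move=> tx [].
Qed.

Lemma smooth_flow_jacobian i j : smooth_on (flow_dom Psi i j) (flow_jacobian i j).
Proof.
move=> k; apply: Ck_on_dirmx; first exact: open_flow_dom.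
exact: (smooth_flow_coord Psi i j k.+1).
Qed.

Lemma smooth_flow_frame i j : smooth_on (flow_dom Psi i j) (flow_frame i j).
Proof.
move=> k; have oD := @open_flow_dom _ _ _ Psi i j; have cL := smooth_flow_jacobian i j k.
apply: Ck_onB => //; apply: Ck_on_mulmx => //.
  by apply: Ck_on_mulmx => //; exact: (smooth_J_snd i j k).
apply: (Ck_on_comp (findim_mx R 1 n) (findim_mx R n n) oD (@open_ccod _ _ M j) _ (smooth_flow_coord Psi i j k) (smooth_J j k)).
by move=> tx; exact: flow_coord_cod.
Qed.

Definition theta i j (w : V) (tx : V) : R :=
  frame_trace (y i j) (A j) (flow_frame i j) (fun tx => J i tx.2) w tx.

Lemma smooth_theta i j w : smooth_on (flow_dom Psi i j) (theta i j w).
Proof.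
apply: (@smooth_frame_trace _ _ _ _ (@ccod R n M j)).
- exact: open_flow_dom.
- exact: open_ccod.
- by move=> tx; exact: flow_coord_cod.
- by move=> z; exact: A_linear.
- exact: smooth_flow_coord.
- exact: smooth_A.
- exact: smooth_flow_frame.
- exact: smooth_J_snd.
- by move=> z; exact: flow_frame_unit.
Qed.

(** The complex structure at the source point does not move with time, which is what
    [curvature_trace] asks of one of its directions. The factor [4 * pi] is the normalisation of
    [chern_form]. *)
Lemma theta_chern i j tx v : flow_dom Psi i j tx ->
  'D_(space_dir v) (theta i j time) tx - 'D_time (theta i j (space_dir v)) tx =
  4 * pi * chern_form J A j (y i j tx) ('D_(space_dir v) (y i j) tx) (X j (y i j tx)).
Proof.
move=> dtx; have [ix _] := dtx.
have D0 : 'D_time (fun tx : V => J i tx.2) tx = 0.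
  have dJ : differentiable (J i) tx.2 := (smooth_J i 1%N).1 _ ix.
  have ds : differentiable (snd : V -> E) tx.
    have L : linear (snd : V -> E) by [].
    apply: (@linear_differentiable _ _ _ (linear_of L)).
    by apply: findim_continuous.
  apply: (etrans (derive_comp time ds dJ)).
  have -> : 'D_time (snd : V -> E) tx = 0.
    have L : linear (snd : V -> E) by [].
    have := @derive_at0 _ _ _ (snd : V -> E) tx time ds => <-.
    rewrite (_ : (fun _ => _) = cst tx.2); first exact: derive_cst.
    by apply/funext => s; rewrite /= scaler0 addr0.
  exact: derive0.
apply: (etrans (@curvature_trace _ _ _ (flow_dom Psi i j) (@ccod R n M j) (y i j) (A j) (J j)
  (flow_frame i j) (fun tx => J i tx.2) (@open_flow_dom _ _ _ Psi i j) (@open_ccod _ _ M j)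
  (@flow_coord_cod _ _ _ Psi i j) (@A_linear j) (smooth_flow_coord Psi i j) (smooth_A j) (smooth_J j)
  (smooth_flow_frame i j) (smooth_J_snd i j) (@flow_frame_unit i j) (@flow_frame_J i j)
  (fun z v jz => DJ v jz) tx dtx (space_dir v) time D0)).
have p0 : (4 * pi : R) != 0 by rewrite mulf_neq0// gt_eqF// pi_gt0.
rewrite /chern_form /curvature mulrA mulfV// mul1r.
by rewrite -(derive_flow_time dtx).
Qed.

Definition transition_jacobian j j' : E -> 'M[R]_n := dirmx (fun k => e_ k) (transition j j' : E -> E).

Lemma mul_transition_jacobian j j' z v : overlap j j' z ->
  v *m transition_jacobian j j' z = 'D_v (transition j j' : E -> E) z.
Proof.
move=> jz; apply: (@mul_dirmx _ _ _ _ (fun x : E => x)); first by [].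
exact: diff_transition.
Qed.

Lemma smooth_transition_jacobian j j' : smooth_on (overlap j j') (transition_jacobian j j').
Proof.
move=> k; apply: Ck_on_dirmx; first exact: open_overlap.
exact: (smooth_transition j j' k.+1).
Qed.

Lemma transition_jacobian_J j j' z : overlap j j' z ->
  J j z *m transition_jacobian j j' z = transition_jacobian j j' z *m J j' (transition j j' z).
Proof.
move=> jz; apply: row_mx_ext => v.
by rewrite !mulmxA !mul_transition_jacobian// J_transition.
Qed.

Lemma flow_jacobian_target i j j' tx : flow_dom Psi i j tx -> flow_dom Psi i j' tx ->
  flow_jacobian i j' tx = flow_jacobian i j tx *m transition_jacobian j j' (y i j tx).
Proof.
move=> d d'; have jz := flow_overlap d d'; apply: row_mx_ext => v.
apply: (etrans (mul_flow_jacobian v d')); rewrite mulmxA (mul_flow_jacobian v d).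
apply: (etrans _ (esym (mul_transition_jacobian _ jz))).
exact: derive_flow_coord_transition.
Qed.

Lemma flow_frame_target i j j' tx : flow_dom Psi i j tx -> flow_dom Psi i j' tx ->
  flow_frame i j' tx = flow_frame i j tx *m transition_jacobian j j' (y i j tx).
Proof.
move=> d d'; have jz := flow_overlap d d'.
rewrite /flow_frame (flow_jacobian_target d d') (flow_coord_transition j' d).
by rewrite mulmxBl -!mulmxA (transition_jacobian_J jz).
Qed.

(** The transformation law of the connection, with the second derivative of the transition map read
    as the derivative of its Jacobian. *)
Lemma derive_transition_jacobian j j' z v : overlap j j' z ->
  'D_v (transition_jacobian j j') z +
    transition_jacobian j j' z *m A j' (transition j j' z) ('D_v (transition j j' : E -> E) z) =
  A j z v *m transition_jacobian j j' z.
Proof.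
move=> jz; apply: row_mx_ext => u; have oO := @open_overlap _ _ M j j'.
rewrite mulmxDr !mulmxA !mul_transition_jacobian//.
rewrite -A_transition//; congr (_ + _).
have dT : derivable (transition_jacobian j j') z v.
  by apply: diff_derivable; exact: (smooth_transition_jacobian j j' 1%N).1 z jz.
have E1 := derive_mulmx (derivable_cst u z v) dT.
rewrite derive_cst mul0mx add0r /cst in E1.
apply: (etrans (esym E1)); apply: near_eq_derive.
by apply: (open_near oO jz) => x jx; exact: mul_transition_jacobian.
Qed.

(** A new target chart multiplies the frame on the right by the transition Jacobian, whose
    derivative is precisely the inhomogeneous term in the law of the connection; the connection
    matrix in the frame is unchanged. *)
Lemma theta_target i j j' w tx : flow_dom Psi i j tx -> flow_dom Psi i j' tx ->
  theta i j w tx = theta i j' w tx.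
Proof.
move=> d d'; have jz := flow_overlap d d'.
have oD := @open_flow_dom _ _ _ Psi i j; have oD' := @open_flow_dom _ _ _ Psi i j'.
set T := transition_jacobian j j' (y i j tx).
have FE := flow_frame_target d d'.
have uF := flow_frame_unit d; have uF' := flow_frame_unit d'.
have uT : T \in unitmx by move: uF'; rewrite FE unitmx_mul => /andP[].
have dF : derivable (flow_frame i j) tx w.
  by apply: diff_derivable; exact: (smooth_flow_frame i j 1%N).1 tx d.
have dTd : differentiable (transition_jacobian j j') (y i j tx) :=
  (smooth_transition_jacobian j j' 1%N).1 _ jz.
have dT : derivable (transition_jacobian j j' \o y i j) tx w.
  by apply: diff_derivable; apply: differentiable_comp => //; exact: diff_flow_coord.
have DF : 'D_w (flow_frame i j') tx = 'D_w (flow_frame i j) tx *m T +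
    flow_frame i j tx *m 'D_('D_w (y i j) tx) (transition_jacobian j j') (y i j tx).
  rewrite -(derive_comp w (diff_flow_coord d) dTd).
  apply: (etrans _ (derive_mulmx dF dT)); apply: near_eq_derive.
  have := open_near oD d (fun z dz => dz); apply: filterS2 (open_near oD' d' (fun z dz => dz)).
  by move=> z dz' dz; exact: flow_frame_target.
have Dy := derive_flow_coord_transition w d d'.
have DT := derive_transition_jacobian ('D_w (y i j) tx) jz.
rewrite /theta /frame_trace /frame_connection DF Dy (flow_coord_transition j' d) FE -/T.
rewrite -mulmxA -(addrA _ _ (_ *m (T *m _))) -mulmxDr DT mulmxA -mulmxDl.
have -> : invmx (flow_frame i j tx *m T) = invmx T *m invmx (flow_frame i j tx).
  apply: (can_inj (mulmxK uF')) => /=; rewrite FE mulVmx; last by rewrite -FE.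
  by rewrite mulmxA mulmxKV// mulVmx.
by rewrite mulmxA mulmxK.
Qed.

(** A new source chart multiplies the frame on the left by a matrix [S] that depends on [x] only. In
    the time direction this conjugates the connection matrix; in a space direction the derivative of
    [S] would enter. *)
Lemma theta_source i i' j t x : overlap i i' x -> flow_dom Psi i j (t, x) ->
  theta i j time (t, x) = theta i' j time (t, transition i i' x).
Proof.
move=> ix d; have [_ jx] := d.
have pE z : overlap i i' z -> cparam i' (transition i i' z) = cparam i z.
  by move=> [_ iz]; rewrite /transition /= ccoordK.
have yE s z : overlap i i' z -> y i j (s, z) = y i' j (s, transition i i' z).
  by move=> iz; rewrite /flow_coord /= (pE z iz).
have dE s z : overlap i i' z -> flow_dom Psi i j (s, z) -> flow_dom Psi i' j (s, transition i i' z).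
  by move=> iz [_ jz]; split; [exact: transition_cod|rewrite /= (pE z iz)].
pose S := transition_jacobian i i' x.
have LE s : flow_dom Psi i j (s, x) ->
    flow_jacobian i j (s, x) = S *m flow_jacobian i' j (s, transition i i' x).
  move=> ds; apply: row_mx_ext => v; have ds' := dE s x ix ds.
  rewrite mulmxA (mul_flow_jacobian _ ds) (mul_transition_jacobian _ ix) (mul_flow_jacobian _ ds').
  have oO := @open_overlap _ _ M i i'.
  pose g (z : E) : V := (s, transition i i' z).
  have dtr := diff_transition ix.
  have dc : differentiable (fun=> s : R^o) x by [].
  have dg : differentiable g x by apply: differentiable_pair.
  have Dg : 'D_v g x = space_dir ('D_v (transition i i' : E -> E) x).
    have := @derive_pair _ _ _ _ (fun=> s : R^o) (transition i i' : E -> E) x v dc dtr.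
    by rewrite derive_cst => ->.
  rewrite -Dg; apply: (etrans _ (derive_comp v dg (diff_flow_coord ds'))).
  pose h (z : E) : V := (s, z).
  have dh : differentiable h x by apply: differentiable_pair.
  have Dh : 'D_v h x = space_dir v.
    have := @derive_pair _ _ _ _ (fun=> s : R^o) (fun z : E => z) x v dc (@ex_diff _ _ _ _ _ _ _ (is_diff_id x)).
    by rewrite derive_cst derive_id => ->.
  rewrite -Dh; apply: (etrans (esym (derive_comp v dh (diff_flow_coord ds)))).
  by apply: near_eq_derive; apply: (open_near oO ix) => z iz; exact: yE.
have FE s : flow_dom Psi i j (s, x) ->
    flow_frame i j (s, x) = S *m flow_frame i' j (s, transition i i' x).
  move=> ds; rewrite /flow_frame (LE s ds) (yE s x ix) /= mulmxBr !mulmxA.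
  by rewrite (transition_jacobian_J ix).
have d' := dE t x ix d.
have uF := flow_frame_unit d; have uF' := flow_frame_unit d'.
have uS : S \in unitmx by move: uF; rewrite (FE t d) unitmx_mul => /andP[].
pose G s := flow_frame i' j (s, transition i i' x).
have dG' : differentiable (flow_frame i' j) (t, transition i i' x) :=
  (smooth_flow_frame i' j 1%N).1 _ d'.
have dG := is_derive_time dG'.
have dF' : differentiable (flow_frame i j) (t, x) := (smooth_flow_frame i j 1%N).1 _ d.
have DF : 'D_time (flow_frame i j) (t, x) = S *m 'D_time (flow_frame i' j) (t, transition i i' x).
  have [_ <-] := is_derive_time dF'; have [dG1 <-] := dG.
  have := derive_mulmx (derivable_cst S t 1) dG1.
  rewrite derive_cst mul0mx add0r => <-; apply: near_eq_derive.
  by apply: filterS (near_flow_dom d) => s; exact: FE.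
rewrite /theta /frame_trace /frame_connection DF (derive_flow_time d) (derive_flow_time d').
rewrite (yE t x ix) (FE t d) /= -!mulmxA -mulmxDr.
set F := flow_frame i' j _; set N := _ + _.
have -> : invmx (S *m F) = invmx F *m invmx S.
  apply: (can_inj (mulmxK uF)) => /=; rewrite (FE t d) -/F mulVmx; last by rewrite -/F -(FE t d).
  by rewrite -mulmxA (mulmxA (invmx S)) mulVmx// mul1mx mulVmx.
rewrite -!mulmxA mxtrace_mulC -!mulmxA (transition_jacobian_J ix) (mulmxA (invmx S)) mulVmx// mul1mx.
by [].
Qed.

End UnitaryFlow.

(** * Differentiation of integrals with a parameter *)

Section IntegralsWithParameter.
Variables (R : realType).
Local Notation mu := (@lebesgue_measure R).

Lemma continuous_integrable (f : R -> R) (a b : R) : continuous f ->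
  mu.-integrable `[a, b] (EFin \o f).
Proof.
move=> cf; apply: continuous_compact_integrable; first exact: segment_compact.
exact: continuous_subspaceT.
Qed.

Lemma Rintegral_derive (f F : R -> R) (a b : R) : a < b -> continuous f ->
  (forall x : R, is_derive x 1 F (f x)) -> \int[mu]_(x in `[a, b]) f x = F b - F a.
Proof.
move=> ab cf dF; have cF : continuous F by move=> x; exact: (is_derive_continuous (dF x)).
rewrite /Rintegral (@continuous_FTC2 _ f F)//.
- exact: continuous_subspaceT.
- split; first by move=> x _; have [] := dF x.
  + apply: cvg_at_right_filter; exact: cF.
  + apply: cvg_at_left_filter; exact: cF.
- by move=> x _; rewrite derive1E; have [] := dF x.
Qed.

Variables (g G : R -> R -> R) (T : R).
Hypothesis T0 : 0 < T.
Hypothesis dg : forall s t : R, is_derive s 1 (g^~ t) (G s t).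
Hypothesis cg : forall s, continuous (g s).
Hypothesis cG : continuous (fun p : R^o * R^o => G p.1 p.2).

Let cG1 s : continuous (G s).
Proof.
move=> t; apply: (@continuous_comp _ _ _ (fun t : R => (s, t) : R^o * R^o) (fun p => G p.1 p.2)).
  by apply: differentiable_continuous; apply: differentiable_pair.
exact: cG.
Qed.

Let cG2 t : continuous (G^~ t).
Proof.
move=> s; apply: (@continuous_comp _ _ _ (fun s : R => (s, t) : R^o * R^o) (fun p => G p.1 p.2)).
  by apply: differentiable_continuous; apply: differentiable_pair.
exact: cG.
Qed.

(** Compactness of a closed rectangle gives the constant that dominates the derivative under the
    integral. *)
Let bound (a : R) : exists2 K : R, 0 <= K &
  forall s t, a - 1 < s < a + 1 -> 0 <= t <= T -> `|G s t| <= K.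
Proof.
pose A : set (R^o * R^o) := (`[a - 1, a + 1] `*` `[0, T])%classic.
have cA : compact A by apply: compact_setX; exact: segment_compact.
have cN : continuous (fun p : R^o * R^o => `|G p.1 p.2|).
  move=> p; apply: (@continuous_comp _ _ _ (fun p : R^o * R^o => G p.1 p.2) (fun x => `|x|)).
    exact: cG.
  exact: norm_continuous.
have A0 : A !=set0 by exists (a, 0); split; rewrite /= in_itv /=; apply/andP; split; rewrite ?(ltW T0)//; lra.
have [c _ H] := compact_EVT_max A0 cA (continuous_subspaceT cN).
exists `|G c.1 c.2| => // s t sI tI; apply: (H (s, t)); rewrite inE; split; rewrite /= in_itv //=.
by move: sI => /andP[? ?]; apply/andP; split; exact: ltW.
Qed.

Let N s := \int[mu]_(t in `[0, T]) g s t.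

Let partial s t : partial1of2 g s t = G s t.
Proof. by rewrite partial1of2E; have [] := dg s t. Qed.

Lemma is_derive_integral (s : R) : is_derive s 1 N (\int[mu]_(t in `[0, T]) G s t).
Proof.
have [K K0 HK] := bound s.
have mT : measurable (`[0, T] : set R) by exact: measurable_itv.
have Is : `](s - 1), (s + 1)[%classic s by rewrite /= in_itv /=; apply/andP; split; lra.
have intf x : `](s - 1), (s + 1)[%classic x -> mu.-integrable `[0, T] (EFin \o g x).
  by move=> _; exact: continuous_integrable.
have intK : mu.-integrable `[0, T] (EFin \o cst K) by apply: continuous_integrable; exact: cst_continuous.
have ub x t : `](s - 1), (s + 1)[%classic x -> `[0, T]%classic t -> `|partial1of2 g x t| <= K.
  by rewrite /= !in_itv /= => xI tI; rewrite partial; exact: HK.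
have df x t : `](s - 1), (s + 1)[%classic x -> `[0, T]%classic t -> derivable (g^~ t) x 1.
  by move=> _ _; have [] := dg x t.
have K0' : forall _ : R, 0 <= K by [].
apply: DeriveDef.
  exact: (@derivable_under_integral _ _ _ mu g _ mT s _ _ Is intf df (cst K) K0' intK ub).
have := @differentiation_under_integral _ _ _ mu g _ mT s _ _ Is intf df (cst K) K0' intK ub.
by rewrite derive1E => ->; apply: eq_Rintegral => t _; rewrite partial.
Qed.

Lemma continuous_integral : continuous (fun s => \int[mu]_(t in `[0, T]) G s t).
Proof.
move=> s; have [K K0 HK] := bound s.
have mT : measurable (`[0, T] : set R) by exact: measurable_itv.
have intK : mu.-integrable `[0, T] (EFin \o cst K) by apply: continuous_integrable; exact: cst_continuous.
apply: (@continuity_under_integral _ _ _ mu G `[0, T] mT (s - 1) (s + 1) _ _ (cst K)) => //.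
- by move=> x _; exact: continuous_integrable.
- by apply: aeW => t _ x _; exact: cG2.
- move=> x; rewrite /= in_itv /= => xI; apply: aeW => t; rewrite /= in_itv /= => tI.
  exact: HK.
- by rewrite inE /= in_itv /=; apply/andP; split; lra.
Qed.

(** The inner integral is the derivative of [N], so the outer one keeps only the values at the two
    ends; no exchange of integrals takes place. *)
Lemma double_integral_derive (a b : R) : a < b ->
  \int[mu]_(s in `[a, b]) \int[mu]_(t in `[0, T]) G s t = N b - N a.
Proof.
by move=> ab; apply: Rintegral_derive => //; [exact: continuous_integral|exact: is_derive_integral].
Qed.

End IntegralsWithParameter.

(** * Integrals over the surface swept out by a path *)

Lemma continuous_for_sum (R : realType) (T : topologicalType) (m : nat) (f : 'I_m -> T -> R) x :
  (forall k, {for x, continuous (f k)}) -> {for x, continuous (fun z => \sum_k f k z)}.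
Proof.
elim: m f => [|m IH] f cf.
  by rewrite (_ : (fun _ => _) = cst 0); [exact: cst_continuous|apply/funext => z; rewrite big_ord0].
rewrite (_ : (fun _ => _) = (fun z => f ord0 z + \sum_k f (lift ord0 k) z)).
  by apply: continuousD; [exact: cf|exact: IH].
by apply/funext => z; rewrite big_ord_recl.
Qed.

Lemma differentiable_fst (R : realType) (V W : normedModType R) (p : V * W) :
  differentiable (fst : V * W -> V) p.
Proof.
have L : linear (fst : V * W -> V) by [].
by apply: (@linear_differentiable _ _ _ (linear_of L)) => x; exact: cvg_fst.
Qed.

Lemma differentiable_snd (R : realType) (V W : normedModType R) (p : V * W) :
  differentiable (snd : V * W -> W) p.
Proof.
have L : linear (snd : V * W -> W) by [].
by apply: (@linear_differentiable _ _ _ (linear_of L)) => x; exact: cvg_snd.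
Qed.

Section SmoothPath.
Variables (R : realType) (n : nat) (M : manifold R n) (Psi : smooth_flow M).
Local Notation I := (atlas_index M).
Local Notation E := 'rV[R]_n.
Local Notation V := (R^o * 'rV[R]_n)%type.
Local Notation y := (flow_coord Psi).
Implicit Types (i j : I).
Variable sigma : R -> M.
Hypothesis ssigma : smooth_into setT sigma.

Definition path_coord i (s : R) : E := ccoord i (sigma s).
Definition velocity i (s : R) : E := 'D_1 (path_coord i) s.

Lemma open_path_dom i : open (sigma @^-1` cdom i).
Proof.
have := open_setI_preimage (@openT R) ssigma.1 (@open_cdom _ _ M i).
by rewrite setTI.
Qed.

Lemma smooth_path_coord i : smooth_on (sigma @^-1` cdom i) (path_coord i).
Proof. by have := ssigma.2 i; rewrite setTI. Qed.

Lemma diff_path_coord i s : cdom i (sigma s) -> differentiable (path_coord i) s.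
Proof. by move=> is_; exact: (smooth_path_coord i 1%N).1. Qed.

Lemma near_path_dom i s : cdom i (sigma s) -> \forall r \near s, cdom i (sigma r).
Proof. by move=> is_; apply: (open_near (@open_path_dom i) is_). Qed.

Lemma velocity_transition i j s : cdom i (sigma s) -> cdom j (sigma s) ->
  velocity j s = 'D_(velocity i s) (transition i j : E -> E) (path_coord i s).
Proof.
move=> is_ js; have ov := overlap_ccoord is_ js.
rewrite /velocity.
have dt : differentiable (transition i j : E -> E) (path_coord i s) := diff_transition ov.
have H := @derive_comp _ _ _ _ (path_coord i) (transition i j : E -> E) s 1 (diff_path_coord is_) dt.
apply: (etrans _ H).
apply: near_eq_derive; apply: filterS (near_path_dom is_) => r ir.
exact/esym/transition_ccoord.
Qed.

Lemma path_flow_dom i j s t : cdom i (sigma s) -> cdom j (Psi t (sigma s)) ->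
  flow_dom Psi i j (t, path_coord i s).
Proof. by move=> is_ jst; split=> /=; [exact: ccoord_cod|rewrite /path_coord ccoordK]. Qed.

Lemma path_flow_coord i j s t : cdom i (sigma s) ->
  y i j (t, path_coord i s) = ccoord j (Psi t (sigma s)).
Proof. by move=> is_; rewrite /flow_coord /= /path_coord ccoordK. Qed.

Lemma derive_path_const (W : normedModType R) (F : V -> W) i s t : cdom i (sigma s) ->
  differentiable F (t, path_coord i s) ->
  differentiable (fun r : R => F (t, path_coord i r)) s /\
  'D_1 (fun r : R => F (t, path_coord i r)) s = 'D_(space_dir (velocity i s)) F (t, path_coord i s).
Proof.
move=> is_ dF; have dp := diff_path_coord is_.
have dc : differentiable (fun=> t : R^o) s by [].
pose h r : V := (t, path_coord i r).
have dh : differentiable h s by apply: differentiable_pair.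
have Dh : 'D_1 h s = space_dir (velocity i s).
  have := @derive_pair _ _ _ _ (fun=> t : R^o) (path_coord i) s 1 dc dp.
  by rewrite derive_cst => ->.
split; first exact: (differentiable_comp dh dF).
have H := @derive_comp _ _ _ _ h F s 1 dh dF.
by rewrite Dh in H.
Qed.

Lemma velocity_flow i j s t : cdom i (sigma s) -> cdom j (Psi t (sigma s)) ->
  'D_1 (fun r : R => ccoord j (Psi t (sigma r))) s =
  'D_(space_dir (velocity i s)) (y i j) (t, path_coord i s).
Proof.
move=> is_ jst; have d := path_flow_dom is_ jst.
rewrite -(derive_path_const is_ (diff_flow_coord d)).2.
by apply: near_eq_derive; apply: filterS (near_path_dom is_) => r ir; rewrite path_flow_coord.
Qed.

Lemma continuous_path_pair i s t : cdom i (sigma s) ->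
  {for (s, t), continuous (fun p : R^o * R^o => (p.2, path_coord i p.1) : V)}.
Proof.
move=> is_; apply: differentiable_continuous; apply: differentiable_pair.
  exact: differentiable_snd.
apply: (@differentiable_comp _ _ _ _ (fst : R^o * R^o -> R) (path_coord i)).
  exact: differentiable_fst.
exact: diff_path_coord is_.
Qed.

End SmoothPath.

(** * Vanishing of the Chern integral over a swept surface *)

Section ChernIntegral.
Variables (R : realType) (n : nat) (M : manifold R n) (Psi : smooth_flow M).
Local Notation I := (atlas_index M).
Local Notation E := 'rV[R]_n.
Local Notation V := (R^o * 'rV[R]_n)%type.
Local Notation e_ k := (delta_mx (0 : 'I_1) (k : 'I_n) : E).
Local Notation X := (@generator R n M Psi).
Local Notation time := (time_dir R n).
Local Notation y := (flow_coord Psi).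
Local Notation mu := (@lebesgue_measure R).
Implicit Types (i j : I).
Variables (omega : tensor2 M) (J : endo M) (A : connection_form M).
Hypothesis w2 : two_form omega.
Hypothesis closed_omega : closed2 omega.
Hypothesis closed_alpha : closed1 (Defs.contraction X omega).
Hypothesis acs : compatible_acs omega J.
Hypothesis conn : unitary_connection omega J A.
Variable T : R.
Hypothesis T0 : 0 < T.
Hypothesis Psi_periodic : forall t p, Psi (t + T) p = Psi t p.
Variable sigma : R -> M.
Hypothesis ssigma : smooth_into setT sigma.

Local Notation th := (theta Psi J A).
Local Notation xc := (path_coord sigma).
Local Notation vel := (velocity sigma).
Let sth i j w : smooth_on (flow_dom Psi i j) (th i j w) :=
  smooth_theta w2 closed_omega closed_alpha acs conn i j w.
Let dth i j w tx : flow_dom Psi i j tx -> differentiable (th i j w) tx.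
Proof. exact: (sth i j w 1%N).1. Qed.

(** The dt-component of [theta] as a function on all of [M], in charts picked pointwise;
    [time_traceE] frees it from that choice. Its integral over a period is, up to a constant, the
    function mu. *)
Definition time_trace (p : M) (t : R) : R :=
  let i := chart_at p in th i (chart_at (Psi t p)) time (t, ccoord i p).

Lemma time_traceE i j p t : cdom i p -> cdom j (Psi t p) ->
  time_trace p t = th i j time (t, ccoord i p).
Proof.
move=> ip jp; rewrite /time_trace; set i0 := chart_at p; set j0 := chart_at _.
have ip0 : cdom i0 p by exact: chart_at_dom.
have jp0 : cdom j0 (Psi t p) by exact: chart_at_dom.
have d k l : cdom k p -> cdom l (Psi t p) -> flow_dom Psi k l (t, ccoord k p).
  by move=> kp lp; split=> /=; [exact: ccoord_cod|rewrite ccoordK].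
rewrite (theta_target w2 closed_omega closed_alpha acs conn time (d _ _ ip0 jp0) (d _ _ ip0 jp)).
rewrite (theta_source A w2 closed_omega closed_alpha acs (overlap_ccoord ip0 ip) (d _ _ ip0 jp)).
by rewrite transition_ccoord.
Qed.

Let near_target i j s t : cdom i (sigma s) -> cdom j (Psi t (sigma s)) ->
  \forall p \near ((s, t) : R^o * R^o), cdom i (sigma p.1) /\ cdom j (Psi p.2 (sigma p.1)).
Proof.
move=> is_ jst; have d := path_flow_dom is_ jst.
have n1 : \forall p \near ((s, t) : R^o * R^o), cdom i (sigma p.1).
  have cf : {for (s, t), continuous (fst : R^o * R^o -> R)}.
    by apply: differentiable_continuous; exact: differentiable_fst.
  exact: (cf _ (near_path_dom ssigma is_)).
have n2 : \forall p \near ((s, t) : R^o * R^o), flow_dom Psi i j (p.2, xc i p.1).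
  by apply: (continuous_path_pair ssigma is_); exact: (open_near (@open_flow_dom _ _ _ Psi i j) d).
apply: filterS2 n1 n2 => p ip [_ jp]; split=> //.
by move: jp; rewrite /= /path_coord ccoordK.
Qed.

Let near_target1 i j s t : cdom i (sigma s) -> cdom j (Psi t (sigma s)) ->
  \forall r \near s, cdom i (sigma r) /\ cdom j (Psi t (sigma r)).
Proof.
move=> is_ jst.
have c0 : {for s, continuous (fun h : R => (h, t) : R^o * R^o)}.
  by apply: differentiable_continuous; apply: differentiable_pair.
exact: (c0 _ (near_target is_ jst)).
Qed.

Let near_target2 j s t : cdom j (Psi t (sigma s)) ->
  \forall r \near t, cdom j (Psi r (sigma s)).
Proof.
move=> jst; have is_ := chart_at_dom (sigma s).
by apply: filterS (near_flow_dom (path_flow_dom is_ jst)) => r [_]; rewrite /= /path_coord ccoordK.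
Qed.

Let g (s t : R) := time_trace (sigma s) t.
Let G (s t : R) := 'D_1 (g^~ t) s.

Let derive_g i j s t : cdom i (sigma s) -> cdom j (Psi t (sigma s)) ->
  is_derive s 1 (g^~ t) ('D_(space_dir (vel i s)) (th i j time) (t, xc i s)).
Proof.
move=> is_ jst; have d := path_flow_dom is_ jst.
have [dF DF] := derive_path_const ssigma is_ (dth time d).
apply: (@near_eq_is_derive _ _ _ (fun r : R => th i j time (t, xc i r))).
  by apply: filterS (near_target1 is_ jst) => r [ir jr]; rewrite /g (time_traceE ir jr).
by apply: DeriveDef; first exact/derivable1_diffP.
Qed.

Let GE i j s t : cdom i (sigma s) -> cdom j (Psi t (sigma s)) ->
  G s t = 'D_(space_dir (vel i s)) (th i j time) (t, xc i s).
Proof. by move=> is_ jst; have [_] := derive_g is_ jst. Qed.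

Let dg (s t : R) : is_derive s 1 (g^~ t) (G s t).
Proof.
apply: DeriveDef => //.
by have [] := derive_g (chart_at_dom (sigma s)) (chart_at_dom (Psi t (sigma s))).
Qed.

Let cg s : continuous (g s).
Proof.
move=> t; pose i := chart_at (sigma s); pose j := chart_at (Psi t (sigma s)).
have is_ : cdom i (sigma s) by exact: chart_at_dom.
have jst : cdom j (Psi t (sigma s)) by exact: chart_at_dom.
have H := is_derive_time (dth time (path_flow_dom is_ jst)).
have E0 : \forall r \near t, th i j time (r, xc i s) = g s r.
  by apply: filterS (near_target2 jst) => r jr; rewrite /g (time_traceE is_ jr).
exact: (is_derive_continuous (near_eq_is_derive E0 H)).
Qed.

Let cG : continuous (fun p : R^o * R^o => G p.1 p.2).
Proof.
move=> [s t]; pose i := chart_at (sigma s); pose j := chart_at (Psi t (sigma s)).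
have is_ : cdom i (sigma s) by exact: chart_at_dom.
have jst : cdom j (Psi t (sigma s)) by exact: chart_at_dom.
have d := path_flow_dom is_ jst.
(* Even in fixed charts the direction of differentiation moves with [p.1]; splitting it over the
   basis leaves derivatives in fixed directions, which are continuous. *)
pose F (p : R^o * R^o) := \sum_k vel i p.1 0 k * 'D_(space_dir (e_ k)) (th i j time) (p.2, xc i p.1).
have FE : \forall p \near ((s, t) : R^o * R^o), F p = G p.1 p.2.
  apply: filterS (near_target is_ jst) => p [ip jp]; have dp := path_flow_dom ip jp.
  rewrite (GE ip jp) /F.
  have L : linear (fun v => 'D_(space_dir v) (th i j time) (p.2, xc i p.1)).
    by move=> a u v; rewrite linear_space_dir derive_linear//; exact: dth.
  by rewrite [RHS](lin_sum L).
have cF : {for (s, t), continuous F}.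
  apply: continuous_for_sum => k; apply: continuousM.
    have cv : {for s, continuous (fun r => vel i r 0 k)}.
      have oP : open (sigma @^-1` cdom i) := @open_path_dom _ _ _ _ ssigma i.
      have := (Ck_on_mxP 0 oP (vel i)).1.
      move=> /(_ ((smooth_path_coord ssigma i 1%N).2 1) 0 k); exact.
    by apply: (@continuous_comp _ _ _ (fst : R^o * R^o -> R) (fun r => vel i r 0 k)); [apply: differentiable_continuous; exact: differentiable_fst|].
  apply: (@continuous_comp _ _ _ (fun p : R^o * R^o => (p.2, xc i p.1) : V)
    ('D_(space_dir (e_ k)) (th i j time))); first exact: continuous_path_pair.
  exact: (sth i j time 1%N).2.
rewrite /prop_for /continuous_at -(nbhs_singleton FE).
exact: cvg_trans (near_eq_cvg FE) cF.
Qed.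

Let shift_time (tx : V) : tx + (T, 0) = (tx.1 + T, tx.2).
Proof. by congr pair; rewrite /= addr0. Qed.

Let flow_coord_periodic i j tx : y i j (tx + (T, 0)) = y i j tx.
Proof. by rewrite shift_time /flow_coord /= Psi_periodic. Qed.

Let theta_periodic i j w tx : th i j w (tx + (T, 0)) = th i j w tx.
Proof.
have LP z : flow_jacobian Psi i j (z + (T, 0)) = flow_jacobian Psi i j z.
  by apply/row_matrixP => k; rewrite !rowK; apply: derive_periodic; exact: flow_coord_periodic.
have JP (z : V) : J i (z + (T, 0)).2 = J i z.2 by rewrite shift_time.
have FP z : flow_frame Psi J i j (z + (T, 0)) = flow_frame Psi J i j z.
  by rewrite /flow_frame LP JP flow_coord_periodic.
rewrite /theta /frame_trace /frame_connection JP FP flow_coord_periodic.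
by rewrite (derive_periodic _ _ FP) (derive_periodic _ _ (flow_coord_periodic i j)).
Qed.

Definition chern_path (s t : R) : R :=
  let j := chart_at (Psi t (sigma s)) in let p := ccoord j (Psi t (sigma s)) in
  chern_form J A j p ('D_1 (fun r : R => ccoord j (Psi t (sigma r))) s) (X j p).

(** By [theta_chern] the integrand is, up to the factor [4 * pi], the path derivative of the
    dt-component minus the time derivative of a space component. The latter is periodic in time and
    integrates to 0. *)
Let chern_integral s :
  \int[mu]_(t in `[0, T]) chern_path s t = (4 * pi)^-1 * \int[mu]_(t in `[0, T]) G s t.
Proof.
pose i := chart_at (sigma s); have is_ : cdom i (sigma s) by exact: chart_at_dom.
pose v := space_dir (vel i s).
(* Source chart and velocity stay frozen, which makes [eta] periodic; only the target chart follows
   the orbit, harmlessly by [theta_target]. *)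
pose eta t := th i (chart_at (Psi t (sigma s))) v (t, xc i s).
have etaE j t : cdom j (Psi t (sigma s)) -> eta t = th i j v (t, xc i s).
  move=> jst; apply: (theta_target w2 closed_omega closed_alpha acs conn).
    by apply: path_flow_dom => //; exact: chart_at_dom.
  exact: path_flow_dom.
have deta j (t : R) : cdom j (Psi t (sigma s)) ->
    is_derive t 1 eta ('D_time (th i j v) (t, xc i s)).
  move=> jst; have H := is_derive_time (dth v (path_flow_dom is_ jst)).
  apply: (near_eq_is_derive _ H).
  by apply: filterS (near_target2 jst) => r jr; rewrite (etaE j).
pose D t := 'D_1 eta t.
have DE j t : cdom j (Psi t (sigma s)) -> D t = 'D_time (th i j v) (t, xc i s).
  by move=> jst; have [_] := deta j t jst.
have dD (t : R) : is_derive t 1 eta (D t).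
  by apply: DeriveDef => //; have [] := deta _ t (chart_at_dom (Psi t (sigma s))).
have cD : continuous D.
  move=> t; pose j := chart_at (Psi t (sigma s)).
  have jst : cdom j (Psi t (sigma s)) by exact: chart_at_dom.
  have d := path_flow_dom is_ jst.
  have dth' : differentiable ('D_time (th i j v)) (t, xc i s) := ((sth i j v 2%N).2 time).1 _ d.
  have H := is_derive_time dth'.
  have E0 : \forall r \near t, 'D_time (th i j v) (r, xc i s) = D r.
    by apply: filterS (near_target2 jst) => r jr; rewrite (DE j).
  exact: (is_derive_continuous (near_eq_is_derive E0 H)).
have ID : \int[mu]_(t in `[0, T]) D t = 0.
  rewrite (Rintegral_derive T0 cD dD) /eta.
  have -> : Psi T (sigma s) = Psi 0 (sigma s) by rewrite -[T in LHS]add0r Psi_periodic.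
  have -> : (T, xc i s) = ((0, xc i s) : V) + (T, 0) by rewrite shift_time /= add0r.
  by rewrite theta_periodic subrr.
have p0 : (4 * pi : R) != 0 by rewrite mulf_neq0// gt_eqF// pi_gt0.
have CE t : chern_path s t = (4 * pi)^-1 * (G s t - D t).
  pose j := chart_at (Psi t (sigma s)).
  have jst : cdom j (Psi t (sigma s)) by exact: chart_at_dom.
  have d := path_flow_dom is_ jst.
  rewrite /chern_path -/j (velocity_flow ssigma is_ jst) -(path_flow_coord Psi j t is_).
  rewrite (GE is_ jst) (DE j t jst).
  by rewrite (theta_chern w2 closed_omega closed_alpha acs conn (vel i s) d) mulrA mulVf// mul1r.
have cGs : continuous (G s).
  move=> t; apply: (@continuous_comp _ _ _ (fun t : R => (s, t) : R^o * R^o) (fun p => G p.1 p.2)).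
    by apply: differentiable_continuous; apply: differentiable_pair.
  exact: cG.
have iG := continuous_integrable 0 T cGs; have iD := continuous_integrable 0 T cD.
transitivity (\int[mu]_(t in `[0, T]) ((4 * pi)^-1 * (G s t - D t))).
  by apply: eq_Rintegral => t _; exact: CE.
rewrite RintegralZl//; last first.
  apply: (@continuous_integrable _ (fun t => G s t - D t)) => t.
  by apply: continuousB; [exact: cGs|exact: cD].
have IB := fun m => RintegralB m iG iD.
apply: (congr1 ( *%R (4 * pi)^-1)).
apply: (etrans (IB (measurable_itv _))).
apply: (etrans (congr1 (fun z => _ - z) ID)); exact: subr0.
Qed.

Lemma chern_path_integral (a b : R) : a < b -> sigma a = sigma b ->
  \int[mu]_(s in `[a, b]) \int[mu]_(t in `[0, T]) chern_path s t = 0.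
Proof.
move=> ab sab.
transitivity (\int[mu]_(s in `[a, b]) ((4 * pi)^-1 * \int[mu]_(t in `[0, T]) G s t)).
  by apply: eq_Rintegral => s _; exact: chern_integral.
rewrite RintegralZl//; last first.
  by apply: continuous_integrable; exact: (continuous_integral T0 cG).
rewrite (double_integral_derive T0 dg cg cG ab).
by rewrite /g sab subrr mulr0.
Qed.

End ChernIntegral.

(** * Primitives of one-forms along paths *)

Section SmoothInto.
Variables (R : realType) (n : nat) (M : manifold R n).
Local Notation I := (atlas_index M).
Local Notation E := 'rV[R]_n.
Implicit Types (i j : I).

Lemma smooth_into_local (V : normedModType R) (U : set V) (f : V -> M) :
  (forall x, U x -> exists B g, [/\ open B, B x, smooth_into B g & {in B, f =1 g}]) ->
  smooth_into U f.
Proof.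
move=> H; split=> [x /H[B [g [oB Bx [cg _] fg]]]|i k].
  have gf : \forall z \near x, g z = f z.
    by apply: (open_near oB Bx) => z Bz; rewrite fg// inE.
  rewrite /prop_for /continuous_at -(nbhs_singleton gf).
  exact: cvg_trans (near_eq_cvg gf) (cg x Bx).
apply: Ck_on_local => x [/H[B [g [oB Bx [cg sg] fg]]] ix].
have Bfg z : B z -> f z = g z by move=> Bz; rewrite fg// inE.
exists (B `&` g @^-1` cdom i), (ccoord i \o g); split.
- by apply: open_setI_preimage => //; exact: open_cdom.
- by split=> //=; rewrite -Bfg.
- exact: sg.
- by move=> z; rewrite inE => -[Bz _] /=; rewrite Bfg.
Qed.

Lemma smooth_into_sub (V : normedModType R) (U U' : set V) (f : V -> M) :
  U' `<=` U -> smooth_into U f -> smooth_into U' f.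
Proof.
move=> UU [cf sf]; split=> [x /UU|i k]; first exact: cf.
by apply: Ck_on_sub (sf i k) => x [/UU].
Qed.

Lemma smooth_into_cst (V : normedModType R) (U : set V) (p : M) : smooth_into U (fun _ : V => p).
Proof.
split=> [x _|i k]; first exact: cst_continuous.
exact: (Ck_on_cst k _ (ccoord i p)).
Qed.

Lemma smooth_into_comp (V W : normedModType R) (U : set V) (U' : set W) (f : V -> M) (g : W -> V) :
  findim V -> open U -> open U' -> (forall z, U' z -> U (g z)) -> smooth_on U' g ->
  smooth_into U f -> smooth_into U' (f \o g).
Proof.
move=> fV oU oU' UU sg [cf sf].
have cg z : U' z -> {for z, continuous g} by move=> Uz; exact: (sg 0%N z Uz).
split=> [z Uz|i k].
  by apply: continuous_comp; [exact: cg|apply: cf; exact: UU].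
have oA : open (U' `&` (f \o g) @^-1` cdom i).
  apply: open_setI_preimage => // [z Uz|]; last exact: open_cdom.
  by apply: continuous_comp; [exact: cg|apply: cf; exact: UU].
have oB : open (U `&` f @^-1` cdom i) by apply: open_setI_preimage => //; exact: open_cdom.
apply: (Ck_on_comp fV (findim_mx R 1 n) oA oB (g := ccoord i \o f) _ _ (sf i k)).
  by move=> z [Uz iz]; split=> //; exact: UU.
by apply: Ck_on_sub (sg k) => z [].
Qed.

Lemma smooth_into_param (V : normedModType R) (U : set V) i (f : V -> E) : open U ->
  (forall z, U z -> ccod i (f z)) -> smooth_on U f -> smooth_into U (cparam i \o f).
Proof.
move=> oU Uf sf; have cf z : U z -> {for z, continuous f} by move=> Uz; exact: (sf 0%N z Uz).
have c z : U z -> {for z, continuous (cparam i \o f)}.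
  by move=> Uz; apply: continuous_comp; [exact: cf|apply: param_continuous; exact: Uf].
split=> // j k.
have oA : open (U `&` (cparam i \o f) @^-1` cdom j).
  by apply: open_setI_preimage => //; exact: open_cdom.
apply: (Ck_on_comp (findim_mx R 1 n) (findim_mx R 1 n) oA (@open_overlap _ _ M i j)
  (g := transition i j) _ _ (smooth_transition i j k)).
  by move=> z [Uz jz]; split=> //; exact: Uf.
by apply: Ck_on_sub (sf k) => z [].
Qed.

End SmoothInto.

Section Primitive.
Variables (R : realType) (n : nat) (M : manifold R n).
Local Notation I := (atlas_index M).
Local Notation E := 'rV[R]_n.
Implicit Types (i j : I) (sigma : R -> M) (h : R -> R) (p q : M).
Variable alpha : tensor1 M.
Hypothesis alphaL : forall i x, ccod i x -> linear (alpha i x : E -> R).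
Hypothesis alphaT : forall i j x v, overlap i j x ->
  alpha i x v = alpha j (transition i j x) ('D_v (transition i j) x).
Hypothesis alphaS : forall i v, smooth_on (@ccod R n M i) (fun x => alpha i x v).

Definition path_speed sigma i (t : R) : R :=
  alpha i (path_coord sigma i t) (velocity sigma i t).

(** Line integrals are recorded as increments of a primitive [h], since the integrand has only local
    expressions that change with the chart. *)
Definition path_primitive sigma h :=
  forall (t : R) i, cdom i (sigma t) -> is_derive t 1 h (path_speed sigma i t).

Lemma path_speed_chart sigma i j t : smooth_into setT sigma ->
  cdom i (sigma t) -> cdom j (sigma t) -> path_speed sigma i t = path_speed sigma j t.
Proof.
move=> ss it jt; rewrite /path_speed (velocity_transition ss it jt).
by rewrite (alphaT _ (overlap_ccoord it jt)) /path_coord transition_ccoord.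
Qed.

Lemma path_primitive_chart sigma h : smooth_into setT sigma ->
  (forall t : R, exists2 i, cdom i (sigma t) & is_derive t 1 h (path_speed sigma i t)) ->
  path_primitive sigma h.
Proof.
move=> ss H t j jt; have [i it dh] := H t.
by rewrite -(path_speed_chart ss it jt).
Qed.

Lemma near_path_speed sigma sigma' i (t : R) :
  (\forall s \near t, sigma s = sigma' s) -> path_speed sigma i t = path_speed sigma' i t.
Proof.
move=> H; rewrite /path_speed /velocity /path_coord (nbhs_singleton H).
by congr (alpha _ _ _); apply: near_eq_derive; apply: filterS H => s ->.
Qed.

(** The constant [c] lets primitives with different normalisations be glued. *)
Lemma path_primitive_local sigma h :
  (forall t : R, exists sigma' h' c, [/\ smooth_into setT sigma', path_primitive sigma' h' &
    \forall s \near t, sigma s = sigma' s /\ h s = h' s + c]) ->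
  smooth_into setT sigma /\ path_primitive sigma h.
Proof.
move=> H; split.
  apply: smooth_into_local => t _; have [s' [h' [c [ss' _ nt]]]] := H t.
  exists [set s | sigma s = s' s /\ h s = h' s + c]^°, s'; split=> //.
  - exact: open_interior.
  - exact: smooth_into_sub ss'.
  - by move=> z; rewrite inE => /interior_subset[].
move=> t i it; have [s' [h' [c [ss' ph' nt]]]] := H t.
have n1 : \forall s \near t, sigma s = s' s by apply: filterS nt => s [].
have n2 : \forall s \near t, (h' + cst c) s = h s by apply: filterS nt => s [].
rewrite (near_path_speed i n1); apply: (near_eq_is_derive n2).
rewrite -[X in is_derive _ _ _ X]addr0; apply: is_deriveD.
by apply: ph'; rewrite -(nbhs_singleton n1).
Qed.

(** Any smooth [theta] is allowed, monotone or not: reversal, the affine changes of concatenation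
    and the height [cos s + 1 / 2] on a meridian are all instances. *)
Lemma path_primitive_reparam sigma h (theta : R -> R) : smooth_into setT sigma ->
  path_primitive sigma h -> smooth_on setT theta ->
  smooth_into setT (sigma \o theta) /\ path_primitive (sigma \o theta) (h \o theta).
Proof.
move=> ss ph st; split.
  by apply: smooth_into_comp ss => //; [exact: findim_R|exact: openT|exact: openT].
move=> t i it.
have dt : differentiable theta t := (st 1%N).1 t Logic.I.
have D : is_derive t 1 theta ('D_1 theta t).
  by apply: DeriveDef => //; apply/derivable1_diffP.
have := @is_derive1_comp _ h theta t _ _ (ph (theta t) i it) D.
congr is_derive; rewrite /path_speed.
have -> : velocity (sigma \o theta) i t = 'D_1 theta t *: velocity sigma i (theta t).
  have H := @derive_comp _ _ _ _ theta (path_coord sigma i) t 1 dt (diff_path_coord ss it).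
  apply: (etrans H).
  have := @derive_linear _ _ _ (path_coord sigma i) (theta t) ('D_1 theta t) 1 0 (diff_path_coord ss it).
  rewrite derive0 !addr0 => <-; congr (derive _ _ _); exact/esym/mulr1.
have L := alphaL (ccoord_cod it) ('D_1 theta t) (velocity sigma i (theta t)) 0.
have Z : alpha i (path_coord sigma i (theta t)) 0 = 0.
  by have := alphaL (ccoord_cod it) (-1) 0 0; rewrite scaler0 addr0 scaleN1r addNr.
by rewrite /path_coord /= in Z *; rewrite Z !addr0 in L; rewrite L mulrC.
Qed.

Lemma path_speed_continuous sigma h (D : R -> R) : smooth_into setT sigma -> path_primitive sigma h ->
  (forall t : R, is_derive t 1 h (D t)) -> continuous D.
Proof.
move=> ss ph dD t; pose i := chart_at (sigma t).
have it : cdom i (sigma t) by exact: chart_at_dom.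
have oP : open (sigma @^-1` cdom i) := @open_path_dom _ _ _ _ ss i.
have c1 : Ck_on 0 (sigma @^-1` cdom i) (path_speed sigma i).
  apply: (@Ck_on_lin2 _ _ _ (@ccod R n M i) (alpha i)) => //.
  - by move=> z; exact: alphaL.
  - exact: open_ccod.
  - by move=> s; exact: ccoord_cod.
  - by move=> v; exact: alphaS.
  - exact: (smooth_path_coord ss i 0).
  - exact: (smooth_path_coord ss i 1%N).2.
have E0 : \forall s \near t, path_speed sigma i s = D s.
  apply: filterS (near_path_dom ss it) => s js.
  by have [_ <-] := ph s i js; have [_ <-] := dD s.
rewrite /prop_for /continuous_at -(nbhs_singleton E0).
exact: cvg_trans (near_eq_cvg E0) (c1 t it).
Qed.

(** Paths are defined on the whole line and rest outside [[0, 1]], so that they can be concatenated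
    smoothly and, when closed, swept into a smooth sphere. *)
Definition flat_path p q sigma h :=
  [/\ smooth_into setT sigma, path_primitive sigma h,
      forall t, t <= 0 -> sigma t = p /\ h t = h 0 &
      forall t, 1 <= t -> sigma t = q /\ h t = h 1].

Definition path_value p q (a : R) := exists sigma h, flat_path p q sigma h /\ a = h 1 - h 0.

Lemma path_value_cst p : path_value p p 0.
Proof.
exists (fun=> p), (fun=> 0); split; last by rewrite subrr.
split=> //; first exact: smooth_into_cst.
move=> t i it; have -> : path_speed (fun=> p) i t = 0; last exact: is_derive_cst.
rewrite /path_speed /velocity.
have -> : 'D_1 (path_coord (fun=> p) i) t = 0 by exact: derive_cst.
by have := alphaL (ccoord_cod it) (-1) 0 0; rewrite scaler0 addr0 scaleN1r addNr.
Qed.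

Let Ck_affine k (a b : R) : Ck_on k setT (fun t : R => a * t + b).
Proof.
by apply: Ck_onD; [exact: openT|apply: Ck_onM; [exact: openT|exact: Ck_on_cst|exact: Ck_on_id]|exact: Ck_on_cst].
Qed.

Lemma path_value_rev p q a : path_value p q a -> path_value q p (- a).
Proof.
move=> [s [h [[ss ph f0 f1] ->]]].
have [ss' ph'] := path_primitive_reparam ss ph (fun k => Ck_affine k (-1) 1).
exists (s \o (fun t => -1 * t + 1)), (h \o (fun t => -1 * t + 1)); split; last first.
  by rewrite /= mulr1 addNr mulr0 add0r opprB.
split=> // t t0 /=; rewrite ?mulr0 ?add0r ?mulr1 ?addNr.
  by apply: f1; lra.
by apply: f0; lra.
Qed.

Lemma path_value_concat p q r a b : path_value p q a -> path_value q r b -> path_value p r (a + b).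
Proof.
move=> [s1 [h1 [[ss1 ph1 f10 f11] ->]]] [s2 [h2 [[ss2 ph2 f20 f21] ->]]].
have [ss1' ph1'] := path_primitive_reparam ss1 ph1 (fun k => Ck_affine k 3 0).
have [ss2' ph2'] := path_primitive_reparam ss2 ph2 (fun k => Ck_affine k 3 (-2)).
(* At triple speed the first path rests from time [1 / 3] on and the second one until [2 / 3]; both
   are at [q] around the seam at [1 / 2]. The shift in [h] below makes the primitives agree
   there. *)
pose s t := if 3 * t <= 3 / 2 then s1 (3 * t + 0) else s2 (3 * t - 2).
pose h t := if 3 * t <= 3 / 2 then h1 (3 * t + 0) else h2 (3 * t - 2) + (h1 1 - h2 0).
have [ss ph] : smooth_into setT s /\ path_primitive s h.
  apply: path_primitive_local => t; have [t23|t13] := ltP t (1 / 2).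
    exists (s1 \o (fun t => 3 * t + 0)), (h1 \o (fun t => 3 * t + 0)), 0; split=> //.
    near=> z; rewrite /s /h /= !addr0; case: ifP => [//|/negbT]; rewrite -ltNge => z2.
    exfalso; suff : z < 1 / 2 by lra.
    by near: z; exact: lt_nbhsl.
  exists (s2 \o (fun t => 3 * t - 2)), (h2 \o (fun t => 3 * t - 2)), (h1 1 - h2 0); split=> //.
  near=> z; rewrite /s /h /=; case: ifP => // z2.
  have z1 : 1 / 3 < z by near: z; apply: lt_nbhsr; lra.
  rewrite addr0.
  have [-> ->] := f11 (3 * z) ltac:(lra); have [-> ->] := f20 (3 * z - 2) ltac:(lra).
  by split=> //; rewrite addrC subrK.
have c0 : (3 * 0 <= 3 / 2 :> R) = true by lra.
have c1 (t : R) : 1 <= t -> (3 * t <= 3 / 2) = false.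
  by move=> t1; apply/negbTE; rewrite -ltNge; lra.
have E1 : 3 * 1 - 2 = 1 :> R by ring.
exists s, h; split; last first.
  by rewrite /h c0 (c1 1 (lexx _)) E1 mulr0 addr0; ring.
split=> // t t0; rewrite /s /h.
  have -> : (3 * t <= 3 / 2) = true by lra.
  rewrite c0 mulr0 !addr0; have [-> ->] := f10 (3 * t) ltac:(lra); split=> //.
rewrite (c1 1 (lexx _)) (c1 t t0) E1.
by have [-> ->] := f21 (3 * t - 2) ltac:(lra).
Unshelve. all: by end_near. Qed.

End Primitive.

(** * From vanishing loop values to a global potential *)

Section Potential.
Variables (R : realType) (n : nat) (M : manifold R n).
Local Notation I := (atlas_index M).
Local Notation E := 'rV[R]_n.
Local Notation e_ k := (delta_mx (0 : 'I_1) (k : 'I_n) : E).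
Implicit Types (i j : I) (p q : M).
Variable alpha : tensor1 M.
Hypothesis alphaL : forall i x, ccod i x -> linear (alpha i x : E -> R).
Hypothesis alphaT : forall i j x v, overlap i j x ->
  alpha i x v = alpha j (transition i j x) ('D_v (transition i j) x).
Hypothesis alphaS : forall i v, smooth_on (@ccod R n M i) (fun x => alpha i x v).

Let alpha_scale i x (a : R) v : ccod i x -> alpha i x (a *: v) = a * alpha i x v.
Proof.
move=> ix; have Z : alpha i x 0 = 0.
  by have := alphaL ix (-1) 0 0; rewrite scaler0 addr0 scaleN1r addNr.
by have := alphaL ix a v 0; rewrite Z !addr0.
Qed.

(** [G] is a primitive in the affine parameter, kept for mean value arguments; the path itself is
    slowed down by [smooth_step]. *)
Lemma straight_path i (x w : E) : (forall s : R, 0 <= s <= 1 -> ccod i (x + s *: w)) ->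
  exists G : R -> R, (forall s : R, 0 <= s <= 1 -> is_derive s 1 G (alpha i (x + s *: w) w)) /\
    path_value alpha (cparam i x) (cparam i (x + w)) (G 1 - G 0).
Proof.
(* The segment is known to lie in the chart for parameters in [[0, 1]] only; clamping the parameter
   makes the integrand continuous on the whole line. *)
move=> H; pose c (s : R) := Num.min (Num.max s 0) 1.
have cI s : 0 <= c s <= 1.
  apply/andP; split; first by rewrite le_min le_max lexx ler01 orbT.
  by rewrite ge_min lexx orbT.
have cc : continuous c.
  move=> s; apply: (@continuous_min _ _ (fun s : R => Num.max s 0) (cst 1)); last exact: cvg_cst.
  by apply: (@continuous_max _ _ (fun s : R => s) (cst 0)); [exact: cvg_id|exact: cvg_cst].
have cE s : 0 <= s <= 1 -> c s = s.
  by move=> /andP[s0 s1]; rewrite /c (max_idPl s0) (min_idPl s1).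
have cf : continuous (fun s => alpha i (x + c s *: w) w).
  move=> s; apply: (@continuous_comp _ _ _ (fun s => x + c s *: w) (fun z => alpha i z w)).
    apply: (@continuous_comp _ _ _ c (fun s : R => x + s *: w)); first exact: cc.
    by apply: differentiable_continuous; exact: differentiable_line.
  by apply: (alphaS i w 0%N); apply: H; exact: cI.
(* Starting at [-1] puts 0 in the interior, so that the derivative there is two-sided. *)
have [G dG] := antiderivative (-1) cf.
have {}dG (s : R) : 0 <= s <= 1 -> is_derive s 1 G (alpha i (x + s *: w) w).
  move=> sI; rewrite -[in alpha _ _](cE s sI); apply: dG.
  by move: sI => /andP[s0 _]; lra.
exists G; split=> //.
pose phi := @smooth_step R.
have phiI t : 0 <= phi t <= 1 by rewrite smooth_step_ge0 smooth_step_le1.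
pose l (t : R) := x + phi t *: w.
pose s t := cparam i (l t).
have il t : ccod i (l t) by exact: H.
have sl : smooth_on setT l.
  move=> k; apply: Ck_onD; [exact: openT|exact: Ck_on_cst|].
  by apply: Ck_onZl; [exact: openT|exact: Ck_on_smooth_step].
have ss : smooth_into setT s by apply: smooth_into_param => //; exact: openT.
exists s, (G \o phi); split; last by rewrite /= /phi (smooth_step0 (lexx 0)) (smooth_step1 (lexx 1)).
split=> //.
- apply: path_primitive_chart => // t; exists i; first exact: cparam_dom.
  have dphi : differentiable phi t := (Ck_on_smooth_step R 1%N).1 t Logic.I.
  have D : is_derive t 1 phi ('D_1 phi t).
    by apply: DeriveDef => //; exact/derivable1_diffP.
  have := @is_derive1_comp _ G phi t _ _ (dG (phi t) (phiI t)) D; congr is_derive.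
  rewrite /path_speed.
  have pE : path_coord s i = l by apply/funext => r; exact: cparamK.
  have -> : velocity s i t = 'D_1 phi t *: w.
    rewrite /velocity pE.
    have H1 := @derive_comp _ _ _ _ phi (fun s : R => x + s *: w) t 1 dphi (differentiable_line x w _).
    by apply: (etrans H1); exact: derive_line.
  by rewrite pE alpha_scale// mulrC.
- move=> t t0; rewrite /s /l /= /phi (smooth_step0 t0) (smooth_step0 (lexx 0)).
  by rewrite scale0r addr0.
- move=> t t1; rewrite /s /l /= /phi (smooth_step1 t1) (smooth_step1 (lexx 1)).
  by rewrite scale1r.
Qed.

Lemma near_path_value p : \forall q \near p, exists a, path_value alpha p q a.
Proof.
pose i := chart_at p; have ip : cdom i p by exact: chart_at_dom.
pose z := ccoord i p; have iz : ccod i z by exact: ccoord_cod.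
have : \forall y \near z, ccod i y by exact: (open_near (@open_ccod _ _ M i) iz).
move=> /nbhs_ballP[r /= r0 Br].
have n1 : \forall q \near p, cdom i q by exact: (open_near (@open_cdom _ _ M i) ip).
have n2 : \forall q \near p, ball z r (ccoord i q).
  have cp : {for p, continuous (ccoord i)}  by apply: Defs.coord_continuous.
  exact: (cp _ (nbhsx_ballx z r r0)).
apply: filterS2 n1 n2 => q iq Bq.
have [|G [_ P]] := @straight_path i z (ccoord i q - z).
  move=> s /andP[s0 s1]; apply: Br; move: Bq; rewrite -!ball_normE /ball_ /= => Bq.
  rewrite opprD addNKr normrN normrZ ger0_norm// distrC.
  by apply: le_lt_trans Bq; rewrite -[leRHS]mul1r ler_wpM2r.
by exists (G 1 - G 0); move: P; rewrite addrC subrK /z !ccoordK.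
Qed.

(** Every point is joined to all points near it, and paths can be concatenated and reversed; so the
    set of points reachable from [p] and its complement are both open. *)
Lemma path_value_connected p : connected [set: M] -> forall q, exists a, path_value alpha p q a.
Proof.
move=> cM q; pose S := [set q | exists a, path_value alpha p q a].
suff : S = setT by move=> /seteqP[_ /(_ q Logic.I)].
apply: cM.
- by exists p; exists 0; exact: path_value_cst.
- exists S; last by rewrite setTI.
  rewrite openE => x [a pa]; apply: filterS (near_path_value x) => y [b pb].
  by exists (a + b); exact: path_value_concat pa pb.
- exists S; last by rewrite setTI.
  rewrite -openC openE => x Sx; apply: filterS (near_path_value x) => y [b pb] [a pa]; apply: Sx.
  by exists (a - b); apply: path_value_concat pa _ => //; exact: path_value_rev.
Qed.

(** The potential at [q] is the value of any path from [p] to [q]. Its increment over a segment in a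
    chart is [alpha] at an intermediate point, and continuity of the coefficients turns this into a
    differential. *)
Lemma potential_exact p : connected [set: M] -> (forall a, path_value alpha p p a -> a = 0) ->
  exact1 alpha.
Proof.
move=> cM loop0; have [H PH] := choice (path_value_connected p cM).
have uniq q a : path_value alpha p q a -> a = H q.
  move=> pa; apply/eqP; rewrite -subr_eq0; apply/eqP; apply: loop0.
  by apply: path_value_concat pa _ => //; apply: path_value_rev.
have mean i z w : (forall s : R, 0 <= s <= 1 -> ccod i (z + s *: w)) ->
    exists2 s : R, 0 <= s <= 1 & H (cparam i (z + w)) - H (cparam i z) = alpha i (z + s *: w) w.
  move=> zw; have [G [dG PG]] := straight_path zw.
  have [s sI E1] := MVT_ge ler01 dG; exists s => //.
  have /uniq <- : path_value alpha p (cparam i (z + w)) (H (cparam i z) + (G 1 - G 0)).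
    by apply: path_value_concat (PH _) PG.
  by rewrite addrAC subrr add0r E1 subr0 mulr1.
have dH i z : ccod i z -> is_diff z (H \o cparam i) (alpha i z).
  move=> iz; apply: (@is_diff_eps _ _ _ _ _ (linear_of (alphaL iz))).
    by apply: findim_continuous; exact: findim_mx.
  (* Dividing by [n.+1] instead of [n] covers dimension 0; the surplus summand is dropped in the
     final estimate. *)
  move=> e e0; pose e' := e / n.+1%:R.
  have e'0 : 0 < e' by rewrite divr_gt0.
  have n2 : \forall y \near z, forall k, `|alpha i z (e_ k) - alpha i y (e_ k)| < e'.
    apply: (@filter_forall E 'I_n (fun k y => `|alpha i z (e_ k) - alpha i y (e_ k)| < e') (nbhs z) _) => k.
    by have /cvgrPdist_lt := alphaS i (e_ k) 0%N z iz; exact.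
  have n1 : \forall y \near z, ccod i y /\ forall k, `|alpha i z (e_ k) - alpha i y (e_ k)| < e'.
    by apply: filterI n2; exact: (open_near (@open_ccod _ _ M i) iz).
  move: n1 => /nbhs_ballP[r /= r0 Br].
  have := nbhs0_lt (V := E) r0; apply: filterS => w wr.
  have Bw s : 0 <= s <= 1 -> ball z r (z + s *: w).
    move=> /andP[s0 s1]; rewrite -ball_normE /ball_ /= opprD addNKr normrN normrZ ger0_norm//.
    by apply: le_lt_trans wr; rewrite -[leRHS]mul1r ler_wpM2r.
  have [s sI E1] := @mean i z w (fun s sI => (Br _ (Bw s sI)).1).
  have [is_ Hk] := Br _ (Bw s sI).
  rewrite /= (addrC w) E1 (lin_sum (alphaL is_) w) [X in _ - X](lin_sum (alphaL iz) w) -sumrB.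
  apply: le_trans (ler_norm_sum _ _ _) _.
  have -> : e * `|w| = \sum_(k < n.+1) e' * `|w|.
    by rewrite sumr_const card_ord -mulrnAl /e' -mulr_natr divfK.
  rewrite big_ord_recr /=; apply: ler_wpDr; first by rewrite mulr_ge0// ltW.
  apply: ler_sum => k _; rewrite -scalerBr normrM mulrC; apply: ler_pM => //.
    by rewrite distrC ltW.
  rewrite [leRHS]/Num.Def.normr/= mx_normrE.
  exact: (@le_bigmax _ _ _ _ (fun ij : 'I_1 * 'I_n => `|w ij.1 ij.2|) (0, k)).
have dfH i z : ccod i z -> differentiable (H \o cparam i) z.
  by move=> iz; exact: (@ex_diff _ _ _ _ _ _ _ (dH i z iz)).
have DH i z v : ccod i z -> 'D_v (H \o cparam i) z = alpha i z v.
  by move=> iz; rewrite deriveE ?(@diff_val _ _ _ _ _ _ _ (dH i z iz))//; exact: dfH.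
exists H; last by move=> i z iz v; rewrite DH.
move=> i [|k]; first by move=> z iz; apply: differentiable_continuous; exact: dfH.
split=> [z|v]; first exact: dfH.
apply: (@Ck_on_eq _ _ _ _ _ _ (fun z => alpha i z v)); first exact: open_ccod.
  by move=> z; rewrite inE => iz; exact: DH.
exact: alphaS.
Qed.

End Potential.

(** * The sphere swept out by a loop through a fixed point *)

Lemma Ck_on_pair (R : realType) (V W Z : normedModType R) k (A : set V) (f : V -> W) (g : V -> Z) :
  open A -> Ck_on k A f -> Ck_on k A g -> Ck_on k A (fun x => (f x, g x)).
Proof.
move=> oA; elim: k f g => [|k IH] f g.
  by move=> cf cg x Ax; apply: cvg_pair; [exact: cf|exact: cg].
move=> [df cf] [dg cg]; split=> [x Ax|v].
  by apply: differentiable_pair; [exact: df|exact: dg].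
apply: (Ck_on_eq oA) (IH _ _ (cf v) (cg v)) => x; rewrite inE => Ax.
by apply: derive_pair; [exact: df|exact: dg].
Qed.

Section Sphere.
Variables (R : realType) (n : nat) (M : manifold R n) (Psi : smooth_flow M).
Local Notation Ix := (atlas_index M).
Local Notation E := 'rV[R]_n.
Local Notation V := (R^o * 'rV[R]_n)%type.
Local Notation X := (@generator R n M Psi).
Local Notation mu := (@lebesgue_measure R).
Implicit Types (i j : Ix).

Lemma smooth_into_flow (W : normedModType R) (U : set W) (theta : W -> R) (k : W -> M) :
  open U -> smooth_on U theta -> smooth_into U k -> smooth_into U (fun z => Psi (theta z) (k z)).
Proof.
move=> oU st [ck sk]; apply: smooth_into_local => z Uz.
pose i := chart_at (k z); have iz : cdom i (k z) by exact: chart_at_dom.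
have oB : open (U `&` k @^-1` cdom i) by apply: open_setI_preimage => //; exact: open_cdom.
pose m (z : W) : V := (theta z, ccoord i (k z)).
exists (U `&` k @^-1` cdom i), ((fun tx : V => Psi tx.1 (cparam i tx.2)) \o m); split=> //.
  have oD := @open_time_cod _ _ M i.
  apply: smooth_into_comp (flow_map_smooth Psi i) => //.
  - exact: findim_prod (findim_R R) (findim_mx R 1 n).
  - by move=> x [_ ix]; split=> //; exact: ccoord_cod.
  - move=> l; apply: Ck_on_pair => //; last exact: sk.
    by apply: Ck_on_sub (st l) => x [].
by move=> x; rewrite inE => -[_ ix] /=; rewrite ccoordK.
Qed.

Lemma derive_flow_orbit j q t : cdom j (Psi t q) ->
  'D_1 (fun r : R => ccoord j (Psi r q)) t = X j (ccoord j (Psi t q)).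
Proof.
move=> jt; pose i := chart_at q; have iq : cdom i q by exact: chart_at_dom.
have d : flow_dom Psi i j (t, ccoord i q) by split=> /=; [exact: ccoord_cod|rewrite ccoordK].
have yE r : flow_coord Psi i j (r, ccoord i q) = ccoord j (Psi r q).
  by rewrite /flow_coord /= ccoordK.
have [_ E1] := is_derive_time (diff_flow_coord d).
have E2 := derive_flow_time d; rewrite yE in E2; rewrite -E2 -E1.
by congr (derive _ t (1 : R)); apply/funext => r; rewrite yE.
Qed.

Hypothesis Psi_periodic : forall t q, Psi (t + 2 * pi) q = Psi t q.
Variable p : M.
Hypothesis fixed : forall t, Psi t p = p.
Variable gamma : R -> M.
Hypothesis sgamma : smooth_into setT gamma.
Hypothesis gamma0 : forall t, t <= 0 -> gamma t = p.
Hypothesis gamma1 : forall t, 1 <= t -> gamma t = p.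

Local Notation o0 := (@ord0 2).
Local Notation o1 := (@Ordinal 3 1 isT).
Local Notation o2 := (@Ordinal 3 2 isT).

(** An arbitrary, discontinuous choice; the periodicity of the flow hides its jumps. *)
Definition angle (a b : R) : R := xget 0 [set t | has_angle a b t].

(** Longitude is the time of the flow and height the parameter of the loop. The shift [1 / 2]
    centres [[0, 1]] on the equator, so that [gamma] rests at [p] when the height exceeds [1 / 2] in
    absolute value, and the value [p] on the axis fits there. *)
Definition loop_sphere (x : 'rV[R]_3) : M :=
  if 0 < x ord0 o0 ^+ 2 + x ord0 o1 ^+ 2
  then Psi (angle (x ord0 o0) (x ord0 o1)) (gamma (x ord0 o2 + 1 / 2)) else p.

Lemma loop_sphere_angle (x : 'rV[R]_3) t : has_angle (x ord0 o0) (x ord0 o1) t ->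
  loop_sphere x = Psi t (gamma (x ord0 o2 + 1 / 2)).
Proof.
move=> ht; have [r r0 [E1 E2]] := ht.
have x0 : 0 < x ord0 o0 ^+ 2 + x ord0 o1 ^+ 2.
  by rewrite (has_angle_norm r0 E1 E2) exprn_gt0.
rewrite /loop_sphere x0.
have hA : has_angle (x ord0 o0) (x ord0 o1) (angle (x ord0 o0) (x ord0 o1)).
  by apply: (@xgetPex _ 0 [set t | has_angle (x ord0 o0) (x ord0 o1) t]); exists t.
exact: (has_angle_periodic (fun t => Psi_periodic t (gamma (x ord0 o2 + 1 / 2))) hA ht).
Qed.

Lemma gamma_pole c : 1 / 2 < `|c| -> gamma (c + 1 / 2) = p.
Proof.
rewrite lter_normr => /orP[c0|c0]; first by apply: gamma1; lra.
by apply: gamma0; lra.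
Qed.

Lemma loop_sphere_pole (x : 'rV[R]_3) : 1 / 2 < `|x ord0 o2| -> loop_sphere x = p.
Proof. by move=> xc; rewrite /loop_sphere gamma_pole// fixed; case: ifP. Qed.

Let Ck_coord k (A : set 'rV[R]_3) l : Ck_on k A (fun x : 'rV[R]_3 => x ord0 l).
Proof.
have L : linear (fun x : 'rV[R]_3 => x ord0 l : R) by move=> a u v; rewrite !mxE.
apply: (@Ck_on_lin _ _ _ _ _ (linear_of L)).
exact: matrix_normedtype.coord_continuous.
Qed.

Let ccoord3 l : continuous (fun x : 'rV[R]_3 => x ord0 l : R).
Proof. exact: matrix_normedtype.coord_continuous. Qed.

Lemma open_pos (f : 'rV[R]_3 -> R) : continuous f -> open [set x | 0 < f x].
Proof.
move=> cf; have := @open_comp _ _ f [set y : R | 0 < y] (fun x _ => cf x) (@open_gt R 0).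
by [].
Qed.

Lemma smooth_loop_sphere : smooth_sphere loop_sphere.
Proof.
pose N (x : 'rV[R]_3) := x ord0 o0 * x ord0 o0 + x ord0 o1 * x ord0 o1.
have oT := @openT 'rV[R]_3.
have cN : continuous N.
  have H : Ck_on 0 setT N by apply: Ck_onD => //; apply: Ck_onM.
  by move=> x; exact: (H x Logic.I).
pose Q (x : 'rV[R]_3) := `|x ord0 o2| - 1 / 2.
have cQ : continuous Q.
  move=> x; apply: (@continuousB _ _ _ (fun x : 'rV[R]_3 => `|x ord0 o2|) (cst (1 / 2))); last exact: cst_continuous.
  by apply: (@continuous_comp _ _ _ (fun x : 'rV[R]_3 => x ord0 o2) (fun y : R => `|y|)); [exact: ccoord3|exact: norm_continuous].
(* The complement of the axis and the two regions of height beyond [1 / 2] cover the sphere: at the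
   other heights the sphere has [N] at least [3 / 4]. *)
exists ([set x | 0 < N x] `|` [set x | 0 < Q x]); split.
- by apply: openU; exact: open_pos.
- move=> x; rewrite /unit_sphere /= !big_ord_recl big_ord0 addr0 => H.
  have [xQ|xQ] := ltP 0 (Q x); [by right|left]; rewrite /N -!expr2.
  have E1 : lift ord0 ord0 = o1 :> 'I_3 by apply/val_inj.
  have E2 : lift ord0 (lift ord0 ord0) = o2 :> 'I_3 by apply/val_inj.
  rewrite E1 E2 in H; have c0 := normr_ge0 (x ord0 o2).
  have : `|x ord0 o2| ^+ 2 <= (1 / 2) ^+ 2.
    by rewrite ler_sqr ?nnegrE//; move: xQ; rewrite /Q; lra.
  rewrite real_normK ?num_real// => c2.
  have : x ord0 o0 ^+ 2 + x ord0 o1 ^+ 2 = 1 - x ord0 o2 ^+ 2 by rewrite -H; ring.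
  move=> ->; apply: lt_le_trans (lerB (lexx 1) c2); lra.
apply: smooth_into_local => x Ux.
have [xQ|xQ] := ltP 0 (Q x).
  exists [set x | 0 < Q x], (fun=> p); split=> //; first exact: open_pos.
  - exact: smooth_into_cst.
  - by move=> z; rewrite inE => zQ; apply: loop_sphere_pole; move: zQ; rewrite /Q /=; lra.
have {Ux}xN : 0 < x ord0 o0 ^+ 2 + x ord0 o1 ^+ 2.
  by case: Ux => /=; [rewrite /N -!expr2|rewrite ltNge xQ].
have [t0 ht0] := has_angle_ex xN.
(* Coordinates rotated by the angle [t0] of [x]; then [x] satisfies [0 < a x], and on that
   half-space [theta] is a smooth choice of angle. *)
pose a (z : 'rV[R]_3) := z ord0 o0 * cos t0 + z ord0 o1 * sin t0.
pose b (z : 'rV[R]_3) := z ord0 o1 * cos t0 - z ord0 o0 * sin t0.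
have Ca k : Ck_on k setT a.
  by apply: Ck_onD => //; apply: Ck_onM => //; exact: Ck_on_cst.
have Cb k : Ck_on k setT b.
  by apply: Ck_onB => //; apply: Ck_onM => //; exact: Ck_on_cst.
have oB : open [set z | 0 < a z] by apply: open_pos => z; exact: (Ca 0%N z Logic.I).
pose theta z := t0 + atan (b z / a z).
exists [set z | 0 < a z], (fun z => Psi (theta z) (gamma (z ord0 o2 + 1 / 2))); split=> //.
- have [r r0 [E1 E2]] := ht0.
  rewrite /= /a E1 E2 -!mulrA -mulrDr -!expr2 cos2Dsin2 mulr1//.
- apply: smooth_into_flow => //.
    move=> k; apply: Ck_onD => //; first exact: Ck_on_cst.
    have c1 : Ck_on k [set z | 0 < a z] (fun z => b z / a z).
      apply: Ck_onM => //; first by apply: Ck_on_sub (Cb k).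
      apply: Ck_onV => // [z /= az|]; first by rewrite gt_eqF.
      by apply: Ck_on_sub (Ca k).
    exact: (@Ck_on_compR _ _ _ k _ setT _ (@atan R) (findim_R R) oB (fun _ _ => Logic.I) c1 (Ck_on_atan R k)).
  apply: smooth_into_comp sgamma => //; [exact: findim_R|exact: openT|].
  by move=> k; apply: Ck_onD => //; exact: Ck_on_cst.
- by move=> z; rewrite inE => az; apply: loop_sphere_angle; exact: has_angle_atan.
Qed.

Let sigma (s : R) := gamma (cos s + 1 / 2).

Lemma smooth_sphere_meridian : smooth_into setT sigma.
Proof.
apply: (@smooth_into_comp _ _ _ _ _ setT setT gamma (fun s => cos s + 1 / 2)) => //.
- exact: findim_R.
- exact: openT.
- exact: openT.
- by move=> k; apply: Ck_onD; [exact: openT|exact: (Ck_on_sin_cos R k).2|exact: Ck_on_cst].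
Qed.

Lemma sphere_meridian_ends : sigma 0 = sigma pi.
Proof.
rewrite /sigma cos0 cospi !gamma_pole//.
  by rewrite normrN normr1; lra.
by rewrite normr1; lra.
Qed.

(** An open condition that contains [[0, pi]]. The derivatives in [sphere_integral] are two-sided,
    so the formula for the sphere must hold slightly beyond the poles, where [sin s] is negative. *)
Let good (s : R) := 0 < sin s \/ 1 / 2 < `|cos s|.

Let spherical_coord s t : [/\ @spherical R s t ord0 o0 = sin s * cos t,
  @spherical R s t ord0 o1 = sin s * sin t & @spherical R s t ord0 o2 = cos s].
Proof. by split; rewrite /spherical /vec3 mxE. Qed.

Let loop_sphereE s t : good s -> loop_sphere (spherical s t) = Psi t (sigma s).
Proof.
have [E0 E1 E2] := spherical_coord s t; case=> [s0|c0].
  rewrite (@loop_sphere_angle _ t) ?E2// E0 E1.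
  by exists (sin s).
by rewrite loop_sphere_pole ?E2// /sigma gamma_pole// fixed.
Qed.

Let good_near (s : R) : good s -> \forall r \near s, good r.
Proof.
case=> [s0|c0].
  near=> r; left; near: r.
  by apply: (cvgr_gt (sin s)) s0; exact: continuous_sin.
near=> r; right; near: r.
apply: (cvgr_gt `|cos s|) c0.
by apply: (@continuous_comp _ _ _ cos (fun y : R => `|y|)); [exact: continuous_cos|exact: norm_continuous].
Unshelve. all: by end_near. Qed.

Let good_itv (s : R) : 0 <= s <= pi -> good s.
Proof.
move=> /sin_ge0_pi s0; have [c0|c0] := ltP (1 / 2) `|cos s|; [by right|left].
rewrite lt_neqAle s0 andbT eq_sym; apply/eqP => E0.
have := cos2Dsin2 s; rewrite E0 expr0n addr0 => E1.
have : `|cos s| ^+ 2 <= (1 / 2) ^+ 2 by rewrite ler_sqr ?nnegrE//; lra.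
by rewrite real_normK ?num_real// E1; lra.
Qed.

Lemma sphere_integralE (w : tensor2 M) : sphere_integral w loop_sphere =
  \int[mu]_(s in `[0, pi]) \int[mu]_(t in `[0, 2 * pi])
    let j := chart_at (Psi t (sigma s)) in
    w j (ccoord j (Psi t (sigma s))) ('D_1 (fun r : R => ccoord j (Psi t (sigma r))) s)
      (X j (ccoord j (Psi t (sigma s)))).
Proof.
apply: eq_Rintegral => s; rewrite inE /= in_itv /= => sI; apply: eq_Rintegral => t _ /=.
have gs := good_itv sI; rewrite (loop_sphereE t gs).
set j := chart_at _; have jt : cdom j (Psi t (sigma s)) by exact: chart_at_dom.
rewrite -(derive_flow_orbit jt) !derive1E; congr (w j _ _ _).
  apply: near_eq_derive; apply: filterS (good_near gs) => r gr.
  by rewrite (loop_sphereE t gr).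
by congr (derive _ t (1 : R)); apply/funext => r; rewrite (loop_sphereE r gs).
Qed.

End Sphere.

(** * The theorem *)

Section SphereValues.
Variables (R : realType) (n : nat) (M : manifold R n) (Psi : smooth_flow M).
Local Notation Ix := (atlas_index M).
Local Notation E := 'rV[R]_n.
Local Notation X := (@generator R n M Psi).
Local Notation mu := (@lebesgue_measure R).
Variable omega : tensor2 M.
Hypothesis w2 : two_form omega.
Hypothesis closed_omega : closed2 omega.
Local Notation alpha := (Defs.contraction X omega).
Hypothesis closed_alpha : closed1 alpha.
Hypothesis Psi_periodic : forall t q, Psi (t + 2 * pi) q = Psi t q.
Variable p : M.
Hypothesis fixed : forall t, Psi t p = p.
Variables (gamma : R -> M) (h : R -> R).
Hypothesis loop : flat_path alpha p p gamma h.

Let sgamma : smooth_into setT gamma. Proof. by have [] := loop. Qed.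
Let pgamma : path_primitive alpha gamma h. Proof. by have [] := loop. Qed.
Let gamma0 t : t <= 0 -> gamma t = p. Proof. by have [_ _ H _] := loop => /H[]. Qed.
Let gamma1 t : 1 <= t -> gamma t = p. Proof. by have [_ _ _ H] := loop => /H[]. Qed.
Let pi20 : 0 < 2 * pi :> R. Proof. by rewrite mulr_gt0// pi_gt0. Qed.

Let theta (s : R) : R := cos s + 1 / 2.
Let sigma := gamma \o theta.
Let ssigma : smooth_into setT sigma := smooth_sphere_meridian sgamma.

(** By invariance the integrand does not depend on [t] and is [- D s], the sign coming from the
    order of the arguments of [omega]. A second sign arises because [theta] descends from [3 / 2] to
    [- 1 / 2], values at which [h] equals [h 1] and [h 0]. *)
Lemma sphere_integral_form : sphere_integral omega (loop_sphere Psi p gamma) = 2 * pi * (h 1 - h 0).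
Proof.
have st : smooth_on setT theta.
  by move=> k; apply: Ck_onD; [exact: openT|exact: (Ck_on_sin_cos R k).2|exact: Ck_on_cst].
have [_ ps] := path_primitive_reparam (fun i x ix => contraction_linear Psi w2 ix) sgamma pgamma st.
pose D (s : R) := 'D_1 (h \o theta) s.
have DE s i : cdom i (sigma s) -> D s = path_speed alpha sigma i s.
  by move=> is_; have [_] := ps s i is_.
have dD (s : R) : is_derive s 1 (h \o theta) (D s).
  by apply: DeriveDef => //; have [] := ps s _ (chart_at_dom (sigma s)).
have cD : continuous D.
  apply: (path_speed_continuous _ _ ssigma ps dD).
    by move=> i x ix; exact: contraction_linear.
  by move=> i v; exact: smooth_contraction.
rewrite (sphere_integralE Psi_periodic fixed gamma0 gamma1).
have dl (a t : R) : is_derive t 1 (fun t => a * t) a.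
  by have := is_deriveZ a (is_derive_id t 1); rewrite [_ *: 1]mulr1.
transitivity (\int[mu]_(s in `[0, pi]) (- (2 * pi) * D s)).
  apply: eq_Rintegral => s _.
  transitivity (\int[mu]_(t in `[0, 2 * pi]) - D s).
    apply: eq_Rintegral => t _ /=.
    pose i := chart_at (sigma s); have is_ : cdom i (sigma s) by exact: chart_at_dom.
    set j := chart_at _; have jt : cdom j (Psi t (sigma s)) by exact: chart_at_dom.
    have d := path_flow_dom is_ jt.
    apply: (etrans (congr1 (fun v => omega j _ v _) (velocity_flow ssigma is_ jt))).
    rewrite -[ccoord j _](path_flow_coord Psi j t is_).
    rewrite (two_form_anti w2 _ _ (flow_coord_cod d)); congr (- _).
    rewrite (DE s i is_) /path_speed.
    exact: (flow_preserves_contraction w2 closed_omega closed_alpha (velocity sigma i s) d).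
  have cs : continuous (fun _ : R => - D s) by move=> t; exact: cst_continuous.
  by rewrite (Rintegral_derive pi20 cs (dl (- D s))); ring.
have cD' : continuous (fun s => - (2 * pi) * D s).
  by move=> s; apply: (@continuousM _ _ (cst (- (2 * pi))) D); [exact: cst_continuous|exact: cD].
have dD' (s : R) : is_derive s 1 (fun s => - (2 * pi) * (h \o theta) s) (- (2 * pi) * D s).
  by have := is_deriveZ (- (2 * pi)) (dD s); exact.
rewrite (Rintegral_derive (pi_gt0 R) cD' dD').
have [_ _ H0 H1] := loop.
have [_ E0] := H0 (-1 + 1 / 2) ltac:(lra); have [_ E1] := H1 (1 + 1 / 2) ltac:(lra).
by rewrite /theta /= cos0 cospi E0 E1; ring.
Qed.

Lemma sphere_integral_c1 (c : tensor2 M) : represents_c1 omega c ->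
  sphere_integral c (loop_sphere Psi p gamma) = 0.
Proof.
move=> [J [A [acs conn ->]]].
rewrite (sphere_integralE Psi_periodic fixed gamma0 gamma1).
exact: (chern_path_integral w2 closed_omega closed_alpha acs conn pi20 Psi_periodic ssigma
  (pi_gt0 R) (sphere_meridian_ends gamma0 gamma1)).
Qed.

Lemma loop_value0 : spherically_monotone omega -> h 1 - h 0 = 0.
Proof.
move=> [lambda [_ [c rc H]]].
have := H _ (smooth_loop_sphere Psi_periodic fixed sgamma gamma0 gamma1).
rewrite sphere_integral_form (sphere_integral_c1 rc) mulr0 => /eqP.
by rewrite mulf_eq0 gt_eqF//= => /eqP.
Qed.

End SphereValues.

(** * Zeros of the generator and maxima of a Hamiltonian *)

Section MaximumFixed.
Variables (R : realType) (n : nat) (M : manifold R n) (Psi : smooth_flow M).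
Local Notation Ix := (atlas_index M).
Local Notation E := 'rV[R]_n.
Local Notation X := (@generator R n M Psi).
Implicit Types (i j : Ix).

(** The velocity of the orbit at time [r] is the image of the generator at [q] under the
    differential of the flow, hence 0. So the orbit is constant for short times, as long as it stays
    in the chart, and the group law carries this to all times. *)
Lemma generator0_fixed i (q : M) : cdom i q -> X i (ccoord i q) = 0 -> forall t, Psi t q = q.
Proof.
move=> iq X0; pose x := ccoord i q.
have d0 : flow_dom Psi i i (0, x).
  by split=> /=; [exact: ccoord_cod|rewrite flow_map0 ccoordK].
have /nbhs_ballP[e /= e0 He] := near_flow_dom d0.
have D0 r : flow_dom Psi i i (r, x) -> 'D_(time_dir R n) (flow_coord Psi i i) (r, x) = 0.
  move=> d; apply: (etrans (derive_flow_time d)).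
  by apply: (etrans (esym (derive_flow_generator d))); rewrite /= X0; exact: derive0.
have small (s : R) : `|s| < e -> Psi s q = q.
  move=> se; have Hs (r : R) : `|r| <= `|s| -> flow_dom Psi i i (r, x).
    by move=> rs; apply: He; rewrite -ball_normE /ball_ /= sub0r normrN (le_lt_trans rs).
  have ds := Hs s (lexx _).
  have yE r : flow_coord Psi i i (r, x) = ccoord i (Psi r q) by rewrite /flow_coord /x /= ccoordK.
  have E1 : ccoord i (Psi s q) = ccoord i (Psi 0 q).
    rewrite -!yE; apply/rowP => k.
    pose f (r : R) := flow_coord Psi i i (r, x) 0 k.
    have df (r : R) : `|r| <= `|s| -> is_derive r 1 f 0.
      move=> /Hs d; have [dy Dy] := is_derive_time (diff_flow_coord d).
      apply: DeriveDef; first exact: (derivable_mxP _ _ _).1 dy 0 k.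
      apply: (etrans (esym (derive_entry 0 k dy))); rewrite Dy (D0 _ d).
      by rewrite mxE.
    have [s0|s0] := leP 0 s.
      apply/esym; apply: (derive0_eq (f := f) s0) => r /andP[r0 rs].
      by apply: df; rewrite !ger0_norm.
    apply: (derive0_eq (f := f) (ltW s0)) => r /andP[rs r0].
    by apply: df; rewrite !ler0_norm ?lerN2// ltW.
  have := congr1 (cparam i) E1; rewrite flow_map0 !ccoordK//.
  by case: ds => _; rewrite /= /x ccoordK.
move=> t.
(* Cuts [t] into [N.+1] equal steps, each short enough for [small]. *)
have [N Nt] : exists N, `|t| / e < N.+1%:R.
  by exists (Num.bound (`|t| / e)); apply: lt_trans (archi_boundP _) _; rewrite ?ltr_nat// divr_ge0// ltW.
have tN : `|t / N.+1%:R| < e.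
  by rewrite normrM normfV normr_nat ltr_pdivrMr// mulrC -ltr_pdivrMr.
have Hm m : Psi (t / N.+1%:R *+ m) q = q.
  elim: m => [|m IH]; first by rewrite mulr0n flow_map0.
  by rewrite mulrS flow_mapD IH small.
by have := Hm N.+1; rewrite -mulr_natr divfK.
Qed.

Variable omega : tensor2 M.
Local Notation alpha := (Defs.contraction X omega).

Lemma exact_fixed : Defs.nondegenerate omega -> compact [set: M] -> [set: M] !=set0 -> exact1 alpha ->
  exists q, forall t, Psi t q = q.
Proof.
move=> nd cM M0 [H sH HE].
have cH : continuous H.
  move=> q; pose i := chart_at q; have iq : cdom i q by exact: chart_at_dom.
  have E0 : \forall z \near q, (H \o cparam i \o ccoord i) z = H z.
    by apply: (open_near (@open_cdom _ _ M i) iq) => z iz; rewrite /= ccoordK.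
  have c0 : {for q, continuous (H \o cparam i \o ccoord i)}.
    apply: continuous_comp; first exact: Defs.coord_continuous.
    by apply: (sH i 0%N); exact: ccoord_cod.
  by rewrite /continuous_at -(nbhs_singleton E0); exact: cvg_trans (near_eq_cvg E0) c0.
have [q _ Hq] := compact_EVT_max M0 cM (continuous_subspaceT cH).
have {}Hq z : H z <= H q by apply: Hq; rewrite inE.
exists q; pose i := chart_at q; have iq : cdom i q by exact: chart_at_dom.
pose x := ccoord i q; have ix : ccod i x by exact: ccoord_cod.
apply: (generator0_fixed iq); apply: (nd i x ix) => v.
apply: (etrans (HE i x ix v)).
have dH z : ccod i z -> differentiable (H \o cparam i) z by exact: (sH i 1%N).1.
pose g (s : R) := (H \o cparam i) (x + s *: v).
have Ex : x + (0 : R) *: v = x by rewrite scale0r addr0.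
have nc : \forall s \near (0 : R), ccod i (x + s *: v).
  have cl : {for (0 : R), continuous (fun s : R => x + s *: v)}.
    by apply: differentiable_continuous; exact: differentiable_line.
  by apply: cl; rewrite Ex; exact: (open_near (@open_ccod _ _ M i) ix).
move: nc => /nbhs_ballP[e /= e0 He].
have dg (s : R) : s \in `](- e), e[ -> is_derive s 1 g ('D_v (H \o cparam i) (x + s *: v)).
  rewrite in_itv /= -ltr_norml => se; apply: is_derive_along; apply: dH; apply: He.
  by rewrite -ball_normE /ball_ /= sub0r normrN.
have i0 : (0 : R) \in `](- e), e[ by rewrite in_itv /= oppr_lt0 e0.
have [|||_ D0] := @derive1_at_max _ g (- e) e 0 _ _ i0.
- by apply: le_trans (ltW e0); rewrite oppr_le0 ltW.
- by move=> s /dg[].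
- by move=> s _; rewrite /g Ex /= [cparam i x]ccoordK.
by have [_] := dg 0 i0; rewrite D0 Ex.
Qed.

End MaximumFixed.

(** * Change of period and conclusion *)

Section MainTheorem.
Variables (R : realType) (n : nat) (M : manifold R n).
Local Notation Ix := (atlas_index M).
Local Notation E := 'rV[R]_n.
Local Notation V := (R^o * 'rV[R]_n)%type.
Implicit Types (i j : Ix).

Definition action_flow (Phi : R -> M -> M) (act : circle_action Phi) : smooth_flow M :=
  let: And4 P0 PD _ PS := act in SmoothFlow P0 PD PS.

Lemma action_flowE Phi (act : circle_action Phi) : action_flow act = Phi :> (R -> M -> M).
Proof. by case: act. Qed.

Lemma rescale_smooth (Psi : smooth_flow M) (a : R) i :
  smooth_into (V := V) (setT `*` @ccod R n M i) (fun tx => Psi (tx.1 * a) (cparam i tx.2)).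
Proof.
have L : linear (fun tx : V => (tx.1 * a, tx.2) : V).
  by move=> b u v; congr pair; rewrite /= mulrDl -scalerAl.
have fV : findim V := findim_prod (findim_R R) (findim_mx R 1 n).
have oD := @open_time_cod _ _ M i.
apply: (@smooth_into_comp _ _ _ _ _ _ _ _ (fun tx : V => (tx.1 * a, tx.2) : V) fV oD oD _ _
  (flow_map_smooth Psi i)).
  by move=> x [_ ix].
move=> k; apply: (@Ck_on_lin _ _ _ _ _ (linear_of L)).
exact: findim_continuous fV.
Qed.

(** Left transparent, so that the rescaled flow simplifies to [Psi (t * a)]. *)
Definition rescale_flow (Psi : smooth_flow M) (a : R) : smooth_flow M.
Proof.
refine (@SmoothFlow R n M (fun t => Psi (t * a)) _ _ (rescale_smooth Psi a)).
- by move=> p; rewrite mul0r flow_map0.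
- by move=> s t p; rewrite mulrDl flow_mapD.
Defined.

Lemma generator_rescale (Psi : smooth_flow M) a i x : ccod i x ->
  generator (rescale_flow Psi a) i x = a *: generator Psi i x.
Proof.
move=> ix; have d := flow_dom0 Psi (overlap_id ix).
have D := is_derive_time (diff_flow_coord d); have [dt _] := D.
pose f (t : R) := flow_coord Psi i i (t, x).
have df : differentiable f (0 * a) by rewrite mul0r; exact/derivable1_diffP.
have dm : differentiable (fun t : R => t * a) 0 by exact/derivable1_diffP.
rewrite /generator !derive1E.
have E1 := @derive_comp _ _ _ _ (fun t : R => t * a) f 0 1 dm df.
apply: (etrans E1).
have -> : 'D_1 (fun t : R => t * a) 0 = a.
  transitivity ('D_1 (fun s : R => (0 : R) + s *: a) 0); last by rewrite derive_line scale1r.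
  by congr (derive _ (0 : R) (1 : R)); apply/funext => t; rewrite add0r.
have df0 : differentiable f 0 by exact/derivable1_diffP.
have := @derive_linear _ _ _ f 0 a 1 0 df0; rewrite derive0 !addr0 mul0r => <-.
by congr (derive _ _ _); exact/esym/mulr1.
Qed.

Lemma contraction_rescale (Psi : smooth_flow M) (omega : tensor2 M) a i x v :
  two_form omega -> ccod i x ->
  Defs.contraction (generator (rescale_flow Psi a)) omega i x v =
  a * Defs.contraction (generator Psi) omega i x v.
Proof.
move=> w2 ix; rewrite /Defs.contraction generator_rescale//.
have Z : omega i x 0 v = 0.
  by have := two_form_linearl w2 ix v (-1) 0 0; rewrite scaler0 addr0 scaleN1r addNr.
by have := two_form_linearl w2 ix v a (generator Psi i x) 0; rewrite Z !addr0.
Qed.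

Lemma closed_contraction_rescale (Psi : smooth_flow M) (omega : tensor2 M) a :
  two_form omega -> closed1 (Defs.contraction (generator Psi) omega) ->
  closed1 (Defs.contraction (generator (rescale_flow Psi a)) omega).
Proof.
move=> w2 cl i x ix u v; pose al := Defs.contraction (generator Psi) omega.
have D w z : 'D_w (fun y => Defs.contraction (generator (rescale_flow Psi a)) omega i y z) x =
    a * 'D_w (fun y => al i y z) x.
  have dz : derivable (fun y => al i y z) x w.
    by apply: diff_derivable; exact: (smooth_contraction Psi w2 i z 1%N).1.
  apply: (etrans _ (deriveZ a dz)); apply: near_eq_derive.
  by apply: (open_near (@open_ccod _ _ M i) ix) => y iy; exact: contraction_rescale.
by rewrite !D -mulrBr (cl i x ix u v) mulr0.
Qed.

End MainTheorem.

Theorem theorem1p6 (R : realType) (n : nat) (M : manifold R n)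
    (M_nonempty : [set: M] !=set0)
    (M_connected : connected [set: M])
    (M_compact : compact [set: M])
    (omega : tensor2 M)
    (omega_symplectic : symplectic_form omega)
    (omega_monotone : spherically_monotone omega)
    (Phi : R -> M -> M)
    (Phi_symplectic : symplectic_action omega Phi) :
  hamiltonian_action omega Phi <-> exists p : M, fixed_point Phi p.
Proof.
have [act closed_alpha] := Phi_symplectic; have [w2 closed_omega nondeg] := omega_symplectic.
pose F := action_flow act.
have FE : F = Phi :> (R -> M -> M) := action_flowE act.
rewrite -FE in closed_alpha.
split=> [[_ ex]|[p fixed]].
  by rewrite -FE in ex; have [q Hq] := exact_fixed nondeg M_compact M_nonempty ex; exists q; rewrite /fixed_point -FE.
split=> //; rewrite -FE.
have pi20 : 0 < 2 * pi :> R by rewrite mulr_gt0// pi_gt0.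
have pin0 : 2 * pi != 0 :> R by rewrite gt_eqF.
(* Stretches the period from 1 to the period [2 * pi] of the longitude. *)
pose Psi := rescale_flow F (2 * pi)^-1.
have Psi_periodic t q : Psi (t + 2 * pi) q = Psi t q.
  by rewrite /= FE mulrDl mulfV//; case: (act) => _ H P1 _; rewrite H P1.
have Psi_fixed t : Psi t p = p by rewrite /= FE; exact: fixed.
have closed_Psi := closed_contraction_rescale (2 * pi)^-1 w2 closed_alpha.
have [H sH HE] : exact1 (Defs.contraction (generator Psi) omega).
  apply: (@potential_exact _ _ _ _ _ _ _ p) => //.
  - by move=> i x ix; exact: contraction_linear.
  - by move=> i j x v ijx; exact: contraction_transition.
  - by move=> i v; exact: smooth_contraction.
  - move=> a [gamma [h [loop ->]]].
    exact: (loop_value0 w2 closed_omega closed_Psi Psi_periodic Psi_fixed loop omega_monotone).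
(* The generator of [Psi] is [(2 * pi)^-1] times that of the action, so its potential is scaled
   back. *)
exists (fun q => 2 * pi * H q).
  by move=> i k; apply: Ck_onM; [exact: open_ccod|exact: Ck_on_cst|exact: (sH i k)].
move=> i x ix v; have dH : derivable (H \o cparam i) x v.
  by apply: diff_derivable; exact: (sH i 1%N).1.
apply: (etrans _ (esym (deriveZ (2 * pi) dH))); rewrite -HE//.
have CE := contraction_rescale F (2 * pi)^-1 v w2 ix.
exact: (etrans (esym (mulVKf pin0 _)) (esym (congr1 ( *%R (2 * pi)) CE))).
Qed.
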